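(* Consider the system $x(k+1)=Ax(k)+w(k)$, $y(k)=Cx(k)+v(k)$ and the two-receiver channel with reception probabilities $p_1$ (user) and $p_2$ (eavesdropper) described in the context, and suppose the following assumption holds: if the sensor sends $\hat y(k)=y(k)$ for all $k\ge 0$, then $\limsup_{k\to\infty}\operatorname{tr}\mathbb{E}\{P_1(k)\}<\infty$ for every initial covariance $\Sigma_0\succ 0$. Consider the family of secrecy mechanisms, parametrized by $p\in[0,1]$, in which independently at each time $k\ge 0$ the sensor sends $\hat y(k)=y(k)$ with probability $p$ and $\hat y(k)=\varepsilon$ (no information) with probability $1-p$. Then perfect expected secrecy is achieved by some mechanism of this family if and only if $$p_1>p_2 .$$ In particular, there exists a probability $p_c\in[0,1)$ such that the probabilities $p\in[0,1]$ whose mechanism guarantees perfect expected secrecy are exactly those satisfying $$\frac{p_c}{p_1}<p\le\min\left\{\frac{p_c}{p_2},\,1\right\}$$ (with the convention $p_c/p_2=+\infty$ if $p_2=0$).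
   Context: System: $x(k)\in\mathbb{R}^n$, $y(k)\in\mathbb{R}^m$, $k\in\mathbb{N}=\{0,1,\dots\}$, $x(k+1)=Ax(k)+w(k)$, $y(k)=Cx(k)+v(k)$. The $w(k)$, $v(k)$ and $x(0)$ are independent zero-mean Gaussian with covariances $Q$, $R$, $\Sigma_0$ respectively, where $Q,R,\Sigma_0\succ 0$ (positive definite; $\succeq$ denotes the positive semidefinite order). The spectral radius satisfies $\rho(A)>1$, $(A,Q^{1/2})$ is stabilizable and $(A,C)$ is detectable. Channel: at each time $k$ the sensor selects a channel input $\hat y(k)\in\mathbb{R}^m\cup\{\varepsilon\}$, where $\varepsilon$ is a symbol meaning ''no information''. There are two outputs, to the user ($i=1$) and the eavesdropper ($i=2$): $\hat y_i(k)=\hat y(k)$ with probability $p_i$ and $\hat y_i(k)=\varepsilon$ with probability $1-p_i$, where $p_1,p_2\in[0,1]$. Receptions are i.i.d. over time and independent across the two outputs, and independent of the random decisions of the sensor's mechanism and of the system's noise and initial state. ''Nothing sent'' and ''packet dropped'' are not distinguished by a receiver (both appear as $\varepsilon$). All parameters and the mechanism are known to both receivers. Estimation errors: for $i=1,2$, let $\hat{\boldsymbol y}_{i,k}=(\hat y_i(0),\dots,\hat y_i(k))$, $\hat x_i(k)=\mathbb{E}\{x(k)\mid\hat{\boldsymbol y}_{i,k}\}$, $P_i(k|k)=\mathbb{E}\{(x(k)-\hat x_i(k))(x(k)-\hat x_i(k))^{\intercal}\mid\hat{\boldsymbol y}_{i,k}\}$, and define the prediction error covariance by $P_i(0)=\Sigma_0$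 and $P_i(k+1)=AP_i(k|k)A^{\intercal}+Q$. It is a random matrix. Perfect expected secrecy: a sensor mechanism achieves (guarantees) perfect expected secrecy if for every initial covariance $\Sigma_0\succ0$ both $\lim_{k\to\infty}\operatorname{tr}\mathbb{E}\{P_2(k)\}=\infty$ and $\limsup_{k\to\infty}\operatorname{tr}\mathbb{E}\{P_1(k)\}<\infty$. *)

(* Defs.v *)
From HB Require Import structures.
From mathcomp Require Import all_boot all_order all_algebra.
From mathcomp Require Import all_classical all_reals all_analysis.
From mathcomp Require Import complex.

Set Implicit Arguments.
Unset Strict Implicit.
Unset Printing Implicit Defensive.

Import Order.TTheory GRing.Theory Num.Theory.
Import numFieldNormedType.Exports.

Local Open Scope complex_scope.
Local Open Scope classical_set_scope.
Local Open Scope ring_scope.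

Definition qform (R : realType) (n : nat) (M : 'M[R]_n) (u : 'cV[R]_n) : R :=
  (u^T *m M *m u) 0 0.

Definition posdef (R : realType) (n : nat) (M : 'M[R]_n) : Prop :=
  M^T = M /\ forall u : 'cV[R]_n, u != 0 -> 0 < qform M u.

Definition possemidef (R : realType) (n : nat) (M : 'M[R]_n) : Prop :=
  M^T = M /\ forall u : 'cV[R]_n, 0 <= qform M u.

Definition is_psd_sqrt (R : realType) (n : nat) (M S : 'M[R]_n) : Prop :=
  possemidef S /\ S *m S = M.

(* The eigenvalues are the complex ones. *)
Definition spectral_radius (R : realType) (n : nat) (A : 'M[R]_n) : R :=
  let Ac : 'M[R[i]]_n := map_mx (real_complex R) A in
  sup [set complex.Re `|z| | z in [set z | eigenvalue Ac z]].

Definition stabilizable (R : realType) (n r : nat)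
    (A : 'M[R]_n) (B : 'M[R]_(n, r)) : Prop :=
  exists K : 'M[R]_(r, n), spectral_radius (A + B *m K) < 1.

Definition detectable (R : realType) (n m : nat)
    (A : 'M[R]_n) (C : 'M[R]_(m, n)) : Prop :=
  exists L : 'M[R]_(n, m), spectral_radius (A + L *m C) < 1.

(* X is a zero-mean Gaussian vector with covariance S: every linear functional
   u^T X has the normal law N(0, u^T S u).  The second parameter of
   [normal_prob] is the standard deviation, and its value at 0 is not a Dirac
   mass; hence u != 0, and S is meant to be positive definite. *)
Definition centered_gaussian (R : realType) (d : measure_display)
    (T : measurableType d) (P : probability T R) (n : nat)
    (X : T -> 'cV[R]_n) (S : 'M[R]_n) : Prop :=
  (forall l : 'I_n, measurable_fun setT (fun t => X t l 0)) /\
  forall u : 'cV[R]_n, u != 0 -> forall B : set R, measurable B ->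
    pushforward P (fun t => (u^T *m X t) 0 0) B
      = normal_prob 0 (Num.sqrt (qform S u)) B.

Definition bernoulli_event (R : realType) (d : measure_display)
    (T : measurableType d) (P : probability T R) (b : T -> bool) (p : R) : Prop :=
  measurable [set t | b t] /\ P [set t | b t] = p%:E.

Definition sigma_vec (R : realType) (T : Type) (n : nat) (X : T -> 'cV[R]_n) :
    set (set T) :=
  <<s [set E | exists (l : 'I_n) (B : set R),
         measurable B /\ E = (fun t => X t l 0) @^-1` B] >>.

Definition sigma_bool (T : Type) (b : T -> bool) : set (set T) :=
  [set E | exists B : set bool, E = b @^-1` B].

Definition mutually_independent (R : realType) (d : measure_display)
    (T : measurableType d) (P : probability T R) (I : eqType)
    (F : I -> set (set T)) : Prop :=
  forall (J : seq I) (E : I -> set T), uniq J ->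
    (forall i, i \in J -> F i (E i)) ->
    P (\bigcap_(i in [set i | i \in J]) E i) = (\prod_(i <- J) P (E i))%E.

(* Z is a version of the conditional expectation E{X | G}. *)
Definition is_cond_exp (R : realType) (d : measure_display)
    (T : measurableType d) (P : probability T R)
    (G : set (set T)) (X Z : T -> R) : Prop :=
  [/\ forall B : set R, measurable B -> G (Z @^-1` B),
      P.-integrable setT (EFin \o Z)
    & forall E : set T, G E ->
        (\int[P]_(t in E) (Z t)%:E = \int[P]_(t in E) (X t)%:E)%E].

(* A chosen version; the default 0 is never used when X is integrable and G is
   a sub-sigma-algebra, since then a version exists. *)
Definition cond_exp (R : realType) (d : measure_display)
    (T : measurableType d) (P : probability T R)
    (G : set (set T)) (X : T -> R) : T -> R :=
  xget (cst 0) [set Z | is_cond_exp P G X Z].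

Inductive receiver := user | eavesdropper.

Inductive source :=
  | InitialState
  | ProcessNoise of nat
  | MeasurementNoise of nat
  | SensorDecision of nat
  | Reception of receiver & nat.

HB.instance Definition _ := gen_eqMixin source.

(* A probability space carrying all the random elements; [decision p k] is the
   event that the mechanism with parameter p sends y(k) at time k, and
   [reception i k] the event that the channel to receiver i does not drop at
   time k.  The decisions for different p live on the same space, but no joint
   law across different p is prescribed. *)
Record realization (R : realType) (n m : nat) := Realization {
  disp_of : measure_display;
  Omega : measurableType disp_of;
  Pr : probability Omega R;
  init_state : Omega -> 'cV[R]_n;
  process_noise : nat -> Omega -> 'cV[R]_n;
  meas_noise : nat -> Omega -> 'cV[R]_m;
  decision : R -> nat -> Omega -> bool;
  reception : receiver -> nat -> Omega -> bool }.

Arguments init_state {R n m} _.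
Arguments process_noise {R n m} _.
Arguments meas_noise {R n m} _.
Arguments decision {R n m} _.
Arguments reception {R n m} _.

Definition source_sigma (R : realType) (n m : nat) (M : realization R n m)
    (p : R) (s : source) : set (set (Omega M)) :=
  match s with
  | InitialState => sigma_vec (init_state M)
  | ProcessNoise k => sigma_vec (process_noise M k)
  | MeasurementNoise k => sigma_vec (meas_noise M k)
  | SensorDecision k => sigma_bool (decision M p k)
  | Reception i k => sigma_bool (reception M i k)
  end.

Arguments source_sigma {R n m} M p s.

Definition realization_law (R : realType) (n m : nat) (Q : 'M[R]_n)
    (Rv : 'M[R]_m) (p1 p2 : R) (S0 : 'M[R]_n) (M : realization R n m) : Prop :=
  [/\ centered_gaussian (Pr M) (init_state M) S0,
      forall k, centered_gaussian (Pr M) (process_noise M k) Q,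
      forall k, centered_gaussian (Pr M) (meas_noise M k) Rv,
      forall k, bernoulli_event (Pr M) (reception M user k) p1 /\
                bernoulli_event (Pr M) (reception M eavesdropper k) p2
    & forall p : R, 0 <= p <= 1 ->
        (forall k, bernoulli_event (Pr M) (decision M p k) p) /\
        mutually_independent (Pr M) (source_sigma M p)].

Section process.
Context (R : realType) (n m : nat).
Variables (A : 'M[R]_n) (C : 'M[R]_(m, n)) (Q S0 : 'M[R]_n).
Variable M : realization R n m.
Variable send : nat -> Omega M -> bool.

Fixpoint state (k : nat) (t : Omega M) : 'cV[R]_n :=
  if k is j.+1 then A *m state j t + process_noise M j t else init_state M t.

Definition measurement (k : nat) (t : Omega M) : 'cV[R]_m :=
  C *m state k t + meas_noise M k t.

(* [None] is the symbol epsilon. *)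
Definition channel_input (k : nat) (t : Omega M) : option 'cV[R]_m :=
  if send k t then Some (measurement k t) else None.

Definition channel_output (i : receiver) (k : nat) (t : Omega M) :
    option 'cV[R]_m :=
  if reception M i k t then channel_input k t else None.

(* The sigma-algebra generated by the channel outputs 0, ..., k, for the
   disjoint-union Borel structure on R^m + {epsilon}. *)
Definition information (i : receiver) (k : nat) : set (set (Omega M)) :=
  <<s [set E | exists2 j : nat, (j <= k)%N &
         E = channel_output i j @^-1` [set None] \/
         exists (l : 'I_m) (B : set R), measurable B /\
           E = channel_output i j @^-1` (Some @` [set z : 'cV[R]_m | B (z l 0)])] >>.

Definition estimate (i : receiver) (k : nat) (t : Omega M) : 'cV[R]_n :=
  \col_l cond_exp (Pr M) (information i k) (fun s => state k s l 0) t.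

Definition error (i : receiver) (k : nat) (t : Omega M) : 'cV[R]_n :=
  state k t - estimate i k t.

Definition filtering_cov (i : receiver) (k : nat) (t : Omega M) : 'M[R]_n :=
  \matrix_(a, b) cond_exp (Pr M) (information i k)
    (fun s => (error i k s *m (error i k s)^T) a b) t.

Definition prediction_cov (i : receiver) (k : nat) (t : Omega M) : 'M[R]_n :=
  if k is j.+1 then A *m filtering_cov i j t *m A^T + Q else S0.

Definition mean_prediction_cov (i : receiver) (k : nat) : 'M[R]_n :=
  \matrix_(a, b) fine 'E_(Pr M)[fun t => prediction_cov i k t a b]%E.

Definition expected_trace (i : receiver) (k : nat) : R :=
  \tr (mean_prediction_cov i k).

End process.

Definition limsup_finite (R : realType) (u : nat -> R) : Prop :=
  (limn_esup (fun k => (u k)%:E) < +oo)%E.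

(* A sensor mechanism is given by its decision variables on each of the
   realizations M S0, one for every initial covariance S0. *)
Definition mechanism (R : realType) (n m : nat)
    (M : 'M[R]_n -> realization R n m) : Type :=
  forall S0 : 'M[R]_n, nat -> Omega (M S0) -> bool.

Definition always_send (R : realType) (n m : nat)
    (M : 'M[R]_n -> realization R n m) : mechanism M :=
  fun S0 k t => true.

Definition random_send (R : realType) (n m : nat)
    (M : 'M[R]_n -> realization R n m) (p : R) : mechanism M :=
  fun S0 => decision (M S0) p.

Arguments always_send {R n m} M.
Arguments random_send {R n m} M p.

Definition perfect_expected_secrecy (R : realType) (n m : nat)
    (A : 'M[R]_n) (C : 'M[R]_(m, n)) (Q : 'M[R]_n)
    (M : 'M[R]_n -> realization R n m) (s : mechanism M) : Prop :=
  forall S0 : 'M[R]_n, posdef S0 ->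
    (expected_trace A C Q S0 (s S0) eavesdropper k @[k --> \oo] --> +oo) /\
    limsup_finite (expected_trace A C Q S0 (s S0) user).

Definition div_or_pinfty (R : realType) (a b : R) : \bar R :=
  if b == 0 then +oo%E else (a / b)%:E.

(* Main.v *)
Require Import Defs.
From mathcomp Require Import all_boot all_order all_algebra.
From mathcomp Require Import all_classical all_reals all_analysis.
From mathcomp Require Import measurable_realfun.
From mathcomp Require Import complex ring lra.

(* Conditionally on which packets arrive, the error covariance follows the
   Kalman recursion, so tr E{P_i(k)} is the mean trace of a Riccati iteration
   driven by independent Bernoulli(q) arrivals, with q = p p_i.

   To see this, note that the noises are jointly Gaussian, so the Kalman error is
   uncorrelated with the past measurements, and cos(e), cos(y) then satisfy the
   product formula of independent variables for linear forms e, y of the noises.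
   A limit gives E[e cos(y)] = 0 and E[(e^2 - var e) cos(y)] = 0, and a
   function orthogonal to all cosines cos(y + a) is orthogonal to every event
   generated by the y's.  Hence the Kalman estimate and covariance are the
   conditional ones.

   The mean trace is nonincreasing in q and superadditive in (Q, V, X).  It grows
   without bound for some q > 0 since A is unstable; boundedness at q and
   superadditivity yield a contraction after finitely many steps, which persists
   for slightly smaller q.  So the bounded regime is exactly pc < q for some
   0 < pc < p1, unboundedness means divergence to infinity, and secrecy is
   equivalent to p p2 <= pc < p p1. *)

Set Implicit Arguments.
Unset Strict Implicit.
Unset Printing Implicit Defensive.

Import Order.TTheory GRing.Theory Num.Theory.
Import numFieldNormedType.Exports.

Local Open Scope classical_set_scope.
Local Open Scope ring_scope.

(** * Quadratic forms and the Riccati recursion *)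

Section quadratic_forms.
Variable R : realType.
Implicit Types (n m : nat).

(** The covariance after an arrival is the minimum, over all gains L, of the Joseph form, which for
    fixed L is linear in (V, X). Monotonicity, superadditivity and homogeneity of the Riccati step
    therefore all follow by inserting a convenient, possibly suboptimal gain.

    On the probabilistic side the obstacle is that the information of a receiver mixes arrivals with
    measurements, while Gaussian laws are given only through scalar functionals. Both are met by
    carrying an event G independent of the noises, later an arrival pattern, through integrals of
    cosines and sines, so that each step is an identity between scalar integrals. The estimate and
    the covariance are moreover arbitrary versions of conditional expectations, so they are matched
    with the Kalman filter only almost everywhere, and the expectations are then computed as finite
    sums over arrival patterns.

    The set of q with bounded mean trace has no least element, so pc itself belongs to the unbounded
    regime. This is why the window for p is open on the left (user) and closed on the right
    (eavesdropper). *)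

Definition bform n (M : 'M[R]_n) (u v : 'cV[R]_n) : R := (u^T *m M *m v) 0 0.

Definition lemx n (X Y : 'M[R]_n) : Prop :=
  forall u : 'cV[R]_n, qform X u <= qform Y u.

Lemma lexmx n (X : 'M[R]_n) : lemx X X.
Proof. by move=> u. Qed.

Lemma qformE n (M : 'M[R]_n) u : qform M u = bform M u u.
Proof. by []. Qed.

Lemma bformDl n (M : 'M[R]_n) u v w : bform M (u + v) w = bform M u w + bform M v w.
Proof. by rewrite /bform linearD /= !mulmxDl mxE. Qed.

Lemma bformDr n (M : 'M[R]_n) u v w : bform M w (u + v) = bform M w u + bform M w v.
Proof. by rewrite /bform mulmxDr mxE. Qed.

Lemma bformZl n (M : 'M[R]_n) a u v : bform M (a *: u) v = a * bform M u v.
Proof. by rewrite /bform linearZ /= -!scalemxAl mxE. Qed.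

Lemma bformZr n (M : 'M[R]_n) a u v : bform M u (a *: v) = a * bform M u v.
Proof. by rewrite /bform -!scalemxAr mxE. Qed.

Lemma bformC n (M : 'M[R]_n) u v : M^T = M -> bform M u v = bform M v u.
Proof.
move=> sM; rewrite /bform.
have -> : u^T *m M *m v = (v^T *m M *m u)^T.
  by rewrite !trmx_mul trmxK sM mulmxA.
by rewrite mxE.
Qed.

Lemma bformDm n (M N : 'M[R]_n) u v : bform (M + N) u v = bform M u v + bform N u v.
Proof. by rewrite /bform mulmxDr mulmxDl mxE. Qed.

Lemma bformZm n a (M : 'M[R]_n) u v : bform (a *: M) u v = a * bform M u v.
Proof. by rewrite /bform -scalemxAr -scalemxAl mxE. Qed.

Lemma bform_conj n m (M : 'M[R]_n) (B : 'M[R]_(m, n)) u v :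
  bform (B *m M *m B^T) u v = bform M (B^T *m u) (B^T *m v).
Proof. by rewrite /bform trmx_mul trmxK !mulmxA. Qed.

Lemma bform0 n (u v : 'cV[R]_n) : bform 0 u v = 0.
Proof. by rewrite /bform mulmx0 mul0mx mxE. Qed.

Lemma bform0l n (M : 'M[R]_n) v : bform M 0 v = 0.
Proof. by rewrite /bform trmx0 !mul0mx mxE. Qed.

Lemma bform0r n (M : 'M[R]_n) v : bform M v 0 = 0.
Proof. by rewrite /bform mulmx0 mxE. Qed.

Lemma bform_delta n (M : 'M[R]_n) i j :
  bform M (delta_mx i 0) (delta_mx j 0) = M i j.
Proof. by rewrite /bform trmx_delta -rowE -colE !mxE. Qed.

Lemma possemidef_ge0 n (M : 'M[R]_n) u : possemidef M -> 0 <= bform M u u.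
Proof. by move=> [_]; apply. Qed.

Lemma posdef_possemidef n (M : 'M[R]_n) : posdef M -> possemidef M.
Proof.
move=> [sM pM]; split=> // u; have [->|/pM/ltW//] := eqVneq u 0.
by rewrite qformE bform0r.
Qed.

Lemma possemidefD n (M N : 'M[R]_n) :
  possemidef M -> possemidef N -> possemidef (M + N).
Proof.
move=> [sM pM] [sN pN]; split; first by rewrite linearD /= sM sN.
by move=> u; rewrite qformE bformDm addr_ge0 // -qformE.
Qed.

Lemma posdefDl n (M N : 'M[R]_n) :
  possemidef M -> posdef N -> posdef (M + N).
Proof.
move=> [sM pM] [sN pN]; split; first by rewrite linearD /= sM sN.
move=> u u0; rewrite qformE bformDm; apply: ltr_wpDl; rewrite -qformE //.
exact: pN.
Qed.

Lemma possemidefZ n a (M : 'M[R]_n) : 0 <= a -> possemidef M -> possemidef (a *: M).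
Proof.
move=> a0 [sM pM]; split; first by rewrite linearZ /= sM.
by move=> u; rewrite qformE bformZm mulr_ge0 // -qformE.
Qed.

Lemma posdefZ n a (M : 'M[R]_n) : 0 < a -> posdef M -> posdef (a *: M).
Proof.
move=> a0 [sM pM]; split; first by rewrite linearZ /= sM.
by move=> u u0; rewrite qformE bformZm mulr_gt0 // -qformE pM.
Qed.

Lemma possemidef0 n : possemidef (0 : 'M[R]_n).
Proof. by split; [rewrite trmx0|move=> u; rewrite qformE bform0]. Qed.

Lemma possemidef_conj n m (M : 'M[R]_n) (B : 'M[R]_(m, n)) :
  possemidef M -> possemidef (B *m M *m B^T).
Proof.
move=> [sM pM]; split; first by rewrite !trmx_mul trmxK sM mulmxA.
by move=> u; rewrite qformE bform_conj; exact: pM.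
Qed.

Lemma posdef_unit n (M : 'M[R]_n) : posdef M -> M \in unitmx.
Proof.
move=> [_ pM]; rewrite -row_free_unit -kermx_eq0.
apply/rowV0P => v /sub_kermxP vM0; apply/eqP/negPn/negP => v0.
have /pM : v^T != 0 by rewrite trmx_eq0.
by rewrite /qform trmxK vM0 mul0mx mxE ltxx.
Qed.

Lemma bform_cauchy_schwarz n (M : 'M[R]_n) u v : posdef M ->
  bform M u v ^+ 2 <= bform M u u * bform M v v.
Proof.
move=> pM; have [sM qM] := pM.
have [->|u0] := eqVneq u 0; first by rewrite !bform0l expr0n mul0r.
have uu : 0 < bform M u u by exact: qM.
have := possemidef_ge0 (v - (bform M u v / bform M u u) *: u) (posdef_possemidef pM).
rewrite -scaleNr !(bformDl, bformDr) !(bformZl, bformZr) (bformC v u sM).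
set x := bform M u v; set a := bform M u u; set b := bform M v v.
rewrite [X in 0 <= X](_ : _ = (a * b - x ^+ 2) / a); last first.
  by rewrite -/a -/x in uu *; field; rewrite gt_eqF.
by rewrite pmulr_lge0 ?invr_gt0// subr_ge0.
Qed.

(** In the inner product given by M, the coordinate [u i 0] is the product of u with [w i], the
    image of a basis vector under [invmx M]. Cauchy-Schwarz bounds it, and D majorizes the squared
    norms of all [w i]. *)
Lemma coord_le_qform n (M : 'M[R]_n) : posdef M ->
  exists2 D : R, 0 < D & forall (u : 'cV[R]_n) i, u i 0 ^+ 2 <= D * bform M u u.
Proof.
move=> pM; have uM := posdef_unit pM; have [sM _] := pM.
pose w i : 'cV[R]_n := invmx M *m delta_mx i 0.
have wE (u : 'cV[R]_n) i : u i 0 = bform M (w i) u.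
  rewrite /bform /w trmx_mul trmx_inv sM -!mulmxA (mulmxA (invmx M)) mulVmx //.
  by rewrite mul1mx trmx_delta -rowE mxE.
have w0 i : 0 <= bform M (w i) (w i).
  exact: possemidef_ge0 (posdef_possemidef pM).
exists (1 + \sum_i bform M (w i) (w i)).
  by rewrite ltr_pwDl // sumr_ge0.
move=> u i; rewrite wE; apply: le_trans (bform_cauchy_schwarz _ _ pM) _.
rewrite ler_wpM2r ?possemidef_ge0 //; first exact: posdef_possemidef.
rewrite (bigD1 i) //= addrCA lerDl addr_ge0 // sumr_ge0 //.
Qed.

Lemma bform_sum n (M : 'M[R]_n) u v :
  bform M u v = \sum_i \sum_j u i 0 * M i j * v j 0.
Proof.
rewrite /bform -mulmxA mxE; apply: eq_bigr => i _; rewrite mxE mxE big_distrr /=.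
by apply: eq_bigr => j _; rewrite mulrA.
Qed.

(** Positivity at u_i e_i - u_j e_j bounds each off-diagonal term by the mean of two diagonal
    ones. *)
Lemma possemidef_le_diag n (X : 'M[R]_n) u : possemidef X ->
  bform X u u <= n%:R * \sum_i X i i * u i 0 ^+ 2.
Proof.
move=> pX; have [sX _] := pX.
have ij i j : u i 0 * X i j * u j 0 <=
    2^-1 * (X i i * u i 0 ^+ 2) + 2^-1 * (X j j * u j 0 ^+ 2).
  have := possemidef_ge0 (u i 0 *: delta_mx i 0 - u j 0 *: delta_mx j 0) pX.
  rewrite -scaleNr !(bformDl, bformDr) !(bformZl, bformZr) !bform_delta.
  have -> : X j i = X i j by rewrite -{1}sX mxE.
  rewrite -subr_ge0 => H; rewrite -subr_ge0.
  rewrite [X in 0 <= X](_ : _ = 2^-1 * (X i i * u i 0 ^+ 2 + X j j * u j 0 ^+ 2 - 2 * (u i 0 * X i j * u j 0))); last by field.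
  rewrite mulr_ge0 ?invr_ge0 //; lra.
rewrite bform_sum; apply: le_trans (ler_sum _ (fun i _ => ler_sum _ (fun j _ => ij i j))) _.
under eq_bigr => i _ do rewrite big_split /= sumr_const card_ord -big_distrr /=.
rewrite big_split /= sumrMnl sumr_const card_ord -big_distrr /=.
rewrite -mulrnDl; set t := \sum_(i < n) _.
by rewrite -[leLHS]mulr_natl (_ : _ + _ = t) //; field.
Qed.

Lemma mxtrace_bform n (X : 'M[R]_n) :
  \tr X = \sum_i bform X (delta_mx i 0) (delta_mx i 0).
Proof. by apply: eq_bigr => i _; rewrite bform_delta. Qed.

Lemma le_mxtrace n (X Y : 'M[R]_n) : lemx X Y -> \tr X <= \tr Y.
Proof. by move=> XY; rewrite !mxtrace_bform; apply: ler_sum => i _; exact: XY. Qed.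

Lemma mxtrace_ge0 n (X : 'M[R]_n) : possemidef X -> 0 <= \tr X.
Proof. by move=> pX; rewrite mxtrace_bform sumr_ge0 // => i _; exact: possemidef_ge0. Qed.

(** The trace controls the diagonal of X, and M controls the coordinates. This is how an arbitrary
    covariance is compared with a multiple of Q. *)
Lemma lemx_mxtrace n (M : 'M[R]_n) : posdef M ->
  exists2 c : R, 0 < c & forall X : 'M[R]_n, possemidef X -> lemx X ((c * \tr X) *: M).
Proof.
move=> pM; have [D D0 DP] := coord_le_qform pM.
exists (n%:R * D + 1); first by rewrite ltr_wpDl // mulr_ge0 // ltW.
move=> X pX u; rewrite qformE; apply: le_trans (possemidef_le_diag u pX) _.
rewrite qformE bformZm mulrDl mul1r mulrDl.
have MM : 0 <= bform M u u by exact: possemidef_ge0 (posdef_possemidef pM).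
rewrite -[leLHS]addr0 lerD //; last by rewrite mulr_ge0 // mxtrace_ge0.
rewrite -!mulrA ler_wpM2l // mulrCA /mxtrace mulr_suml ler_sum // => i _.
by rewrite ler_wpM2l // -[X i i]bform_delta possemidef_ge0.
Qed.

End quadratic_forms.

(** * The Riccati step: optimality of the gain and its consequences *)

Section riccati.
Variables (R : realType) (n m : nat).
Variables (A : 'M[R]_n) (C : 'M[R]_(m, n)).
Implicit Types (Q X Y Z : 'M[R]_n) (V : 'M[R]_m) (g : bool).

Definition gain V X : 'M[R]_(n, m) := X *m C^T *m invmx (C *m X *m C^T + V).

(** The Joseph form: the error covariance after a correction with an arbitrary gain L. *)
Definition joseph V (L : 'M[R]_(n, m)) X : 'M[R]_n :=
  (1%:M - L *m C) *m X *m (1%:M - L *m C)^T + L *m V *m L^T.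

Definition filter_cov V g X : 'M[R]_n := if g then joseph V (gain V X) X else X.

Definition riccati_step Q V g X : 'M[R]_n := A *m filter_cov V g X *m A^T + Q.

Lemma innovation_posdef V X : posdef V -> possemidef X ->
  posdef (C *m X *m C^T + V).
Proof. by move=> pV pX; apply: posdefDl => //; exact: possemidef_conj. Qed.

(** The normal equation K (C X C^T + V) = X C^T of the optimal gain, regrouped. It expresses that
    the corrected error is uncorrelated with the measurement, and returns in this role for the
    noises. *)
Lemma gain_orthogonal V X : posdef V -> possemidef X ->
  (1%:M - gain V X *m C) *m X *m C^T = gain V X *m V.
Proof.
move=> pV pX; have uS := posdef_unit (innovation_posdef pV pX).
have /eqP : gain V X *m (C *m X *m C^T + V) = X *m C^T.
  by rewrite /gain -mulmxA mulVmx // mulmx1.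
rewrite mulmxDr eq_sym [X in _ == X]addrC -subr_eq => /eqP <-.
by rewrite !mulmxBl mul1mx !mulmxA.
Qed.

(** Completing the square in L: the terms linear in [L - gain V X] cancel by [gain_orthogonal] and
    its transpose. Hence [gain V X] minimizes the Joseph form. *)
Lemma joseph_square V L X : posdef V -> possemidef X ->
  joseph V L X = joseph V (gain V X) X +
    (L - gain V X) *m (C *m X *m C^T + V) *m (L - gain V X)^T.
Proof.
move=> pV pX; have [sV _] := pV; have [sX _] := pX.
set K := gain V X; set D := L - K; have -> : L = K + D by rewrite addrC subrK.
have o1 := gain_orthogonal pV pX.
have o2 : C *m X *m (1%:M - K *m C)^T = V *m K^T.
  by have := congr1 trmx o1; rewrite -/K !trmx_mul trmxK sX sV mulmxA.
rewrite -/K in o1; rewrite /joseph.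
have -> : 1%:M - (K + D) *m C = (1%:M - K *m C) - D *m C.
  by rewrite mulmxDl opprD addrA.
set F := 1%:M - K *m C in o1 o2 *; clearbody F D K.
rewrite ![(_ + D)^T]linearD /= ![(_ - _ *m C)^T]linearB /=.
rewrite !trmx_mul !(mulmxDl, mulmxDr, mulmxBl, mulmxBr).
rewrite !(mulmxN, mulNmx).
have -> : F *m X *m (C^T *m D^T) = K *m V *m D^T by rewrite mulmxA o1.
have -> : D *m C *m X *m F^T = D *m V *m K^T by rewrite -(mulmxA D C) -(mulmxA D) o2 mulmxA.
rewrite !mulmxA; set a := F *m X *m F^T; set b := D *m V *m K^T.
set c := K *m V *m D^T; set d := D *m C *m X *m C^T *m D^T.
set e := K *m V *m K^T; set f := D *m V *m D^T.
apply/matrixP => i j; rewrite !mxE; ring.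
Qed.

Lemma joseph_possemidef V L X : possemidef V -> possemidef X ->
  possemidef (joseph V L X).
Proof. by move=> pV pX; apply: possemidefD; exact: possemidef_conj. Qed.

Lemma filter_cov_possemidef V g X : posdef V -> possemidef X ->
  possemidef (filter_cov V g X).
Proof.
by move=> /posdef_possemidef pV pX; case: g => //=; exact: joseph_possemidef.
Qed.

Lemma step_possemidef Q V g X : possemidef Q -> posdef V -> possemidef X ->
  possemidef (riccati_step Q V g X).
Proof.
move=> pQ pV pX; apply: possemidefD => //; apply: possemidef_conj.
exact: filter_cov_possemidef.
Qed.

Lemma filter_cov_le_joseph V L X : posdef V -> possemidef X ->
  lemx (filter_cov V true X) (joseph V L X).
Proof.
move=> pV pX u; rewrite (joseph_square L pV pX) !qformE bformDm lerDl.
apply: possemidef_ge0; apply: possemidef_conj.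
exact/posdef_possemidef/innovation_posdef.
Qed.

Lemma lemx_conj k (B : 'M[R]_(k, n)) X Y :
  lemx X Y -> lemx (B *m X *m B^T) (B *m Y *m B^T).
Proof. by move=> XY u; rewrite !qformE !bform_conj; exact: XY. Qed.

Lemma lemx_step Q V g X (F : bool -> 'M[R]_n) :
  (forall b, lemx (filter_cov V b X) (F b)) ->
  lemx (riccati_step Q V g X) (A *m F g *m A^T + Q).
Proof.
by move=> /(_ g) H u; rewrite !qformE !bformDm lerD2r; exact: lemx_conj.
Qed.

(** The gain optimal for (W, Y) can be used for (V, X), and with a fixed gain the Joseph form is
    monotone. *)
Lemma lemx_filter_cov V W g X Y : posdef V -> posdef W ->
  possemidef X -> possemidef Y -> lemx V W -> lemx X Y ->
  lemx (filter_cov V g X) (filter_cov W g Y).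
Proof.
move=> pV pW pX pY VW XY; case: g => // u.
apply: le_trans (filter_cov_le_joseph (gain W Y) pV pX u) _.
rewrite /= !qformE /joseph !bformDm lerD // !bform_conj; [exact: XY|exact: VW].
Qed.

Lemma lemx_step2 Q V W g X Y : posdef V -> posdef W ->
  possemidef X -> possemidef Y -> lemx V W -> lemx X Y ->
  lemx (riccati_step Q V g X) (riccati_step Q W g Y).
Proof.
move=> pV pW pX pY VW XY.
by apply: (@lemx_step Q V g X (fun b => filter_cov W b Y)) => b; exact: lemx_filter_cov.
Qed.

Lemma le_step Q V g X : posdef V -> possemidef X -> lemx Q (riccati_step Q V g X).
Proof.
move=> pV pX u; rewrite /riccati_step !qformE bformDm lerDr.
by apply: possemidef_ge0; apply: possemidef_conj; exact: filter_cov_possemidef.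
Qed.

Lemma josephD V1 V2 L X1 X2 :
  joseph (V1 + V2) L (X1 + X2) = joseph V1 L X1 + joseph V2 L X2.
Proof.
by rewrite /joseph !mulmxDr !mulmxDl addrACA.
Qed.

Lemma josephZ a V L X : joseph (a *: V) L (a *: X) = a *: joseph V L X.
Proof. by rewrite /joseph -!scalemxAr -!scalemxAl scalerDr. Qed.

(** A minimum of linear functions is superadditive: the gain optimal for the sum is admissible for
    each summand. *)
Lemma filter_covD V1 V2 g X1 X2 : posdef V1 -> posdef V2 ->
  possemidef X1 -> possemidef X2 ->
  lemx (filter_cov V1 g X1 + filter_cov V2 g X2)
       (filter_cov (V1 + V2) g (X1 + X2)).
Proof.
move=> pV1 pV2 pX1 pX2; case: g; last by move=> u; exact: lexx.
move=> u.
rewrite [filter_cov (_ + _) _ _]/filter_cov josephD !qformE.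
rewrite (bformDm (filter_cov _ _ _)) (bformDm (joseph _ _ _)).
by rewrite lerD // -!qformE; exact: filter_cov_le_joseph.
Qed.

Lemma filter_covZ a V g X : 0 < a -> posdef V -> possemidef X ->
  lemx (filter_cov (a *: V) g (a *: X)) (a *: filter_cov V g X).
Proof.
move=> a0 pV pX; case: g; last by move=> u; exact: lexx.
move=> u.
have pV' := posdefZ a0 pV; have pX' := possemidefZ (ltW a0) pX.
apply: le_trans (filter_cov_le_joseph (gain V X) pV' pX' u) _.
by rewrite josephZ.
Qed.

(** Losing a packet amounts to correcting with the gain 0. *)
Lemma step_false_ge Q V g X : posdef V -> possemidef X ->
  lemx (riccati_step Q V g X) (riccati_step Q V false X).
Proof.
move=> pV pX; apply: (@lemx_step Q V g X (fun=> X)) => -[] u; last exact: lexx.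
apply: le_trans (filter_cov_le_joseph 0 pV pX u) _.
by rewrite /joseph !mul0mx subr0 trmx1 mulmx1 mul1mx addr0.
Qed.

End riccati.

(** * The mean trace under Bernoulli arrivals *)

Section mean_trace.
Variables (R : realType) (n m : nat).
Variables (A : 'M[R]_n) (C : 'M[R]_(m, n)).
Implicit Types (Q X Y Z : 'M[R]_n) (V W : 'M[R]_m) (g : bool) (q : R).

Local Notation step := (riccati_step A C).

(* Mean trace of the k-th Riccati iterate of X when the arrivals are independent
   Bernoulli(q); the recursion conditions on the first arrival. *)
Fixpoint mean_trace Q V q k X : R :=
  if k is j.+1 then
    q * mean_trace Q V q j (step Q V true X) +
    (1 - q) * mean_trace Q V q j (step Q V false X)
  else \tr X.

Lemma ler_mix q (a b c d : R) : 0 <= q <= 1 -> a <= c -> b <= d ->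
  q * a + (1 - q) * b <= q * c + (1 - q) * d.
Proof.
by move=> /andP[q0 q1] ac bd; rewrite lerD // ler_wpM2l // subr_ge0.
Qed.

Lemma mean_trace_ge0 Q V q k X : 0 <= q <= 1 -> possemidef Q -> posdef V ->
  possemidef X -> 0 <= mean_trace Q V q k X.
Proof.
move=> /andP[q0 q1] pQ pV; elim: k X => [|k IH] X pX /=; first exact: mxtrace_ge0.
by rewrite addr_ge0 // mulr_ge0 ?subr_ge0 // IH //; exact: step_possemidef.
Qed.

Lemma le_mean_trace Q V W q k X Y : 0 <= q <= 1 -> possemidef Q ->
  posdef V -> posdef W -> possemidef X -> possemidef Y ->
  lemx V W -> lemx X Y -> mean_trace Q V q k X <= mean_trace Q W q k Y.
Proof.
move=> q01 pQ pV pW + + VW.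
elim: k X Y => [|k IH] X Y pX pY XY /=; first exact: le_mxtrace.
by apply: ler_mix => //; apply: IH; [exact: step_possemidef
  |exact: step_possemidef|exact: lemx_step2|exact: step_possemidef
  |exact: step_possemidef|exact: lemx_step2].
Qed.

Hint Resolve lexmx : core.

Lemma mean_traceD P Q V W q k X Y : 0 <= q <= 1 ->
  possemidef P -> possemidef Q -> posdef V -> posdef W ->
  possemidef X -> possemidef Y ->
  mean_trace P V q k X + mean_trace Q W q k Y <=
  mean_trace (P + Q) (V + W) q k (X + Y).
Proof.
move=> q01 pP pQ pV pW; elim: k X Y => [|k IH] X Y pX pY /=.
  by rewrite linearD.
have pVW : posdef (V + W) by apply: posdefDl => //; exact: posdef_possemidef.
have pPQ := possemidefD pP pQ; have pXY := possemidefD pX pY.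
have H g : mean_trace P V q k (step P V g X) + mean_trace Q W q k (step Q W g Y)
    <= mean_trace (P + Q) (V + W) q k (step (P + Q) (V + W) g (X + Y)).
  apply: le_trans (IH _ _ (step_possemidef _ _ _ pP pV pX) (step_possemidef _ _ _ pQ pW pY)) _.
  apply: le_mean_trace => //; [|exact: step_possemidef|].
    by apply: possemidefD; exact: step_possemidef.
  move=> u; rewrite /riccati_step addrACA -mulmxDl -mulmxDr !qformE !(bformDm _ (P + Q)).
  by rewrite lerD2r -!qformE; apply: lemx_conj; exact: filter_covD.
apply: le_trans (ler_mix q01 (H true) (H false)).
by rewrite le_eqVlt; apply/orP; left; apply/eqP; ring.
Qed.

Lemma mean_traceZ a Q V q k X : 0 < a -> 0 <= q <= 1 ->
  possemidef Q -> posdef V -> possemidef X ->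
  mean_trace (a *: Q) (a *: V) q k (a *: X) <= a * mean_trace Q V q k X.
Proof.
move=> a0 q01 pQ pV; elim: k X => [|k IH] X pX /=; first by rewrite linearZ.
have pQ' := possemidefZ (ltW a0) pQ; have pV' := posdefZ a0 pV.
have pX' := possemidefZ (ltW a0) pX.
have H g : mean_trace (a *: Q) (a *: V) q k (step (a *: Q) (a *: V) g (a *: X)) <=
    a * mean_trace Q V q k (step Q V g X).
  apply: le_trans (IH _ _); last exact: step_possemidef.
  apply: le_mean_trace => //; first exact: step_possemidef.
    by apply: possemidefZ; [exact: ltW|exact: step_possemidef].
  move=> u; rewrite /riccati_step scalerDr !qformE !(bformDm _ (a *: Q)) lerD2r.
  rewrite scalemxAl scalemxAr -!qformE; apply: lemx_conj; exact: filter_covZ.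
by rewrite mulrDr mulrCA (mulrCA a); apply: ler_mix.
Qed.

(** One step from any X lands above Q, so the trajectory from Q, one step behind, bounds every other
    from below. *)
Lemma mean_traceS Q V q k : 0 <= q <= 1 -> possemidef Q -> posdef V ->
  forall X, possemidef X -> mean_trace Q V q k Q <= mean_trace Q V q k.+1 X.
Proof.
move=> q01 pQ pV X pX /=.
have -> : mean_trace Q V q k Q =
  q * mean_trace Q V q k Q + (1 - q) * mean_trace Q V q k Q by ring.
by apply: ler_mix => //; apply: le_mean_trace => //;
  by [exact: step_possemidef|exact: le_step].
Qed.

Lemma mean_trace_nondecreasing Q V q : 0 <= q <= 1 -> possemidef Q -> posdef V ->
  nondecreasing_seq (fun k => mean_trace Q V q k Q).
Proof. by move=> q01 pQ pV; apply/nondecreasing_seqP => k; exact: mean_traceS. Qed.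

(** The induction hypothesis compares the tails at equal matrices; raising the arrival probability
    then moves weight from the branch without arrival to the smaller one with arrival. *)
Lemma mean_trace_antitone Q V q r k X : 0 <= q -> q <= r -> r <= 1 ->
  possemidef Q -> posdef V -> possemidef X ->
  mean_trace Q V r k X <= mean_trace Q V q k X.
Proof.
move=> q0 qr r1 pQ pV; elim: k X => [|k IH] X pX //=.
have r01 : 0 <= r <= 1 by rewrite (le_trans q0 qr) r1.
apply: le_trans (ler_mix r01 (IH _ (step_possemidef _ _ _ pQ pV pX)) (IH _ (step_possemidef _ _ _ pQ pV pX))) _.
set a := mean_trace Q V q k _; set b := mean_trace Q V q k _.
have : a <= b.
  apply: le_mean_trace => //; try exact: step_possemidef.
    by rewrite q0 (le_trans qr).
  exact: step_false_ge.
by rewrite -subr_ge0 => ab; nra.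
Qed.

(** The Riccati iterates do not involve q, so this is a polynomial in q. *)
Lemma mean_trace_continuous Q V k X : continuous (fun q => mean_trace Q V q k X).
Proof.
elim: k X => [|k IH] X q /=; first exact: cvg_cst.
apply: cvgD; first by apply: cvgM; [exact: cvg_id|exact: IH].
apply: cvgM; last exact: IH.
by apply: cvgB; [exact: cvg_cst|exact: cvg_id].
Qed.

End mean_trace.

(** * Boundedness persists for slightly smaller arrival probabilities *)

Section threshold.
Variables (R : realType) (n m : nat).
Variables (A : 'M[R]_n) (C : 'M[R]_(m, n)).
Implicit Types (Q X Y Z : 'M[R]_n) (V W : 'M[R]_m) (g : bool) (q : R).

Local Notation step := (riccati_step A C).
Local Notation mean_trace := (mean_trace A C).

Hint Resolve lexmx possemidef0 : core.

Lemma step0E Q V g X : step Q V g X = step 0 V g X + Q.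
Proof. by rewrite /riccati_step addr0. Qed.

(* Superadditivity separates the responses to the noises injected at each step;
   each of them needs its own share V of the measurement noise. *)
Lemma sum_mean_trace_le Q V q k X : 0 <= q <= 1 -> possemidef Q -> posdef V ->
  possemidef X ->
  mean_trace 0 V q k X + \sum_(j < k) mean_trace 0 V q j Q <=
  mean_trace Q (k.+1%:R *: V) q k X.
Proof.
move=> q01 pQ pV; elim: k X => [|k IH] X pX /=; first by rewrite big_ord0 addr0.
have pVk i : posdef (i.+1%:R *: V) by apply: posdefZ => //; rewrite ltr0n.
have VE : k.+2%:R *: V = V + k.+1%:R *: V.
  by rewrite -[X in X + _]scale1r -scalerDl (natrD _ 1).
have H g : mean_trace 0 V q k (step 0 V g X) + \sum_(j < k.+1) mean_trace 0 V q j Q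
    <= mean_trace Q (k.+2%:R *: V) q k (step Q (k.+2%:R *: V) g X).
  rewrite big_ord_recr /= addrA addrAC -addrA.
  apply: le_trans (lerD (lexx _) (IH _ pQ)) _ => //.
  have pS := step_possemidef A C g (possemidef0 R n) pV pX.
  have := mean_traceD A C k q01 (possemidef0 R n) pQ pV (pVk k) pS pQ.
  rewrite add0r -VE; move=> /le_trans; apply.
  apply: le_mean_trace => //; first exact: possemidefD.
    exact: step_possemidef.
  move=> u; rewrite (step0E Q) !qformE !(bformDm _ Q) lerD2r -!qformE.
  apply: lemx_step2 => //; rewrite VE => w.
  by rewrite !qformE bformDm lerDl possemidef_ge0 //; exact: posdef_possemidef.
apply: le_trans (ler_mix q01 (H true) (H false)).
by rewrite le_eqVlt; apply/orP; left; apply/eqP; ring.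
Qed.

(* Keep the gains of the unperturbed recursion: they are suboptimal for the
   perturbed one, and make it affine in t. *)
Lemma mean_trace_perturb Q V q k X Z : 0 <= q <= 1 -> possemidef Q -> posdef V ->
  possemidef X -> possemidef Z ->
  exists D : R, forall t : R, 0 <= t ->
    mean_trace (t *: Q) V q k (X + t *: Z) <= mean_trace 0 V q k X + t * D.
Proof.
move=> q01 pQ pV; elim: k X Z => [|k IH] X Z pX pZ.
  by exists (\tr Z) => t t0 /=; rewrite linearD /= linearZ.
have pX' g := step_possemidef A C g (possemidef0 R n) pV pX.
pose F g : 'M[R]_n := if g then 1%:M - gain C V X *m C else 1%:M.
pose Z' g := A *m (F g *m Z *m (F g)^T) *m A^T + Q.
have pZ' g : possemidef (Z' g).
  by apply: possemidefD => //; do 2 apply: possemidef_conj.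
have H (t : R) g : 0 <= t -> lemx (step (t *: Q) V g (X + t *: Z)) (step 0 V g X + t *: Z' g).
  move=> t0 u; rewrite /riccati_step /Z' addr0 scalerDr addrA !qformE !(bformDm _ (t *: Q)).
  rewrite lerD2r scalemxAl scalemxAr -mulmxDl -mulmxDr -!qformE.
  apply: lemx_conj => w; case: g; last by rewrite /F /= mul1mx trmx1 mulmx1.
  have pXZ : possemidef (X + t *: Z) by apply: possemidefD => //; exact: possemidefZ.
  apply: (@le_trans _ _ (qform (joseph C V (gain C V X) (X + t *: Z)) w)); first exact: filter_cov_le_joseph.
  rewrite /joseph /F mulmxDr mulmxDl -scalemxAr -scalemxAl.
  by rewrite le_eqVlt; apply/orP; left; apply/eqP; congr (qform _ w); rewrite addrAC.
have [D1 HD1] := IH _ _ (pX' true) (pZ' true).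
have [D2 HD2] := IH _ _ (pX' false) (pZ' false).
exists (q * D1 + (1 - q) * D2) => t t0 /=.
have K g D : (forall t : R, 0 <= t ->
    mean_trace (t *: Q) V q k (step 0 V g X + t *: Z' g) <=
      mean_trace 0 V q k (step 0 V g X) + t * D) ->
    mean_trace (t *: Q) V q k (step (t *: Q) V g (X + t *: Z)) <=
      mean_trace 0 V q k (step 0 V g X) + t * D.
  move=> /(_ t t0) HD; apply: le_trans HD; apply: le_mean_trace => //.
  - exact: possemidefZ.
  - apply: step_possemidef => //; first exact: possemidefZ.
    by apply: possemidefD => //; exact: possemidefZ.
  - by apply: possemidefD => //; exact: possemidefZ.
  - exact: H.
apply: le_trans (ler_mix q01 (K _ _ HD1) (K _ _ HD2)) _.
by rewrite le_eqVlt; apply/orP; left; apply/eqP; ring.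
Qed.

(** The start Q makes the sequence nondecreasing, so that boundedness and divergence to infinity are
    the only alternatives. Other starts are compared with it in [bounded_mean_any] and
    [unbounded_mean_cvg]. *)
Definition bounded_mean Q V q := exists B, forall k, mean_trace Q V q k Q <= B.

(** The bound holds for every start, so conditioning on the first k arrivals applies it to the last
    j of k + j steps. Times below j are covered by the finite sum S, and the bound S + 2 c is
    preserved by halving and adding c. *)
Lemma contraction_bounded Q V q j c : 0 <= q <= 1 -> posdef Q -> posdef V ->
  (0 < j)%N ->
  (forall X, possemidef X -> mean_trace Q V q j X <= 2^-1 * \tr X + c) ->
  bounded_mean Q V q.
Proof.
move=> q01 pQ pV j0 H.
have pQ' := posdef_possemidef pQ.
have c0 : 0 <= c.
  have := H 0 (possemidef0 R n); rewrite mxtrace0 mulr0 add0r; apply: le_trans.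
  exact: mean_trace_ge0.
have H' k X : possemidef X ->
    mean_trace Q V q (k + j) X <= 2^-1 * mean_trace Q V q k X + c.
  elim: k X => [|k IH] X pX; first by rewrite add0n; exact: H.
  rewrite addSn /=.
  apply: le_trans (ler_mix q01 (IH _ (step_possemidef _ _ _ pQ' pV pX)) (IH _ (step_possemidef _ _ _ pQ' pV pX))) _.
  by rewrite le_eqVlt; apply/orP; left; apply/eqP; ring.
pose S := \sum_(i < j) mean_trace Q V q i Q.
have S0 : 0 <= S by apply: sumr_ge0 => i _; exact: mean_trace_ge0.
exists (S + 2 * c) => k; elim/ltn_ind: k => k IH.
have [kj|jk] := ltnP k j.
  rewrite /S (bigD1 (Ordinal kj)) //= -addrA lerDl addr_ge0 ?mulr_ge0 //.
  by apply: sumr_ge0 => i _; exact: mean_trace_ge0.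
rewrite -(subnK jk); apply: le_trans (H' _ _ pQ') _.
have : mean_trace Q V q (k - j) Q <= S + 2 * c.
  by apply: IH; rewrite -subn_gt0 subKn.
by move: (mean_trace _ _ _ _ _) => x; lra.
Qed.

(* By sum_mean_trace_le the responses mean_trace 0 W q j Q have a bounded sum, so
   one of them is small.  By continuity it stays small at some r < q, and scaling X
   down to the size of Q turns this into the hypothesis of contraction_bounded. *)
Lemma bounded_mean_open Q V q : 0 < q <= 1 -> posdef Q -> posdef V ->
  bounded_mean Q V q -> exists2 r, 0 <= r < q & bounded_mean Q V r.
Proof.
move=> /andP[q0 q1] pQ pV [B HB].
have q01 : 0 <= q <= 1 by rewrite ltW.
have pQ' := posdef_possemidef pQ.
have [c c0 Hc] := lemx_mxtrace pQ.
have c20 : 0 < (8 * c)^-1 by rewrite invr_gt0 mulr_gt0.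
(* N copies of [(8 * c)^-1] exceed the bound B. *)
pose N := (Num.truncn (B * (8 * c))).+1.
have N0 : 0 < N.+1%:R^-1 :> R by rewrite invr_gt0 ltr0n.
have BN : B < (8 * c)^-1 *+ N.
  by rewrite -[ltRHS]mulr_natl ltr_pdivlMr ?mulr_gt0 //; exact: truncnS_gt.
(* [sum_mean_trace_le] inflates the measurement noise by N + 1; starting from this share makes the
   inflated noise V itself. *)
pose W := N.+1%:R^-1 *: V.
have pW : posdef W by exact: posdefZ.
have NW : N.+1%:R *: W = V by rewrite scalerA divff ?scale1r // pnatr_eq0.
have [j j0 Hj] : exists2 j, (0 < j)%N & mean_trace 0 W q j Q <= (8 * c)^-1.
  apply: contrapT => Hn.
  have Hgt j : (0 < j)%N -> (8 * c)^-1 <= mean_trace 0 W q j Q.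
    by move=> j0; apply/ltW; rewrite ltNge; apply/negP => ?; apply: Hn; exists j.
  have := HB N; apply/negP; rewrite -ltNge; apply: lt_le_trans BN _.
  rewrite -NW; apply: le_trans (sum_mean_trace_le N q01 pQ' pW pQ').
  (* [Hgt] says nothing about the term j = 0; the response to the initial matrix at time N > 0 takes
     its place, so N terms are still counted. *)
  rewrite {2 3}/N big_ord_recl mulrS lerD //; first exact: Hgt.
  apply: ler_wpDl; first exact: mean_trace_ge0.
  rewrite -[in leLHS](card_ord (Num.truncn _)) -sumr_const.
  by apply: ler_sum => i _; exact: Hgt.
have [r r0q Hr] : exists2 r, 0 <= r < q & mean_trace 0 W r j Q <= (4 * c)^-1.
  have e0 : 0 < (8 * c)^-1 by [].
  have /cvgrPdist_lt /(_ _ e0) := @mean_trace_continuous R n m A C 0 W j Q q.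
  move=> /nbhs_ballP[d /= d0 Hd].
  pose r := q - Num.min q d / 2.
  have md : 0 < Num.min q d by rewrite lt_min q0.
  have mq : Num.min q d <= q by rewrite ge_min lexx.
  have mdd : Num.min q d <= d by rewrite ge_min lexx orbT.
  exists r; first by rewrite /r; lra.
  have /Hd : ball q d r.
    by rewrite /ball /= /r opprB addrC subrK ger0_norm; lra.
  rewrite ltr_norml => /andP[+ _].
  have -> : (4 * c)^-1 = (8 * c)^-1 + (8 * c)^-1 by field; rewrite gt_eqF.
  by move: Hj; lra.
have r01 : 0 <= r <= 1 by case/andP: r0q => -> /ltW/le_trans ->.
exists r => //.
have [D HD] := mean_trace_perturb j r01 pQ' pW pQ' (possemidef0 R n).
apply: (@contraction_bounded _ _ _ j (N.+1%:R / (4 * c) + D)) => // X pX.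
(* The first summand gives X <= s Q and the second V / s <= W. A response of at most [(4 * c)^-1],
   scaled back by s, contributes 1/4 of the trace of X, within the allowed slope 1/2. *)
pose s := c * \tr X + N.+1%:R.
have sN : N.+1%:R <= s by rewrite lerDr mulr_ge0 ?mxtrace_ge0 // ltW.
have s0 : 0 < s by apply: lt_le_trans sN; rewrite ltr0n.
have sV0 : 0 < s^-1 by rewrite invr_gt0.
apply: (@le_trans _ _ (mean_trace Q V r j (s *: Q))).
  apply: le_mean_trace => //; first by apply: possemidefZ => //; exact: ltW.
  move=> u; apply: le_trans (Hc X pX u) _; rewrite !qformE !bformZm ler_wpM2r //.
    exact: possemidef_ge0.
  by rewrite lerDl.
have sE k (Z : 'M[R]_k) : Z = s *: (s^-1 *: Z) by rewrite scalerA divff ?scale1r // gt_eqF.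
rewrite [in leLHS](sE _ V) (_ : mean_trace Q _ _ _ _ = mean_trace (s *: (s^-1 *: Q)) (s *: (s^-1 *: V)) r j (s *: Q)); last by rewrite -(sE _ Q).
apply: le_trans (mean_traceZ _ _ _ _ _ _ _ _) _ => //.
- by apply: possemidefZ => //; exact: ltW.
- exact: posdefZ.
apply: (@le_trans _ _ (s * ((4 * c)^-1 + s^-1 * D))); last first.
  have -> : s * ((4 * c)^-1 + s^-1 * D) = 4^-1 * \tr X + (N.+1%:R / (4 * c) + D).
    by move: s0; rewrite /s => s0; field; rewrite !gt_eqF.
  by rewrite lerD2r ler_wpM2r ?mxtrace_ge0 // lef_pV2 ?posrE // ler_nat.
rewrite ler_pM2l //; apply: (@le_trans _ _ (mean_trace (s^-1 *: Q) W r j Q)).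
  apply: le_mean_trace => //; first by apply: possemidefZ => //; exact: ltW.
    exact: posdefZ.
  move=> u; rewrite !qformE !bformZm ler_wpM2r //.
    by apply: possemidef_ge0; exact: posdef_possemidef.
  by rewrite lef_pV2 ?posrE // ltr0n.
have := HD _ (ltW sV0); rewrite scaler0 addr0 => /le_trans; apply.
by rewrite lerD2r.
Qed.

End threshold.

(** * Instability and the critical arrival probability *)

Section unstable.
Variables (R : realType) (n m : nat).
Variables (A : 'M[R]_n) (C : 'M[R]_(m, n)).
Implicit Types (Q X Y Z : 'M[R]_n) (V W : 'M[R]_m) (g : bool) (q : R).

Local Notation step := (riccati_step A C).
Local Notation mean_trace := (mean_trace A C).
Local Notation bounded_mean := (bounded_mean A C).

Hint Resolve lexmx possemidef0 : core.

(** The vectors u and w are the real and imaginary parts of a left eigenvector, transposed, for an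
    eigenvalue z = x + i y with |z| > 1. *)
Lemma unstable_plane : 1 < spectral_radius A ->
  exists (u w : 'cV[R]_n) (x y : R),
  [/\ 1 < x ^+ 2 + y ^+ 2, A^T *m u = x *: u - y *: w,
      A^T *m w = y *: u + x *: w & (u != 0) || (w != 0)].
Proof.
rewrite /spectral_radius; set S := (X in sup X) => S1.
have S0 : (S !=set0)%classic.
  (* The supremum of the empty set is 0, so a value above 1 provides an eigenvalue. *)
  by apply/set0P/eqP => S0; move: S1; rewrite S0 sup0 ltr10.
have [r [z /eigenvalueP[v vA v0] <-] z1] := sup_gt S0 S1.
pose re := map_mx (@complex.Re R) v; pose im := map_mx (@complex.Im R) v.
have coord j : \sum_i v 0 i * (A i j)%:C%C = z * v 0 j.
  have := congr1 (fun M : 'rV__ => M 0 j) vA; rewrite !mxE => <-.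
  by apply: eq_bigr => i _; rewrite !mxE.
have ReC (a : R[i]) (b : R) : complex.Re (a * b%:C%C) = complex.Re a * b.
  by case: a => a1 a2 /=; rewrite mulr0 subr0.
have ImC (a : R[i]) (b : R) : complex.Im (a * b%:C%C) = complex.Im a * b.
  by case: a => a1 a2 /=; rewrite mulr0 add0r.
exists re^T, im^T, (complex.Re z), (complex.Im z); split.
- move: z1; case: (z) => x y /= z1; rewrite -(ltr_pXn2r (n := 2)) ?nnegrE //= in z1.
  by move: z1; rewrite expr1n sqr_sqrtr // addr_ge0 // sqr_ge0.
- apply/colP => j; rewrite !mxE.
  have := congr1 (@complex.Re R) (coord j); rewrite raddf_sum /=.
  case: (z) (v 0 j) => x y [a b] /= <-; apply: eq_bigr => i _.
  by rewrite ReC !mxE mulrC.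
- apply/colP => j; rewrite !mxE.
  have := congr1 (@complex.Im R) (coord j); rewrite raddf_sum /=.
  case: (z) (v 0 j) => x y [a b] /=; rewrite addrC => <-; apply: eq_bigr => i _.
  by rewrite ImC !mxE mulrC.
- rewrite -negb_and; apply: contra v0 => /andP[/eqP re0 /eqP im0].
  apply/eqP/rowP => j; rewrite mxE.
  have := congr1 (fun M : 'cV__ => M j 0) re0.
  have := congr1 (fun M : 'cV__ => M j 0) im0.
  by rewrite !mxE; case: (v 0 j) => a b /= -> ->.
Qed.

(* On the real plane of a left eigenvector, losing a packet multiplies the form F by
   s = |z|^2 > 1; with 1 - q = 1/s this alone keeps the mean of F from
   decreasing, and every step adds F Q. *)
Lemma unbounded_mean Q V : posdef Q -> posdef V -> 1 < spectral_radius A ->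
  exists2 q, 0 < q <= 1 & ~ bounded_mean Q V q.
Proof.
move=> pQ pV /unstable_plane[u [w [x [y [xy Au Aw uw]]]]].
have pQ' := posdef_possemidef pQ; have [sQ qQ] := pQ.
pose F (X : 'M[R]_n) := bform X u u + bform X w w.
set s := x ^+ 2 + y ^+ 2 in xy *.
have s0 : 0 < s by apply: lt_trans xy.
have FA X : X^T = X -> F (A *m X *m A^T) = s * F X.
  move=> sX; rewrite /F !bform_conj Au Aw -scaleNr.
  rewrite !(bformDl, bformDr) !(bformZl, bformZr) (bformC w u sX) /s.
  ring.
have FQ : 0 < F Q.
  have Q0 v : 0 <= bform Q v v by exact: possemidef_ge0.
  by case/orP: uw => /qQ; rewrite qformE => ?; [apply: ltr_pwDl|apply: ltr_wpDl].
have [c c0 Hc] := lemx_mxtrace pQ.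
have Ftr X : possemidef X -> F X <= c * F Q * \tr X.
  move=> pX; rewrite /F mulrDr mulrDl; apply: lerD.
    by have := Hc X pX u; rewrite !qformE bformZm mulrAC.
  by have := Hc X pX w; rewrite !qformE bformZm mulrAC.
exists (1 - s^-1).
  by rewrite subr_gt0 invf_lt1 // xy /= gerBl invr_ge0 ltW.
set q := 1 - s^-1.
have q01 : 0 <= q <= 1.
  by rewrite /q subr_ge0 invf_le1 // (ltW xy) /= gerBl invr_ge0 ltW.
have Fle X Y : lemx X Y -> F X <= F Y.
  by move=> XY; rewrite /F lerD //; exact: XY.
have grow k X : possemidef X -> F X + k%:R * F Q <= c * F Q * mean_trace Q V q k X.
  elim: k X => [|k IH] X pX; first by rewrite mul0r addr0; exact: Ftr.
  have pT g := step_possemidef A C g pQ' pV pX.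
  have q1 : 0 <= 1 - q by case/andP: q01 => _; rewrite subr_ge0.
  have := ler_mix q01 (IH _ (pT true)) (IH _ (pT false)).
  rewrite /= !(mulrCA _ (c * F Q)) -mulrDr; apply: le_trans.
  have -> : F (step Q V false X) = s * F X + F Q.
    by case: pX => sX _; rewrite -FA // /F /step !bformDm addrACA.
  have qs : (1 - q) * s = 1 by rewrite /q subKr mulVf // gt_eqF.
  have T0 : q * F Q <= q * F (step Q V true X).
    by case/andP: q01 => q_0 _; apply: ler_wpM2l => //; apply: Fle; exact: le_step.
  rewrite [leRHS](_ : _ = q * F (step Q V true X) + k%:R * F Q + ((1 - q) * s) * F X + (1 - q) * F Q); last by ring.
  have -> : (1 - q) * F Q = F Q - q * F Q by ring.
  by rewrite qs mul1r -natr1 (mulrDl k%:R) mul1r; move: T0; lra.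
move=> [B HB].
have K k : k%:R <= c * B.
  rewrite -(ler_pM2r FQ) [leRHS]mulrAC.
  apply: le_trans (_ : _ <= F Q + k%:R * F Q) _; first by rewrite lerDr ltW.
  by apply: le_trans (grow k Q pQ') _; rewrite ler_pM2l ?mulr_gt0.
have := K (Num.truncn (c * B)).+1; apply/negP; rewrite -ltNge; exact: truncnS_gt.
Qed.

(** A multiple a Q of the start dominates S. By homogeneity, scaling both noises and the start by a
    costs only the factor a, and by superadditivity the surplus (a - 1) Q, (a - 1) V of the noises
    can be discarded. *)
Lemma bounded_mean_any Q V q S : 0 <= q <= 1 -> posdef Q -> posdef V -> possemidef S ->
  bounded_mean Q V q -> exists B, forall k, mean_trace Q V q k S <= B.
Proof.
move=> q01 pQ pV pS [B HB]; have pQ' := posdef_possemidef pQ.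
have [c c0 Hc] := lemx_mxtrace pQ.
(* The constant 2 keeps a - 1 positive even for S = 0, so that the surplus measurement noise is
   positive definite. *)
pose a := c * \tr S + 2.
have cS : 0 <= c * \tr S by rewrite mulr_ge0 ?mxtrace_ge0 // ltW.
have a1 : 0 < a - 1 by rewrite /a; lra.
have a0 : 0 < a by rewrite /a; lra.
exists (a * B) => k.
apply: (@le_trans _ _ (a * mean_trace Q V q k Q)); last by rewrite ler_pM2l.
apply: le_trans (mean_traceZ _ _ _ a0 q01 pQ' pV pQ').
have aE k' (Z : 'M[R]_k') : a *: Z = Z + (a - 1) *: Z.
  by rewrite -[X in X + _]scale1r -scalerDl addrC subrK.
have p1 := possemidefZ (ltW a1) pQ'; have p2 := posdefZ a1 pV.
have paQ := possemidefZ (ltW a0) pQ'.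
have := mean_traceD A C k q01 pQ' p1 pV p2 paQ (possemidef0 R n).
rewrite addr0 -!aE; apply: le_trans; apply: ler_wpDr; first exact: mean_trace_ge0.
apply: le_mean_trace => // u; apply: le_trans (Hc S pS u) _.
rewrite !qformE !bformZm ler_wpM2r ?possemidef_ge0 //.
by rewrite /a; lra.
Qed.

(** From the start Q the mean trace is nondecreasing, so unboundedness is divergence; by
    [mean_traceS] every start S inherits it one step later. *)
Lemma unbounded_mean_cvg Q V q S : 0 <= q <= 1 -> posdef Q -> posdef V -> possemidef S ->
  ~ bounded_mean Q V q -> mean_trace Q V q k S @[k --> \oo] --> +oo.
Proof.
move=> q01 pQ pV pS nB; have pQ' := posdef_possemidef pQ.
apply/cvgryPge => B.
have [k0 Hk0] : exists k, B < mean_trace Q V q k Q.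
  apply: contrapT => H; apply: nB; exists B => k; rewrite leNgt; apply/negP => ?.
  by apply: H; exists k.
exists k0.+1 => //= -[//|k] /=; rewrite ltnS => k0k.
apply: le_trans (ltW Hk0) _.
apply: le_trans (mean_trace_nondecreasing A C q01 pQ' pV k0k) _.
exact: mean_traceS.
Qed.

(** The critical value is the supremum of the unbounded probabilities. It is unbounded itself, since
    boundedness there would extend strictly below it by [bounded_mean_open]. *)
Lemma mean_trace_threshold Q V p : posdef Q -> posdef V -> 1 < spectral_radius A ->
  0 <= p <= 1 -> bounded_mean Q V p ->
  exists2 pc, 0 < pc < p & forall q, 0 <= q <= 1 -> bounded_mean Q V q <-> pc < q.
Proof.
move=> pQ pV rho /andP[p0 p1] Bp; have pQ' := posdef_possemidef pQ.
have mono q r : 0 <= q -> q <= r -> r <= 1 -> bounded_mean Q V q -> bounded_mean Q V r.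
  move=> q0 qr r1 [B HB]; exists B => k; apply: le_trans (HB k).
  exact: mean_trace_antitone.
pose E := [set q : R | 0 <= q <= 1 /\ ~ bounded_mean Q V q]%classic.
have [q0 /andP[q00 q01] nBq0] := unbounded_mean pQ pV rho.
have Eq0 : E q0 by split => //; rewrite ltW.
have Ep : ubound E p.
  move=> q [/andP[q_0 q_1] nB]; rewrite leNgt; apply/negP => pq; apply: nB.
  by apply: mono Bp => //; exact: ltW.
have supE : has_sup E by split; [exists q0|exists p].
have q0c : q0 <= sup E by apply: sup_ubound => //; exact: supE.2.
have c0 : 0 < sup E by apply: lt_le_trans q0c.
have cp : sup E <= p by apply: sup_le_ub => //; exists q0.
have below q : 0 <= q -> q < sup E -> ~ bounded_mean Q V q.
  move=> q_0 qc Bq; have [r [/andP[r0 r1] nBr] qr] := sup_gt supE.1 qc.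
  by apply: nBr; apply: mono Bq => //; exact: ltW.
have nBc : ~ bounded_mean Q V (sup E).
  move=> Bc; have c01 : 0 < sup E <= 1 by rewrite c0 (le_trans cp).
  have [r /andP[r0 rc] Br] := bounded_mean_open c01 pQ pV Bc.
  exact: below Br.
exists (sup E).
  by rewrite c0 lt_neqAle cp andbT; apply/eqP => cE; rewrite cE in nBc.
move=> q /andP[q_0 q_1]; split=> [Bq|cq].
  rewrite ltNge; apply/negP; rewrite le_eqVlt => /orP[/eqP qE|/(below _ q_0)//].
  by rewrite qE in Bq.
apply: contrapT => nB; suff : q <= sup E by rewrite leNgt cq.
by apply: sup_ubound; [exact: supE.2|split => //; rewrite q_0].
Qed.

End unstable.

(** * Characteristic functions of Gaussian variables *)

Lemma Rintegral_cvg_dominated (R : realType) d (T : measurableType d)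
    (mu : {measure set T -> \bar R}) (f_ : nat -> T -> R) (f g : T -> R) :
  (forall n, measurable_fun setT (f_ n)) ->
  measurable_fun setT f ->
  (forall t, f_ n t @[n --> \oo] --> f t) ->
  mu.-integrable setT (EFin \o g) ->
  (forall n t, `|f_ n t| <= g t) ->
  mu.-integrable setT (EFin \o f) /\
  (\int[mu]_t f_ n t)%R @[n --> \oo] --> (\int[mu]_t f t)%R.
Proof.
move=> mf_ mf f_f ig fg.
have mE n : measurable_fun setT (EFin \o f_ n : T -> \bar R) by apply/measurable_EFinP.
have mEf : measurable_fun setT (EFin \o f : T -> \bar R) by apply/measurable_EFinP.
have cE : {ae mu, forall t, [set: T] t -> (f_ n t)%:E @[n --> \oo] --> (f t)%:E}.
  by apply: aeW => t _; apply: cvg_EFin; [exact: nearW|exact: f_f].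
have dE : {ae mu, forall t n, [set: T] t -> (`|(EFin \o f_ n) t| <= (EFin \o g) t)%E}.
  by apply: aeW => t n _; rewrite lee_fin.
have [intf _ c] := @dominated_convergence _ _ _ mu _ measurableT
  (fun n => EFin \o f_ n) (EFin \o f) (EFin \o g) mE mEf cE ig dE.
split => //; apply: fine_cvg.
by rewrite fineK ?integrable_fin_num.
Qed.

Section gauss_char.
Variables (R : realType) (s : R).
Hypothesis s0 : 0 < s.
Local Notation mu := (@lebesgue_measure R).
Local Notation n := (normal_pdf 0 s).

(** The fundamental theorem of calculus on [-k, k], followed by dominated convergence with |f| as
    the bound. *)
Lemma Rintegral_derive_eq0 (f F : R -> R) :
  continuous f -> (forall x : R, is_derive x (1 : R) F (f x)) ->
  mu.-integrable setT (EFin \o f) ->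
  F k%:R @[k --> \oo] --> 0 -> F (- k%:R) @[k --> \oo] --> 0 ->
  (\int[mu]_x f x)%R = 0.
Proof.
move=> cf dF intf Fp Fn.
have mf : measurable_fun setT f by exact: continuous_measurable_fun.
pose I k : set R := `[- k%:R, k%:R]%classic.
have mI k : measurable (I k) by exact: measurable_itv.
have [_ c] : mu.-integrable setT (EFin \o f) /\
    (\int[mu]_x (f \_ (I k)) x)%R @[k --> \oo] --> (\int[mu]_x f x)%R.
  apply: (@Rintegral_cvg_dominated _ _ _ mu (fun k => f \_ (I k)) f (fun t => `|f t|)) => //.
  - by move=> k; apply: (measurable_restrictT f (mI k)).1; exact: measurable_funTS.
  - move=> t; apply: cvg_near_cst; exists (Num.truncn `|t|).+1 => // k /= tk.
    rewrite patchE mem_set // /I /= in_itv /= -ler_norml ltW //.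
    by apply: lt_le_trans (truncnS_gt _) _; rewrite ler_nat.
  - exact: integrable_norm.
  - by move=> k t; rewrite patchE; case: ifPn => // _; rewrite normr0.
have c2 : F k%:R - F (- k%:R) @[k --> \oo] --> 0.
  by have := cvgB Fp Fn; rewrite subr0; apply.
rewrite -(cvg_lim (@Rhausdorff R) c); apply/(cvg_lim (@Rhausdorff R)).
move: c2; apply: cvg_trans; apply: near_eq_cvg.
exists 1%N => // k /= k1; rewrite -Rintegral_mkcond /Rintegral.
rewrite (@continuous_FTC2 R f F) //.
- by rewrite (lt_le_trans (y := 0)) ?oppr_lt0 ?ltr0n.
- exact: continuous_subspaceT.
- have cF : continuous F.
    by move=> x; apply: differentiable_continuous; apply/derivable1_diffP.
  split; first by move=> x _; exact: ex_derive.
  + by apply: cvg_at_right_filter; exact: cF.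
  + by apply: cvg_at_left_filter; exact: cF.
- by move=> x _; rewrite derive1E; exact: derive_val.
Qed.

Lemma normal_pdf_exp x : n x = normal_peak s * expR (- x ^+ 2 / (s ^+ 2 * 2)).
Proof. by rewrite /normal_pdf gt_eqF // /normal_fun subr0 -mulr_natr. Qed.

Lemma is_derive_normal_pdf x : is_derive x (1 : R) n (- (x / s ^+ 2) * n x).
Proof.
rewrite (_ : normal_pdf 0 s = (fun x => normal_peak s * expR (- x ^+ 2 / (s ^+ 2 * 2)))); last first.
  by apply/funext => y; exact: normal_pdf_exp.
apply: is_derive_eq.
rewrite /GRing.scale /=; field; by rewrite gt_eqF.
Qed.

Lemma integrable_mul_normal_pdf (h : R -> R) : measurable_fun setT h ->
  (forall x, `|h x| <= 1) -> mu.-integrable setT (EFin \o (fun x => h x * n x)).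
Proof.
move=> mh h1; apply: le_integrable (integrable_normal_pdf 0 s) => //.
  by apply/measurable_EFinP/measurable_funM => //; exact: measurable_normal_pdf.
move=> x _ /=; rewrite lee_fin normrM ler_piMl //.
Qed.

(** The density of deviation sqrt 2 s has half the exponent. With y = x^2 / (4 s^2), the other half
    absorbs the factor |x|, because |x| <= 1 + x^2 <= (1 + 4 s^2) exp y. *)
Lemma integrable_id_normal_pdf : mu.-integrable setT (EFin \o (fun x => `|x| * n x)).
Proof.
have s2 : Num.sqrt 2 * s != 0 by rewrite mulf_neq0 ?gt_eqF // sqrtr_gt0.
pose K := (1 + 4 * s ^+ 2) * normal_peak s / normal_peak (Num.sqrt 2 * s).
apply: le_integrable (integrableZl _ K (integrable_normal_pdf 0 (Num.sqrt 2 * s))) => //.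
  apply/measurable_EFinP/measurable_funM; last exact: measurable_normal_pdf.
  exact: normr_measurable.
move=> x _; rewrite /= lee_fin.
have pk := normal_peak_gt0 (lt0r_neq0 s0); have pk2 := normal_peak_gt0 s2.
have K0 : 0 <= K.
  by rewrite /K divr_ge0 ?mulr_ge0 ?(ltW pk) ?(ltW pk2) ?addr_ge0 // mulr_ge0 // sqr_ge0.
rewrite [leLHS]ger0_norm; last by apply: mulr_ge0 => //; exact: normal_pdf_ge0.
rewrite [leRHS]ger0_norm; last by apply: mulr_ge0 => //; exact: normal_pdf_ge0.
rewrite normal_pdf_exp /normal_pdf (negbTE s2) /normal_fun subr0 exprMn sqr_sqrtr //.
rewrite [leRHS]mulrA (_ : K * _ = (1 + 4 * s ^+ 2) * normal_peak s); last first.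
  by rewrite /K divfK // gt_eqF.
set y := x ^+ 2 / (4 * s ^+ 2).
have -> : - x ^+ 2 / (s ^+ 2 * 2) = - y + - y.
  by rewrite /y; field; rewrite gt_eqF.
have -> : - x ^+ 2 / ((2 * s ^+ 2) *+ 2) = - y.
  by rewrite /y -mulr_natr; field; rewrite gt_eqF.
rewrite mulrCA [leRHS]mulrAC [leRHS]mulrC ler_pM2l // expRD mulrA ler_pM2r ?expR_gt0 //.
rewrite [X in _ * X]expRN ler_pdivrMr ?expR_gt0 //.
have y0 : 0 <= y by rewrite divr_ge0 ?sqr_ge0 // mulr_ge0 // sqr_ge0.
have e1 := expR_ge1Dx y.
have xy : x ^+ 2 = 4 * s ^+ 2 * y by rewrite /y; field; rewrite gt_eqF.
have x2 : `|x| <= 1 + x ^+ 2 by rewrite -[x ^+ 2]real_normK ?num_real //; nra.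
apply: le_trans x2 _; rewrite xy.
have : 0 <= s ^+ 2 by rewrite sqr_ge0.
move: (s ^+ 2) => s2'; nra.
Qed.

(** The characteristic function of N(0, s^2), which is real by symmetry. *)
Definition normal_cos (t : R) : R := (\int[mu]_x (cos (t * x) * n x))%R.

Lemma normal_pdf_le_harmonic (k : nat) :
  n k%:R <= normal_peak s * (2 + 2 * s ^+ 2) * harmonic k.
Proof.
have pk := normal_peak_gt0 (lt0r_neq0 s0).
rewrite normal_pdf_exp -mulrA ler_pM2l //.
set y := k%:R ^+ 2 / (s ^+ 2 * 2); rewrite mulNr -/y expRN /harmonic /=.
have s20 : 0 < s ^+ 2 by rewrite exprn_gt0.
have y0 : 0 <= y by rewrite divr_ge0 ?sqr_ge0 // mulr_ge0 // sqr_ge0.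
rewrite -[leLHS]mul1r ler_pdivrMr ?expR_gt0 // mulrAC ler_pdivlMr ?ltr0n // mul1r.
apply: le_trans (_ : _ <= (2 + 2 * s ^+ 2) * (1 + y)) _; last first.
  by rewrite ler_wpM2l ?expR_ge1Dx // addr_ge0 // mulr_ge0 // sqr_ge0.
have k2 : k%:R ^+ 2 = s ^+ 2 * 2 * y by rewrite /y; field; rewrite gt_eqF.
rewrite -natr1; move: k2 s20 y0; move: (s ^+ 2) y (k%:R : R) => s2 y r; nra.
Qed.

Lemma mul_normal_pdf_cvg0 (h : nat -> R) : (forall k, `|h k| <= 1) ->
  h k * n k%:R @[k --> \oo] --> 0.
Proof.
move=> h1; pose c := normal_peak s * (2 + 2 * s ^+ 2).
have c0 : (fun k => c * @harmonic R k) @ \oo --> 0.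
  by rewrite -[X in _ --> X](mulr0 c); apply: cvgMr; exact: cvg_harmonic.
apply/norm_cvg0P; apply: (squeeze_cvgr _ (cvg_cst 0) c0).
apply: nearW => k; rewrite normr_ge0 normrM (ger0_norm (normal_pdf_ge0 _ _ _)) /=.
apply: le_trans (normal_pdf_le_harmonic k).
by rewrite ler_piMl // normal_pdf_ge0.
Qed.

Lemma integrable_cos_normal_pdf t :
  mu.-integrable setT (EFin \o (fun x => cos (t * x) * n x)).
Proof.
apply: integrable_mul_normal_pdf => [|x]; last first.
  by rewrite ler_norml cos_geN1 cos_le1.
by apply: continuous_measurable_fun => x; apply: continuous_comp;
  [exact: mulrl_continuous|exact: continuous_cos].
Qed.

Lemma integrable_id_sin_normal_pdf t :
  mu.-integrable setT (EFin \o (fun x => x * sin (t * x) * n x)).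
Proof.
apply: le_integrable integrable_id_normal_pdf => //.
  apply/measurable_EFinP/measurable_funM; last exact: measurable_normal_pdf.
  apply: measurable_funM => //.
  by apply: continuous_measurable_fun => x; apply: continuous_comp;
    [exact: mulrl_continuous|exact: continuous_sin].
move=> x _ /=; rewrite lee_fin !normrM normr_id ler_wpM2r //.
by rewrite ler_piMr // ler_norml sin_geN1 sin_le1.
Qed.

(** The function f below is the derivative of sin (t x) times the density, and the boundary terms
    vanish. *)
Lemma Rintegral_sin_id_normal_pdf t :
  (\int[mu]_x (x * sin (t * x) * n x))%R = s ^+ 2 * t * normal_cos t.
Proof.
pose f x := t * (cos (t * x) * n x) - (x * sin (t * x) * n x) / s ^+ 2.
have cn : continuous n by apply: continuous_normal_pdf; rewrite gt_eqF.
have if1 : mu.-integrable setT (EFin \o (fun x => t * (cos (t * x) * n x))).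
  by apply: eq_integrable (integrableZl measurableT t (integrable_cos_normal_pdf t)).
have if2 : mu.-integrable setT (EFin \o (fun x => (x * sin (t * x) * n x) / s ^+ 2)).
  by apply: eq_integrable (integrableZr measurableT (s ^+ 2)^-1 (integrable_id_sin_normal_pdf t)).
have ct (x : R) : {for x, continuous (fun x => t * x)} by exact: mulrl_continuous.
have cf : continuous f.
  move=> x; apply: cvgB; first apply: cvgMr; first apply: cvgM.
  - by apply: continuous_comp; [exact: ct|exact: continuous_cos].
  - exact: cn.
  apply: cvgMl; apply: cvgM; last exact: cn.
  apply: cvgM; first exact: cvg_id.
  by apply: continuous_comp; [exact: ct|exact: continuous_sin].
have : (\int[mu]_x f x)%R = 0.
  apply: (@Rintegral_derive_eq0 f (fun x => sin (t * x) * n x)) => //.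
  - move=> x; have dn := is_derive_normal_pdf x.
    apply: is_derive_eq; rewrite /f /GRing.scale /=; field; by rewrite gt_eqF.
  - by apply: eq_integrable (integrableB measurableT if1 if2).
  - by apply: mul_normal_pdf_cvg0 => k; rewrite ler_norml sin_geN1 sin_le1.
  - have E k : n (- k%:R) = n k%:R by rewrite !normal_pdf_exp sqrrN.
    under eq_fun do rewrite E.
    by apply: mul_normal_pdf_cvg0 => k; rewrite ler_norml sin_geN1 sin_le1.
rewrite /f RintegralB // RintegralZl //; last exact: integrable_cos_normal_pdf.
rewrite RintegralZr //; last exact: integrable_id_sin_normal_pdf.
move=> /eqP; rewrite subr_eq0 => /eqP E.
by rewrite -mulrA E mulrC divfK // sqrf_eq0 gt_eqF.
Qed.

Lemma is_derive_normal_cos t :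
  is_derive t (1 : R) normal_cos (- (s ^+ 2 * t) * normal_cos t).
Proof.
rewrite mulNr -Rintegral_sin_id_normal_pdf.
pose F (u x : R) := cos (u * x) * n x.
have d1F u x : partial1of2 F u x = - (x * sin (u * x) * n x).
  rewrite partial1of2E /F.
  have dF : is_derive u (1 : R) (fun u => cos (u * x) * n x) (- (x * sin (u * x) * n x)).
    by apply: is_derive_eq; rewrite /GRing.scale /=; ring.
  exact: derive_val.
have It : `]t - 1, t + 1[%classic t.
  by rewrite /= in_itv /=; apply/andP; split; lra.
have intF u : `]t - 1, t + 1[%classic u -> mu.-integrable setT (EFin \o F u).
  by move=> _; exact: integrable_cos_normal_pdf.
have dF u x : `]t - 1, t + 1[%classic u -> setT x -> derivable (F ^~ x) u 1.
  by move=> _ _; apply: ex_derive.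
have G0 x : 0 <= `|x| * n x by rewrite mulr_ge0 // normal_pdf_ge0.
have Gub u x : `]t - 1, t + 1[%classic u -> setT x ->
    `|partial1of2 F u x| <= `|x| * n x.
  move=> _ _; rewrite d1F normrN !normrM (ger0_norm (normal_pdf_ge0 _ _ _)).
  rewrite ler_wpM2r ?normal_pdf_ge0 //.
  by rewrite ler_piMr // ler_norml sin_geN1 sin_le1.
have E1 := derivable_under_integral measurableT It intF dF G0 integrable_id_normal_pdf Gub.
have E2 := differentiation_under_integral measurableT It intF dF G0 integrable_id_normal_pdf Gub.
apply: DeriveDef; first exact: E1.
rewrite -derive1E -[normal_cos]/(fun u => \int[mu]_x F u x)%R E2.
under eq_Rintegral do rewrite d1F -mulN1r.
rewrite RintegralZl //; last exact: integrable_id_sin_normal_pdf.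
by rewrite mulN1r.
Qed.

(* normal_cos solves f' = - s^2 t f, by integration by parts. *)
Lemma normal_cosE t : normal_cos t = expR (- (t * s) ^+ 2 / 2).
Proof.
pose h u := normal_cos u * expR ((u * s) ^+ 2 / 2).
have dh u : is_derive u (1 : R) h 0.
  have dn := is_derive_normal_cos u.
  by apply: is_derive_eq; rewrite /GRing.scale /=; field.
have h0 : h 0 = 1.
  rewrite /h /normal_cos mul0r expr0n mul0r expR0 mulr1.
  under eq_Rintegral do rewrite mul0r cos0 mul1r.
  by rewrite /Rintegral integral_normal_pdf.
have : h t = 1.
  rewrite -h0; apply: is_derive_0_is_cst => v; exact: dh.
rewrite /h => E; rewrite mulNr expRN.
apply: (mulIf (lt0r_neq0 (expR_gt0 ((t * s) ^+ 2 / 2)))).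
by rewrite E mulVf // gt_eqF // expR_gt0.
Qed.

End gauss_char.

(** * From measures of events to integrals of bounded functions *)

Section bounded_transfer.
Variable R : realType.

Lemma integrable_mul_bounded d (T : measurableType d) (mu : {measure set T -> \bar R})
    (U h : T -> R) (M : R) :
  mu.-integrable setT (EFin \o U) -> measurable_fun setT h -> (forall t, `|h t| <= M) ->
  mu.-integrable setT (EFin \o (fun t => U t * h t)).
Proof.
move=> iU mh hM; have mU : measurable_fun setT U.
  by apply/measurable_EFinP; exact: (measurable_int mu).
apply: le_integrable (integrableZl _ M iU) => //.
  by apply/measurable_EFinP; exact: measurable_funM.
move=> t _; rewrite /= lee_fin !normrM mulrC ler_wpM2r //.
exact: le_trans (hM t) (ler_norm _).
Qed.

Lemma probability_bounded_integrable d (T : measurableType d) (P : probability T R)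
    (h : T -> R) (M : R) :
  measurable_fun setT h -> (forall t, `|h t| <= M) ->
  P.-integrable setT (EFin \o h).
Proof.
move=> mh hM; apply: measurable_bounded_integrable => //.
  by apply: le_lt_trans (probability_le1 P measurableT) _; rewrite ltry.
exists M; split; first by rewrite num_real.
by move=> x xM t _; apply: le_trans (hM t) (ltW xM).
Qed.

Lemma measurable_truncn_eq d (S : measurableType d) (g : S -> R) (N i : nat) :
  measurable_fun setT g -> (forall s, 0 <= g s) ->
  measurable [set s | Num.truncn (g s) = i].
Proof.
move=> mg g0.
rewrite (_ : [set _ | _] = g @^-1` `[i%:R, i.+1%:R[).
  by rewrite -[X in measurable X]setTI; apply: mg => //; exact: measurable_itv.
apply/seteqP; split=> s /=; rewrite in_itv /=.
  by move=> <-; apply: truncn_itv.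
by move=> si; apply/eqP; rewrite truncn_eq.
Qed.

(** The range [-1, 1] is cut into slices of width 1 / (N + 1). Shifting f by 1 and scaling makes the
    slice number a truncation between 0 and 2 (N + 1). *)
Lemma bounded_uniform_approx d (S : measurableType d) (f : S -> R) (N : nat) :
  measurable_fun setT f -> (forall s, `|f s| <= 1) ->
  exists (k : nat) (c : 'I_k -> R) (B : 'I_k -> set S),
    (forall i, measurable (B i)) /\
    forall s, `|f s - \sum_(i < k) c i * \1_(B i) s| <= N.+1%:R^-1.
Proof.
move=> mf f1; pose g s := N.+1%:R * (f s + 1).
have g0 s : 0 <= g s.
  by rewrite mulr_ge0 //; have := f1 s; rewrite ler_norml => /andP[]; lra.
have mg : measurable_fun setT g by apply: measurable_funM => //; exact: measurable_funD.
pose k := (2 * N.+1).+1.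
exists k, (fun i => i%:R / N.+1%:R - 1), (fun i => [set s | Num.truncn (g s) = i]).
split=> [i|s]; first exact: measurable_truncn_eq.
have tk : (Num.truncn (g s) < k)%N.
  rewrite ltnS -(ler_nat R); apply: le_trans (_ : _ <= g s) _; first by rewrite truncn_le.
  rewrite natrM /g mulrC ler_pM2r ?ltr0n //.
  by have := f1 s; rewrite ler_norml => /andP[]; lra.
rewrite (bigD1 (Ordinal tk)) //= big1 ?addr0; last first.
  move=> i ik; rewrite indicE memNset ?mulr0 //= => E; move/eqP: ik; apply.
  exact/val_inj.
rewrite indicE mem_set // mulr1.
have N0 : 0 < N.+1%:R :> R by rewrite ltr0n.
have := truncn_itv (g0 s); set t := Num.truncn _ => /andP[t1 t2].
have -> : f s = g s / N.+1%:R - 1 by rewrite /g mulrAC divff ?gt_eqF // mul1r addrK.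
rewrite opprB addrA subrK -mulrBl normrM [`|_^-1|]ger0_norm ?invr_ge0 ?(ltW N0) //.
rewrite ler_piMl ?invr_ge0 ?(ltW N0) // ler_norml.
by move: t1 t2; rewrite -natr1; lra.
Qed.

(** The weighted laws of X and Y agree on events, hence on simple functions, hence on their uniform
    limits. The weights make it serve both as a change of variables to a density and as a way to
    exploit independence. *)
Lemma Rintegral_bounded_transfer d1 d2 d (T1 : measurableType d1)
    (T2 : measurableType d2) (S : measurableType d)
    (mu : {measure set T1 -> \bar R}) (nu : {measure set T2 -> \bar R})
    (U : T1 -> R) (V : T2 -> R) (X : T1 -> S) (Y : T2 -> S) (f : S -> R) :
  mu.-integrable setT (EFin \o U) -> nu.-integrable setT (EFin \o V) ->
  measurable_fun setT X -> measurable_fun setT Y ->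
  (forall B, measurable B ->
    (\int[mu]_t (U t * \1_B (X t)) = \int[nu]_t (V t * \1_B (Y t)))%R) ->
  measurable_fun setT f -> (forall s, `|f s| <= 1) ->
  (\int[mu]_t (U t * f (X t)) = \int[nu]_t (V t * f (Y t)))%R.
Proof.
move=> iU iV mX mY UV mf f1.
have key d' (T : measurableType d') (m : {measure set T -> \bar R}) (W : T -> R)
    (Z : T -> S) (k : nat) (c : 'I_k -> R) (B : 'I_k -> set S) e :
    m.-integrable setT (EFin \o W) -> measurable_fun setT Z ->
    (forall i, measurable (B i)) ->
    (forall s, `|f s - \sum_(i < k) c i * \1_(B i) s| <= e) ->
    `| (\int[m]_t (W t * f (Z t)))%R -
       \sum_(i < k) c i * (\int[m]_t (W t * \1_(B i) (Z t)))%R |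
      <= e * (\int[m]_t `|W t|)%R.
  move=> iW mZ mB He.
  have mind i : measurable_fun setT (fun t => \1_(B i) (Z t) : R).
    by apply: measurableT_comp => //; exact: measurable_indic.
  have iWB i : m.-integrable setT (EFin \o (fun t => W t * \1_(B i) (Z t))).
    apply: (integrable_mul_bounded (M := 1)) => // t.
    by rewrite indicE ger0_norm // lern1 leq_b1.
  have iWf : m.-integrable setT (EFin \o (fun t => W t * f (Z t))).
    by apply: (integrable_mul_bounded (M := 1)) => //; exact: measurableT_comp.
  have iWc i : m.-integrable setT (EFin \o (fun t => c i * (W t * \1_(B i) (Z t)))).
    by apply: eq_integrable (integrableZl measurableT (c i) (iWB i)).
  have sumE (r : seq 'I_k) : m.-integrable setT
      (EFin \o (fun t => \sum_(i <- r) c i * (W t * \1_(B i) (Z t)))) /\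
      (\int[m]_t \sum_(i <- r) c i * (W t * \1_(B i) (Z t)))%R =
      \sum_(i <- r) c i * (\int[m]_t (W t * \1_(B i) (Z t)))%R.
    elim: r => [|i r [IH1 IH2]].
      split.
        apply: eq_integrable (integrable0 m setT) => // t _ /=.
        by rewrite big_nil.
      under eq_Rintegral do rewrite big_nil.
      by rewrite big_nil Rintegral_cst // mul0r.
    split.
      apply: eq_integrable (integrableD measurableT (iWc i) IH1) => // t _ /=.
      by rewrite big_cons.
    under eq_Rintegral do rewrite big_cons.
    by rewrite RintegralD // big_cons IH2 RintegralZl.
  have [i1 <-] := sumE (index_enum 'I_k).
  rewrite -RintegralB //.
  have i2 := integrableB measurableT iWf i1.
  apply: le_trans (le_normr_Rintegral _ _) _ => //.
  have i3 : m.-integrable setT (EFin \o (fun t => `|W t|)) by exact: integrable_norm.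
  rewrite -RintegralZl //; apply: le_Rintegral => //.
  - exact: integrable_norm.
  - by apply: eq_integrable (integrableZl measurableT e i3).
  move=> t _; under eq_bigr do rewrite mulrCA.
  by rewrite -big_distrr /= -mulrBr normrM mulrC ler_wpM2r.
apply/eqP; rewrite -subr_eq0 -normr_le0; apply/ler_addgt0Pl => e e0; rewrite addr0.
set x := (X in X - _); set y := (X in _ - X).
pose K := (\int[mu]_t `|U t| + \int[nu]_t `|V t|)%R.
have K0 : 0 <= K by rewrite addr_ge0 // Rintegral_ge0.
pose N := Num.truncn (K / e).
have [k [c [B [mB HB]]]] := bounded_uniform_approx N mf f1.
have H1 := key _ _ _ _ _ _ _ _ _ iU mX mB HB.
have H2 := key _ _ _ _ _ _ _ _ _ iV mY mB HB.
have -> : x - y = (x - \sum_(i < k) c i * (\int[mu]_t (U t * \1_(B i) (X t)))%R) -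
   (y - \sum_(i < k) c i * (\int[nu]_t (V t * \1_(B i) (Y t)))%R).
  by under eq_bigr do rewrite (UV _ (mB _)); rewrite opprB addrA subrK.
apply: le_trans (ler_normB _ _) _; apply: le_trans (lerD H1 H2) _.
rewrite -mulrDr -/K mulrC ler_pdivrMr ?ltr0n // mulrC -ler_pdivrMr //.
exact/ltW/truncnS_gt.
Qed.

End bounded_transfer.

(** * Integrals of products and of cosines of sums of independent variables *)

Section independent_products.
Variables (R : realType) (d : measure_display) (T : measurableType d).
Variables (P : probability T R) (I : eqType) (N : pred I) (G : set T).
Variable (X : I -> T -> R).
Hypothesis mG : measurable G.
Hypothesis mX : forall i, N i -> measurable_fun setT (X i).
Hypothesis indepX : forall (J : seq I) (B : I -> set R), uniq J -> all N J ->
  (forall i, measurable (B i)) ->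
  P (G `&` \bigcap_(i in [set` J]) (X i @^-1` B i)) =
  (P G * \prod_(i <- J) P (X i @^-1` B i))%E.

Local Notation "\E Y" := (\int[P]_t Y t)%R (at level 10, Y at level 8).

(** The state of an induction: the variables in L1 carry a bounded function, those in L2 an
    indicator, and the independent event G is carried along. *)
Definition indep_factor (h : I -> R -> R) (L1 : seq I) (B : I -> set R) (L2 : seq I)
    (t : T) : R :=
  \1_G t * \prod_(i <- L1) h i (X i t) * \prod_(i <- L2) \1_(B i) (X i t).

Lemma norm_mul_le1 (x y : R) : `|x| <= 1 -> `|y| <= 1 -> `|x * y| <= 1.
Proof. by move=> x1 y1; rewrite normrM mulr_ile1. Qed.

Lemma prod_norm_le1 (L : seq I) (g : I -> R) :
  (forall i, `|g i| <= 1) -> `|\prod_(i <- L) g i| <= 1.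
Proof.
move=> g1; elim: L => [|i L IH]; first by rewrite big_nil normr1.
by rewrite big_cons normrM mulr_ile1.
Qed.

Lemma indic_norm_le1 S (A : set S) x : `|\1_A x : R| <= 1.
Proof. by rewrite indicE ger0_norm // lern1 leq_b1. Qed.

Lemma measurable_prod_seq (L : seq I) (g : I -> T -> R) :
  (forall i, i \in L -> measurable_fun setT (g i)) ->
  measurable_fun setT (fun t => \prod_(i <- L) g i t).
Proof.
elim: L => [|i L IH] mg.
  by under eq_fun do rewrite big_nil; exact: measurable_cst.
under eq_fun do rewrite big_cons; apply: measurable_funM.
  by apply: mg; rewrite mem_head.
by apply: IH => j jL; apply: mg; rewrite in_cons jL orbT.
Qed.

Section factors.
Variable h : I -> R -> R.
Hypothesis mh : forall i, measurable_fun setT (h i).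
Hypothesis h1 : forall i x, `|h i x| <= 1.

Lemma measurable_indep_factor L1 B L2 : all N L1 -> all N L2 ->
  (forall i, measurable (B i)) -> measurable_fun setT (indep_factor h L1 B L2).
Proof.
move=> /allP N1 /allP N2 mB; apply: measurable_funM; first apply: measurable_funM.
- exact: measurable_indic.
- by apply: measurable_prod_seq => i /N1/mX mXi; exact: measurableT_comp.
- apply: measurable_prod_seq => i /N2/mX mXi; apply: measurableT_comp => //; exact: measurable_indic.
Qed.

Lemma indep_factor_le1 L1 B L2 t : `|indep_factor h L1 B L2 t| <= 1.
Proof.
rewrite !normrM !mulr_ile1 ?mulr_ge0 ?indic_norm_le1 // ?prod_norm_le1 // => i.
exact: indic_norm_le1.
Qed.

(* The factors h i are replaced by indicators one at a time: both sides depend on h i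
   only through measures of events. *)
Lemma Rintegral_indep_factor L1 B L2 : uniq (L1 ++ L2) -> all N (L1 ++ L2) ->
  (forall i, measurable (B i)) ->
  \E (indep_factor h L1 B L2) = fine (P G) * (\prod_(i <- L1) \E (h i \o X i)) *
    \prod_(i <- L2) fine (P (X i @^-1` B i)).
Proof.
elim: L1 B L2 => [|s L1 IH] B L2 uL NL mB.
  rewrite big_nil mulr1.
  transitivity (fine (P (G `&` \bigcap_(i in [set` L2]) (X i @^-1` B i)))).
    have mA : measurable (G `&` \bigcap_(i in [set` L2]) (X i @^-1` B i)).
      apply: measurableI => //; apply: fin_bigcap_measurable => // i /= iL.
      by rewrite -[X in measurable X]setTI; apply: mX => //; exact: (allP NL).
    rewrite -[in RHS](setIT (G `&` _)) -integral_indic //.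
    congr fine; apply: eq_integral => t _; congr EFin.
    rewrite /indep_factor big_nil mulr1 indicI /=; congr (_ * _).
    rewrite indicE; have [tA|tA] := boolP (t \in _).
      rewrite big_seq big1 // => i iL; rewrite indicE mem_set //.
      by move: tA; rewrite inE => /(_ i); apply.
    move: tA; rewrite notin_setE => tA; apply/eqP.
    rewrite prodf_seq_eq0; apply: contrapT => /negP/hasPn H; apply: tA => i /= iL.
    by have := H _ iL; rewrite /= indicE pnatr_eq0 eqb0 negbK inE.
  rewrite indepX //.
  have pE (L : seq I) : all N L -> (\prod_(i <- L) P (X i @^-1` B i) =
      (\prod_(i <- L) fine (P (X i @^-1` B i)))%:E)%E.
    elim: L => [|i L IHL] /=; first by rewrite !big_nil.
    move=> /andP[Ni NLL]; rewrite !big_cons IHL // EFinM fineK //.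
    apply: fin_num_measure; rewrite -[X in measurable X]setTI; exact: mX.
  by rewrite pE // -[X in fine (X * _)%E]fineK ?fin_num_measure //.
have [sL uL'] : s \notin L1 ++ L2 /\ uniq (L1 ++ L2) by move: uL => /= /andP.
have [Ns NL'] : N s /\ all N (L1 ++ L2) by move: NL => /= /andP.
pose U := indep_factor h L1 B L2.
have [N1 N2] : all N L1 /\ all N L2 by apply/andP; rewrite -all_cat.
have mU : measurable_fun setT U by exact: measurable_indep_factor.
have U1 t : `|U t| <= 1 by exact: indep_factor_le1.
have iU : P.-integrable setT (EFin \o U) by exact: probability_bounded_integrable U1.
have transfer : (\int[P]_t (U t * h s (X s t)) = \int[P]_t (\E U * h s (X s t)))%R.
  apply: (Rintegral_bounded_transfer (X := X s) (Y := X s) (f := h s)) => //.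
  - exact: finite_measure_integrable_cst.
  - exact: mX.
  - exact: mX.
  (* Against an indicator at s, the variable s moves to the list L2, and the induction hypothesis
     evaluates both sides. *)
  move=> A mA; pose B' i := if i == s then A else B i.
  have mB' i : measurable (B' i) by rewrite /B'; case: ifP.
  have uL2 : uniq (L1 ++ s :: L2) by rewrite -cat_rcons -cats1 -catA uniq_catCA.
  have NL2 : all N (L1 ++ s :: L2) by rewrite all_cat /= N1 Ns N2.
  have eqB (L : seq I) (g : I -> set R -> R) : s \notin L ->
      \prod_(i <- L) g i (B' i) = \prod_(i <- L) g i (B i).
    move=> sL'; apply: eq_big_seq => i iL; rewrite /B' ifN //.
    by apply: contraNneq sL' => <-.
  have sL2 : s \notin L2 by move: sL; rewrite mem_cat negb_or => /andP[].
  transitivity (\E (indep_factor h L1 B' (s :: L2))).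
    apply: eq_Rintegral => t _; rewrite /indep_factor big_cons /B' eqxx -/B'.
    rewrite (eqB L2 (fun i A => \1_A (X i t))) // /U /indep_factor; ring.
  rewrite IH // big_cons {1}/B' eqxx (eqB L2 (fun i A => fine (P (X i @^-1` A)))) //.
  rewrite RintegralZl //; last first.
    apply: (probability_bounded_integrable P (M := 1)) => [|t]; last exact: indic_norm_le1.
    by apply: measurableT_comp; [exact: measurable_indic|exact: mX].
  rewrite /U IH // (_ : (\int[P]_t \1_A (X s t))%R = fine (P (X s @^-1` A))); first ring.
  by rewrite /Rintegral -[in RHS](setIT (_ @^-1` _)) -integral_indic // -[X in measurable X]setTI; exact: mX.
transitivity (\int[P]_t (U t * h s (X s t)))%R.
  by apply: eq_Rintegral => t _; rewrite /U /indep_factor big_cons; ring.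
rewrite transfer RintegralZl //; last first.
  apply: (probability_bounded_integrable P (M := 1)) => [|t]; last exact: h1.
  by apply: measurableT_comp; [exact: mh|exact: mX].
by rewrite /U IH // big_cons /=; ring.
Qed.

End factors.

Hypothesis sinX : forall i, N i -> \E (sin \o X i) = 0.

Lemma measurable_sum_seq (L : seq I) (g : I -> T -> R) :
  (forall i, i \in L -> measurable_fun setT (g i)) ->
  measurable_fun setT (fun t => \sum_(i <- L) g i t).
Proof.
elim: L => [|i L IH] mg.
  by under eq_fun do rewrite big_nil; exact: measurable_cst.
under eq_fun do rewrite big_cons; apply: measurable_funD.
  by apply: mg; rewrite mem_head.
by apply: IH => j jL; apply: mg; rewrite in_cons jL orbT.
Qed.

Lemma cos_norm_le1 (x : R) : `|cos x| <= 1.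
Proof. by rewrite ler_norml cos_geN1 cos_le1. Qed.

Lemma sin_norm_le1 (x : R) : `|sin x| <= 1.
Proof. by rewrite ler_norml sin_geN1 sin_le1. Qed.

Lemma measurable_cos : measurable_fun setT (@cos R).
Proof. by apply: continuous_measurable_fun => x; exact: continuous_cos. Qed.

Lemma measurable_sin : measurable_fun setT (@sin R).
Proof. by apply: continuous_measurable_fun => x; exact: continuous_sin. Qed.

(** The addition formulas peel off one variable, whose cosine or sine joins the bounded functions h;
    hence the general h and the simultaneous treatment of both functions. Every product with an odd
    number of sines vanishes through [sinX] or the induction hypothesis. *)
Lemma Rintegral_indep_trig (L2 L1 : seq I) (h : I -> R -> R) :
  (forall i, measurable_fun setT (h i)) -> (forall i x, `|h i x| <= 1) ->
  uniq (L1 ++ L2) -> all N (L1 ++ L2) ->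
  let U := indep_factor h L1 (fun=> setT) [::] in
  \E (fun t => U t * cos (\sum_(i <- L2) X i t)) =
    fine (P G) * (\prod_(i <- L1) \E (h i \o X i)) *
    \prod_(i <- L2) \E (cos \o X i) /\
  \E (fun t => U t * sin (\sum_(i <- L2) X i t)) = 0.
Proof.
elim: L2 L1 h => [|s L2 IH] L1 h mh h1 uL NL U.
  split.
    under eq_Rintegral do rewrite big_nil cos0 mulr1.
    rewrite big_nil mulr1 /U (Rintegral_indep_factor mh h1 (B := fun=> setT)) //.
    by rewrite big_nil mulr1.
  under eq_Rintegral do rewrite big_nil sin0 mulr0.
  by rewrite Rintegral_cst // mul0r.
have uL' : uniq ((s :: L1) ++ L2) by rewrite cat_cons -cat1s uniq_catCA.
have NL' : all N ((s :: L1) ++ L2).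
  by move: NL; rewrite !all_cat /= => /and3P[-> -> ->].
have Ns : N s by move: NL' => /= /andP[].
have sL1 : s \notin L1 by move: uL' => /= /andP[]; rewrite mem_cat negb_or => /andP[].
have NL2 : all N L2 by move: NL'; rewrite all_cat => /andP[].
have NL1 : all N L1 by move: NL; rewrite all_cat => /andP[].
pose h_ (f : R -> R) i := if i == s then f else h i.
have hE f t : indep_factor (h_ f) (s :: L1) (fun=> setT) [::] t = U t * f (X s t).
  rewrite /U /indep_factor !big_nil !mulr1 big_cons {1}/h_ eqxx mulrCA mulrC.
  congr (_ * _ * _); apply: eq_big_seq => i iL1; rewrite /h_ ifN //.
  by apply: contraNneq sL1 => <-.
have pE f : \prod_(i <- s :: L1) \E (h_ f i \o X i) =
    \E (f \o X s) * \prod_(i <- L1) \E (h i \o X i).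
  rewrite big_cons {1}/h_ eqxx; congr (_ * _); apply: eq_big_seq => i iL1.
  by rewrite /h_ ifN //; apply: contraNneq sL1 => <-.
have mh_ f : measurable_fun setT f -> forall i, measurable_fun setT (h_ f i).
  by move=> mf i; rewrite /h_; case: ifP.
have h1_ f : (forall x, `|f x| <= 1) -> forall i x, `|h_ f i x| <= 1.
  by move=> f1 i x; rewrite /h_; case: ifP.
have [C1 C2] := IH (s :: L1) _ (mh_ _ measurable_cos) (h1_ _ cos_norm_le1) uL' NL'.
have [S1 S2] := IH (s :: L1) _ (mh_ _ measurable_sin) (h1_ _ sin_norm_le1) uL' NL'.
have mS : measurable_fun setT (fun t => \sum_(i <- L2) X i t).
  by apply: measurable_sum_seq => i iL2; apply: mX; exact: (allP NL2).
have mU : measurable_fun setT U by exact: measurable_indep_factor.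
have U1 t : `|U t| <= 1 by exact: indep_factor_le1.
have int (f g : R -> R) : measurable_fun setT f -> measurable_fun setT g ->
    (forall x, `|f x| <= 1) -> (forall x, `|g x| <= 1) ->
    P.-integrable setT (EFin \o (fun t => U t * f (X s t) * g (\sum_(i <- L2) X i t))).
  move=> mf mg f1 g1; apply: (probability_bounded_integrable P (M := 1)) => [|t].
    apply: measurable_funM; last exact: measurableT_comp.
    by apply: measurable_funM => //; apply: measurableT_comp => //; exact: mX.
  by apply: norm_mul_le1; first exact: norm_mul_le1.
have ic := int _ _ measurable_cos measurable_cos cos_norm_le1 cos_norm_le1.
have iss := int _ _ measurable_sin measurable_sin sin_norm_le1 sin_norm_le1.
have isc := int _ _ measurable_sin measurable_cos sin_norm_le1 cos_norm_le1.
have ics := int _ _ measurable_cos measurable_sin cos_norm_le1 sin_norm_le1.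
split.
  under eq_Rintegral do rewrite big_cons cosD mulrBr !mulrA.
  rewrite RintegralB //.
  under eq_Rintegral do rewrite -hE.
  under [X in _ - X]eq_Rintegral do rewrite -hE.
  by rewrite C1 S2 subr0 pE big_cons; ring.
under eq_Rintegral do rewrite big_cons sinD mulrDr !mulrA.
rewrite RintegralD //.
under eq_Rintegral do rewrite -hE.
under [X in _ + X]eq_Rintegral do rewrite -hE.
by rewrite S1 C2 addr0 pE sinX //; ring.
Qed.

Lemma Rintegral_indep_cos (L : seq I) : uniq L -> all N L ->
  \E (fun t => \1_G t * cos (\sum_(i <- L) X i t)) =
    fine (P G) * \prod_(i <- L) \E (cos \o X i).
Proof.
move=> uL NL.
have [E _] := @Rintegral_indep_trig L [::] (fun=> cst 0) (fun=> measurable_cst _)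
  (fun _ _ => eq_ind_r (fun x => x <= 1) ler01 (normr0 _)) uL NL.
move: E; rewrite big_nil mulr1 => <-.
by apply: eq_Rintegral => t _; rewrite /indep_factor !big_nil !mulr1.
Qed.

Lemma Rintegral_indep_sin (L : seq I) : uniq L -> all N L ->
  \E (fun t => \1_G t * sin (\sum_(i <- L) X i t)) = 0.
Proof.
move=> uL NL.
have [_ E] := @Rintegral_indep_trig L [::] (fun=> cst 0) (fun=> measurable_cst _)
  (fun _ _ => eq_ind_r (fun x => x <= 1) ler01 (normr0 _)) uL NL.
rewrite -[RHS]E.
by apply: eq_Rintegral => t _; rewrite /indep_factor !big_nil !mulr1.
Qed.

End independent_products.

(** * Functions orthogonal to all cosines *)

Section step_polynomials.
Variable R : realType.

(** With s halfway between r and 1 and r = s q, the sequence n s^n is bounded by Bernoulli's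
    inequality while q^n tends to 0. *)
Lemma mulrn_expr_cvg0 (r : R) : 0 <= r < 1 -> n%:R * r ^+ n @[n --> \oo] --> 0.
Proof.
move=> /andP[r0 r1]; pose s := (1 + r) / 2.
have s1 : 0 < s < 1 by rewrite /s; apply/andP; split; lra.
have /andP[s_0 s_1] := s1.
pose q := r / s.
have q01 : 0 <= q < 1.
  by rewrite /q ltr_pdivrMr // mul1r divr_ge0 ?(ltW s_0) //= /s; lra.
have /andP[q0 q1] := q01.
have sn n : n%:R * s ^+ n <= (1 - s)^-1.
  have b : 1 + n%:R * (1 - s) <= s ^- n.
    elim: n => [|n IH]; first by rewrite mul0r addr0 expr0 invr1.
    rewrite exprSr invfM -natr1.
    have si : 1 + (1 - s) <= s^-1.
      by rewrite -[leRHS]mul1r ler_pdivlMr //; nra.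
    have n0 : 0 <= n%:R :> R by [].
    apply: le_trans (_ : _ <= (1 + n%:R * (1 - s)) * (1 + (1 - s))) _.
      by have := mulr_ge0 n0 (sqr_ge0 (1 - s)); nra.
    by apply: ler_pM; [rewrite addr_ge0 // mulr_ge0 // subr_ge0 ltW|lra|exact: IH|exact: si].
  rewrite -[s ^+ n]invrK ler_pdivrMr ?invr_gt0 ?exprn_gt0 // mulrC -ler_pdivrMr ?invr_gt0 ?subr_gt0 //.
  rewrite invrK; lra.
have qc : (1 - s)^-1 * q ^+ n @[n --> \oo] --> 0.
  rewrite -[X in _ --> X](mulr0 (1 - s)^-1); apply: cvgMr.
  by apply: cvg_expr; rewrite ger0_norm.
apply: (squeeze_cvgr _ (cvg_cst 0) qc); apply: nearW => n.
rewrite mulr_ge0 ?exprn_ge0 //=.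
have -> : r = s * q by rewrite /q mulrC divfK // gt_eqF.
by rewrite exprMn mulrA ler_wpM2r // exprn_ge0.
Qed.

Lemma bernoulli_lower (u : R) k : 0 <= u <= 1 -> 1 - k%:R * u <= (1 - u) ^+ k.
Proof.
move=> /andP[u0 u1]; elim: k => [|k IH]; first by rewrite mul0r subr0 expr0.
have k0 : 0 <= k%:R :> R by [].
rewrite exprS -natr1; apply: le_trans (_ : _ <= (1 - u) * (1 - k%:R * u)) _.
  by have := mulr_ge0 k0 (sqr_ge0 u); nra.
by rewrite ler_wpM2l // subr_ge0.
Qed.

Lemma bernoulli_upper (u : R) k : 0 <= u <= 1 -> (1 - u) ^+ k <= (1 + k%:R * u)^-1.
Proof.
move=> /andP[u0 u1]; have k0 : 0 <= k%:R :> R by [].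
have d0 : 0 < 1 + k%:R * u by rewrite ltr_pwDl // mulr_ge0.
rewrite -[leRHS]mul1r ler_pdivlMr //.
have kb : 1 + k%:R * u <= (1 + u) ^+ k.
  elim: {d0} k k0 => [|k IH] _; first by rewrite mul0r addr0 expr0.
  have k0 : 0 <= k%:R :> R by [].
  rewrite exprS -natr1; apply: le_trans (_ : _ <= (1 + u) * (1 + k%:R * u)) _.
    by have := mulr_ge0 k0 (sqr_ge0 u); nra.
  by rewrite ler_wpM2l ?IH // addr_ge0.
apply: le_trans (ler_wpM2l _ kb) _; first by rewrite exprn_ge0 // subr_ge0.
rewrite -exprMn exprn_ile1 //; last by nra.
by rewrite mulr_ge0 ?subr_ge0 // addr_ge0.
Qed.

(* On [-1, 1] these polynomials converge to the indicator of the negative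
   numbers. *)
Definition step_fun (n : nat) (x : R) : R :=
  (1 - ((1 + x) / 2) ^+ n) ^+ (n * 2 ^ n).

Lemma step_fun_bound n x : `|x| <= 1 -> 0 <= step_fun n x <= 1.
Proof.
rewrite ler_norml => /andP[x0 x1].
have h0 : 0 <= (1 + x) / 2 by lra.
have h1 : (1 + x) / 2 <= 1 by lra.
have p0 : 0 <= ((1 + x) / 2) ^+ n by rewrite exprn_ge0.
have p1 : ((1 + x) / 2) ^+ n <= 1 by rewrite exprn_ile1.
by rewrite exprn_ge0 ?subr_ge0 //= exprn_ile1 ?subr_ge0 // gerBl.
Qed.

(** The exponent n 2^n is chosen so that its product with ((1 + x) / 2)^n is n (1 + x)^n, which
    tends to 0 for x < 0 and is at least n for x >= 0. The two Bernoulli bounds conclude. *)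
Lemma step_fun_cvg x : `|x| <= 1 ->
  step_fun n x @[n --> \oo] --> ((x < 0)%R%:R : R).
Proof.
move=> x1; have := x1; rewrite ler_norml => /andP[xN xP].
pose u n : R := ((1 + x) / 2) ^+ n.
have u01 n : 0 <= u n <= 1.
  have h0 : 0 <= (1 + x) / 2 by lra.
  by rewrite exprn_ge0 // exprn_ile1 //; lra.
have ku n : (n * 2 ^ n)%:R * u n = n%:R * (1 + x) ^+ n.
  by rewrite natrM natrX -mulrA /u -exprMn; congr (_ * _ ^+ _); field.
have [x0|x0] := ltP x 0.
  have c : 1 - n%:R * (1 + x) ^+ n @[n --> \oo] --> (1 : R).
    rewrite -[X in _ --> X]subr0; apply: cvgB; first exact: cvg_cst.
    by apply: mulrn_expr_cvg0; apply/andP; split; lra.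
  rewrite /= mulr1n; apply: (@squeeze_cvgr _ _ _ _ (fun n => 1 - n%:R * (1 + x) ^+ n) (fun=> 1)) => //; last exact: cvg_cst.
  apply: nearW => n.
  have /andP[_ ->] := step_fun_bound n x1; rewrite andbT -ku.
  exact: bernoulli_lower.
rewrite /= mulr0n; apply: (squeeze_cvgr _ (cvg_cst 0) (@cvg_harmonic R)); apply: nearW => n.
have /andP[-> _] := step_fun_bound n x1; rewrite /=.
apply: le_trans (bernoulli_upper _ (u01 n)) _.
rewrite ku /harmonic /= lef_pV2 ?posrE ?ltr0n //; last first.
  by rewrite ltr_pwDl // mulr_ge0 // exprn_ge0 //; lra.
rewrite -natr1 addrC lerD2l ler_peMr // exprn_ege1 //; lra.
Qed.

End step_polynomials.

Section indic_bigcup.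
Variables (R : realType) (T : Type) (F : nat -> set T).

Lemma indic_bigcupS n x : trivIset setT F ->
  \1_(\bigcup_(k < n.+1) F k) x = \1_(\bigcup_(k < n) F k) x + \1_(F n) x :> R.
Proof.
move=> tF; rewrite !indicE; have [Fn|Fn] := boolP (x \in F n).
  move: (Fn); rewrite inE => Fn'.
  rewrite [x \in \bigcup_(k < n) F k]memNset ?add0r; last first.
    move=> [k /= kn Fk]; have := tF k n Logic.I Logic.I.
    move=> /(_ (ex_intro _ x (conj Fk Fn'))) kE.
    by rewrite kE ltnn in kn.
  by rewrite mem_set //; exists n => //=.
rewrite addr0; congr ((nat_of_bool _)%:R); apply/idP/idP; rewrite !inE => -[k /= kn Fk].
  exists k => //=; move: kn; rewrite ltnS leq_eqVlt => /predU1P[kE|//].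
  by move: Fn; rewrite notin_setE -kE.
by exists k => //=; exact: ltnW.
Qed.

Lemma indic_bigcup_cvg x :
  \1_(\bigcup_(k < n) F k) x @[n --> \oo] --> (\1_(\bigcup_k F k) x : R).
Proof.
apply: cvg_near_cst; have [[k _ Fk]|nF] := pselect ((\bigcup_k F k) x).
  exists k.+1 => // n /= kn; rewrite !indicE !mem_set //; first by exists k.
  by exists k.
apply: nearW => n; rewrite !indicE !memNset // => -[k _ Fk].
by apply: nF; exists k.
Qed.

End indic_bigcup.

(** * From cosines to indicators of events *)

Section annihilator.
Variables (R : realType) (d : measure_display) (T : measurableType d).
Variables (P : probability T R) (X : T -> R) (V : set (T -> R)).
Hypothesis iX : P.-integrable setT (EFin \o X).
Hypothesis mV : forall v, V v -> measurable_fun setT v.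
Hypothesis VD : forall (a b : R) v w, V v -> V w -> V (fun t => a * v t + b * w t).
Hypothesis V0 : V (fun=> 0).
Hypothesis X0 : forall v a, V v -> (\int[P]_t (X t * cos (v t + a)))%R = 0.

Local Notation "\E Y" := (\int[P]_t Y t)%R (at level 10, Y at level 8).

(** The factors F that keep X F orthogonal to all the cosines. Boundedness keeps the products
    integrable. *)
Definition annihilated (F : T -> R) : Prop :=
  [/\ measurable_fun setT F, exists M, forall t, `|F t| <= M
    & forall v a, V v -> \E (fun t => X t * (F t * cos (v t + a))) = 0].

Lemma measurable_cos_shift v a : V v -> measurable_fun setT (fun t => cos (v t + a)).
Proof.
move=> Vv; apply: measurableT_comp; first exact: measurable_cos.
by apply: measurable_funD => //; exact: mV.
Qed.

Lemma annihilated_integrable F v a : V v -> annihilated F ->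
  P.-integrable setT (EFin \o (fun t => X t * (F t * cos (v t + a)))).
Proof.
move=> Vv [mF [M FM] _]; apply: (integrable_mul_bounded (M := M)) => // [|t].
  by apply: measurable_funM => //; exact: measurable_cos_shift.
by rewrite normrM; apply: le_trans (FM t); rewrite ler_piMr // cos_norm_le1.
Qed.

Lemma annihilated_Rintegral F : annihilated F -> \E (fun t => X t * F t) = 0.
Proof.
move=> [_ _ /(_ _ 0 V0) E]; rewrite -[RHS]E; apply: eq_Rintegral => t _.
by rewrite addr0 cos0 mulr1.
Qed.

Lemma annihilated1 : annihilated (fun=> 1).
Proof.
split=> [//||v a Vv]; first by exists 1 => t; rewrite normr1.
by rewrite -[RHS](X0 a Vv); apply: eq_Rintegral => t _; rewrite mul1r.
Qed.

Lemma annihilated_lin (a b : R) F H : annihilated F -> annihilated H ->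
  annihilated (fun t => a * F t + b * H t).
Proof.
move=> aF aH; have [mF [M FM] F0] := aF; have [mH [K HK] H0] := aH.
split.
- by apply: measurable_funD; apply: measurable_funM.
- exists (`|a| * M + `|b| * K) => t; apply: le_trans (ler_normD _ _) _.
  by rewrite !normrM lerD // ler_wpM2l.
- move=> v c Vv.
  have iF := annihilated_integrable c Vv aF; have iH := annihilated_integrable c Vv aH.
  transitivity (\int[P]_t (a * (X t * (F t * cos (v t + c))) +
                           b * (X t * (H t * cos (v t + c)))))%R.
    by apply: eq_Rintegral => t _; ring.
  rewrite RintegralD //.
  + by rewrite !RintegralZl // F0 // H0 // !mulr0 addr0.
  + by apply: eq_integrable (integrableZl measurableT a iF).
  + by apply: eq_integrable (integrableZl measurableT b iH).
Qed.

(* By the product formula for cosines the annihilated functions are stable under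
   multiplication by cosines, hence by polynomials in them, hence by the
   limits of these, among which are the indicators of events. *)
Definition multiplier (h : T -> R) : Prop :=
  forall F, annihilated F -> annihilated (fun t => F t * h t).

Lemma multiplier_cos w b : V w -> multiplier (fun t => cos (w t + b)).
Proof.
move=> Vw F aF; have [mF [M FM] F0] := aF; split.
- by apply: measurable_funM => //; exact: measurable_cos_shift.
- exists M => t; rewrite normrM; apply: le_trans (FM t).
  by rewrite ler_piMr // cos_norm_le1.
- move=> v a Vv; have Vp := VD 1 1 Vv Vw; have Vm := VD 1 (-1) Vv Vw.
  have ip := annihilated_integrable (a + b) Vp aF.
  have im := annihilated_integrable (a - b) Vm aF.
  transitivity (\int[P]_t (2^-1 *
      (X t * (F t * cos (1 * v t + 1 * w t + (a + b)))) + 2^-1 *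
      (X t * (F t * cos (1 * v t + (-1) * w t + (a - b))))))%R.
    apply: eq_Rintegral => t _.
    have -> : 1 * v t + 1 * w t + (a + b) = (v t + a) + (w t + b) by ring.
    have -> : 1 * v t + (-1) * w t + (a - b) = (v t + a) - (w t + b) by ring.
    by rewrite (cosD (v t + a)) (cosB (v t + a)); field.
  rewrite RintegralD //.
  + by rewrite !RintegralZl // F0 // F0 // !mulr0 addr0.
  + by apply: eq_integrable (integrableZl measurableT (2^-1) ip).
  + by apply: eq_integrable (integrableZl measurableT (2^-1) im).
Qed.

Lemma annihilated_lim (F_ : nat -> T -> R) F M :
  (forall n, annihilated (F_ n)) -> (forall n t, `|F_ n t| <= M) ->
  (forall t, F_ n t @[n --> \oo] --> F t) -> annihilated F.
Proof.
move=> aF FM cF.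
have mF : measurable_fun setT F.
  by apply: (@measurable_fun_cvg _ _ _ setT F_); [move=> n; have [] := aF n|move=> t _; exact: cF].
have bF t : `|F t| <= M.
  by apply: (cvgr_to_le (cvg_norm (cF t))); apply: nearW => n; exact: FM.
split => //; first by exists M.
move=> v a Vv.
have iMX : P.-integrable setT (EFin \o (fun t => M * `|X t|)).
  have := integrableZl measurableT M (integrable_norm iX).
  exact: eq_integrable.
have mX : measurable_fun setT X by apply/measurable_EFinP; exact: (measurable_int P).
have [_ c] : P.-integrable setT (EFin \o (fun t => X t * (F t * cos (v t + a)))) /\
  \E (fun t => X t * (F_ n t * cos (v t + a))) @[n --> \oo] -->
  \E (fun t => X t * (F t * cos (v t + a))).
  apply: Rintegral_cvg_dominated iMX _ => [n||t|n t].
  - apply: measurable_funM => //; apply: measurable_funM; last exact: measurable_cos_shift.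
    by have [] := aF n.
  - by apply: measurable_funM => //; apply: measurable_funM => //; exact: measurable_cos_shift.
  - by apply: cvgMr; apply: cvgMl; exact: cF.
  - rewrite normrM mulrC ler_wpM2r // normrM; apply: le_trans (FM n t).
    by rewrite ler_piMr // cos_norm_le1.
rewrite -(cvg_lim (@Rhausdorff R) c).
have -> : (fun n => \E (fun t => X t * (F_ n t * cos (v t + a)))) = (fun=> 0).
  by apply/funext => n; have [_ _ ->] := aF n.
exact: lim_cst.
Qed.

Lemma multiplier_horner h (p : {poly R}) : multiplier h -> multiplier (fun t => p.[h t]).
Proof.
move=> mh; elim/poly_ind: p => [|p c IH] F aF.
  have := annihilated_lin 0 0 aF aF; congr annihilated; apply/funext => t.
  by rewrite horner0 !mul0r addr0 mulr0.
have := annihilated_lin 1 c (mh _ (IH _ aF)) aF; congr annihilated; apply/funext => t.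
by rewrite hornerMXaddC; ring.
Qed.

Lemma multiplier_lim (h_ : nat -> T -> R) h K :
  (forall n, multiplier (h_ n)) -> (forall n t, `|h_ n t| <= K) ->
  (forall t, h_ n t @[n --> \oo] --> h t) -> multiplier h.
Proof.
move=> mh hK ch F aF; have [_ [M FM] _] := aF.
apply: (@annihilated_lim (fun n t => F t * h_ n t) _ (M * K)) => [n|n t|t].
- exact: mh.
- by rewrite normrM ler_pM.
- by apply: cvgMr; exact: ch.
Qed.

(** A sine is a cosine shifted by pi / 2, so the step polynomials evaluated at it are multipliers,
    and they converge to the indicator of its being negative. *)
Lemma multiplier_sin_neg w b : V w ->
  multiplier (fun t => (sin (w t + b) < 0)%R%:R).
Proof.
move=> Vw.
apply: (@multiplier_lim (fun n t => step_fun n (sin (w t + b))) _ 1) => [n|n t|t].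
- pose p : {poly R} := (1 - ((1 + 'X) * (2^-1)%:P) ^+ n) ^+ (n * 2 ^ n).
  have := multiplier_horner p (multiplier_cos (b - pi / 2) Vw).
  congr multiplier; apply/funext => t.
  by rewrite addrA cosBpihalf /p /step_fun !hornerE.
- have /andP[s0 s1] := step_fun_bound n (sin_norm_le1 (w t + b)).
  by rewrite ger0_norm.
- exact: step_fun_cvg (sin_norm_le1 _).
Qed.

(** Once n + 1 exceeds |w - a| / pi, the sine of (w - a) / (n + 1) has the sign of w - a. *)
Lemma multiplier_lt w a : V w -> multiplier (fun t => (w t < a)%R%:R).
Proof.
move=> Vw.
apply: (@multiplier_lim (fun n t => (sin (n.+1%:R^-1 * w t + 0 * w t - a / n.+1%:R) < 0)%R%:R) _ 1) => [n|n t|t].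
- by apply: (multiplier_sin_neg (- (a / n.+1%:R))); exact: VD.
- by case: (_ < _); rewrite ?normr1 ?normr0.
- apply: cvg_near_cst; pose z := w t - a.
  exists (Num.truncn (`|z| / pi)).+1 => // n /= zn.
  have n0 : 0 < n.+1%:R :> R by rewrite ltr0n.
  have -> : n.+1%:R^-1 * w t + 0 * w t - a / n.+1%:R = z / n.+1%:R.
    by rewrite /z; field; rewrite gt_eqF.
  have p0 := pi_gt0 R.
  have zpi : `|z / n.+1%:R| < pi.
    rewrite normrM normfV (ger0_norm (ltW n0)) ltr_pdivrMr // mulrC -ltr_pdivrMr //.
    by apply: lt_le_trans (truncnS_gt _) _; rewrite ler_nat ltnW.
  congr ((nat_of_bool _)%:R); rewrite -[RHS]subr_lt0 -/z.
  move: zpi; rewrite ltr_norml => /andP[z1 z2].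
  have [zn0|zp|->] := ltgtP z 0.
  + rewrite -[_ / _]opprK sinN oppr_lt0 sin_gt0_pi // oppr_gt0 ltrNl z1 andbT.
    by rewrite pmulr_llt0 ?invr_gt0.
  + by apply/negbTE; rewrite -leNgt ltW // sin_gt0_pi // z2 andbT divr_gt0.
  + by rewrite mul0r sin0 ltxx.
Qed.

(** Multipliers are closed under linear combinations and bounded limits, so the sets with this
    property form a Dynkin system containing the half-lines. *)
Lemma multiplier_indic w (B : set R) : V w -> measurable B ->
  multiplier (fun t => \1_B (w t)).
Proof.
move=> Vw mB.
have m1 : multiplier (fun=> 1).
  by move=> F; congr annihilated; apply/funext => t; rewrite mulr1.
have mlin (a b : R) g h : multiplier g -> multiplier h ->
    multiplier (fun t => a * g t + b * h t).
  move=> mg mh F aF; have := annihilated_lin a b (mg _ aF) (mh _ aF).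
  by congr annihilated; apply/funext => t; ring.
pose G := [set A : set R | exists x, A = `]-oo, x[%classic].
apply: (@dynkin_induction _ _ (@RGenInftyO.G R) (fun B => multiplier (fun t => \1_B (w t)))) => //.
- exact: RGenInftyO.measurableE.
- move=> _ _ [x ->] [y ->]; exists (Num.min x y).
  by apply/seteqP; split=> z /=; rewrite !in_itv /= lt_min => /andP.
- by move: m1; congr multiplier; apply/funext => t; rewrite indicT.
- move=> A [x ->]; have := multiplier_lt x Vw; congr multiplier; apply/funext => t.
  by rewrite indicE mem_setE in_itv.
- move=> S mS IH; have := mlin 1 (-1) _ _ m1 IH; congr multiplier; apply/funext => t.
  by rewrite !indicE in_setC; case: (_ \in _); rewrite /=; ring.
- move=> S mS tS IH.
  have US n : multiplier (fun t => \1_(\bigcup_(k < n) S k) (w t)).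
    elim: n => [|n IHn].
      have := mlin 0 0 _ _ m1 m1; congr multiplier; apply/funext => t.
      by rewrite !mul0r addr0 indicE memNset //= => -[].
    have := mlin 1 1 _ _ IHn (IH n); congr multiplier; apply/funext => t.
    by rewrite !mul1r indic_bigcupS.
  apply: (@multiplier_lim (fun n t => \1_(\bigcup_(k < n) S k) (w t)) _ 1) => // [n t|t].
    exact: indic_norm_le1.
  exact: indic_bigcup_cvg.
- exact: (eq_ind _ (fun S : set (set R) => S B) mB _ (RGenInftyO.measurableE R)).
Qed.

End annihilator.

(** * Cosine and sine means of a single Gaussian vector *)

Section gaussian_vector.
Variables (R : realType) (d : measure_display) (T : measurableType d).
Variables (P : probability T R) (n : nat) (X : T -> 'cV[R]_n) (S : 'M[R]_n).
Hypothesis gX : centered_gaussian P X S.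
Hypothesis pS : posdef S.

Local Notation "\E Y" := (\int[P]_t Y t)%R (at level 10, Y at level 8).

Lemma dot_sum (c : 'cV[R]_n) (x : 'cV[R]_n) : (c^T *m x) 0 0 = \sum_l c l 0 * x l 0.
Proof. by rewrite mxE; apply: eq_bigr => l _; rewrite mxE. Qed.

Lemma measurable_dot (c : 'cV[R]_n) : measurable_fun setT (fun t => (c^T *m X t) 0 0).
Proof.
under eq_fun do rewrite dot_sum.
by apply: measurable_sum => l; apply: measurable_funM => //; have [] := gX.
Qed.

Lemma sigma_vec_dot (c : 'cV[R]_n) (B : set R) : measurable B ->
  sigma_vec X ((fun t => (c^T *m X t) 0 0) @^-1` B).
Proof.
move=> mB; pose G := [set E | exists (l : 'I_n) (B : set R),
         measurable B /\ E = (fun t => X t l 0) @^-1` B].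
have mc l : measurable_fun setT (fun t : g_sigma_algebraType G => X t l 0).
  move=> _ C mC; rewrite setTI; apply: sub_sigma_algebra; by exists l, C.
have : measurable_fun setT (fun t : g_sigma_algebraType G => (c^T *m X t) 0 0).
  under eq_fun do rewrite dot_sum.
  by apply: measurable_sum => l; apply: measurable_funM => //; exact: mc.
by move=> /(_ measurableT B mB); rewrite setTI.
Qed.

Lemma Rintegral_gaussian (c : 'cV[R]_n) (f : R -> R) : c != 0 ->
  measurable_fun setT f -> (forall x, `|f x| <= 1) ->
  \E (fun t => f ((c^T *m X t) 0 0)) =
  (\int[lebesgue_measure]_x (normal_pdf 0 (Num.sqrt (qform S c)) x * f x))%R.
Proof.
move=> c0 mf f1; have [_ /(_ c c0) law] := gX.
have mD := measurable_dot c.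
transitivity (\int[P]_t (1 * f ((c^T *m X t) 0 0)))%R.
  by apply: eq_Rintegral => t _; rewrite mul1r.
apply: (Rintegral_bounded_transfer (Y := id)) => //.
- by apply: (probability_bounded_integrable P (M := 1)) => // t; rewrite normr1.
- exact: integrable_normal_pdf.
move=> B mB; have := law B mB; rewrite /pushforward /normal_prob => E.
transitivity (fine (P ((fun t => (c^T *m X t) 0 0) @^-1` B))).
  rewrite /Rintegral -[in RHS](setIT (_ @^-1` _)) -integral_indic //; last first.
    by rewrite -[X in measurable X]setTI; exact: mD.
  by congr fine; apply: eq_integral => t _; rewrite mul1r.
rewrite E -/(Rintegral _ _ _) Rintegral_mkcond; apply: eq_Rintegral => x _.
by rewrite patchE [\1_B x]indicE; case: (x \in B); rewrite ?mulr1 ?mulr0.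
Qed.

Lemma gaussian_cos (c : 'cV[R]_n) :
  \E (fun t => cos ((c^T *m X t) 0 0)) = expR (- bform S c c / 2).
Proof.
(* The law is prescribed only for nonzero functionals; at c = 0 both sides equal 1. *)
have [->|c0] := eqVneq c 0.
  rewrite bform0l oppr0 mul0r expR0.
  under eq_Rintegral do rewrite trmx0 mul0mx mxE cos0.
  rewrite Rintegral_cst // mul1r -[RHS]/(fine 1%E); congr fine; exact: probability_setT.
have [_ /(_ c c0) Sc] := pS.
have s0 : 0 < Num.sqrt (qform S c) by rewrite sqrtr_gt0.
rewrite (Rintegral_gaussian c0 (@measurable_cos R) (@cos_norm_le1 R)).
have := normal_cosE s0 1; rewrite /normal_cos mul1r sqr_sqrtr ?ltW // => <-.
by apply: eq_Rintegral => x _; rewrite mul1r mulrC.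
Qed.

(** The functionals c and -c have the same normal law, while the sine is odd. *)
Lemma gaussian_sin (c : 'cV[R]_n) : \E (fun t => sin ((c^T *m X t) 0 0)) = 0.
Proof.
have [->|c0] := eqVneq c 0.
  under eq_Rintegral do rewrite trmx0 mul0mx mxE sin0.
  by rewrite Rintegral_cst // mul0r.
have nc0 : - c != 0 by rewrite oppr_eq0.
have E := Rintegral_gaussian c0 (@measurable_sin R) (@sin_norm_le1 R).
have EN := Rintegral_gaussian nc0 (@measurable_sin R) (@sin_norm_le1 R).
have qN : qform S (- c) = qform S c.
  by rewrite !qformE -scaleN1r bformZl bformZr mulrA mulN1r opprK mul1r.
rewrite qN -E in EN.
have : \E (fun t => sin (((- c)^T *m X t) 0 0)) = - \E (fun t => sin ((c^T *m X t) 0 0)).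
  rewrite -mulN1r -RintegralZl //; last first.
    apply: (probability_bounded_integrable P (M := 1)) => [|t]; last exact: sin_norm_le1.
    by apply: measurableT_comp; [exact: measurable_sin|exact: measurable_dot].
  by apply: eq_Rintegral => t _; rewrite linearN /= mulNmx mxE sinN mulN1r.
by rewrite EN; lra.
Qed.

End gaussian_vector.

(** * Bounded trigonometric approximations of x and of its square *)

Section trig_limits.
Variable R : realType.

Lemma cvg_ext (I : Type) (F : set_system I) (f g : I -> R) (l : R) :
  (forall i, f i = g i) -> f i @[i --> F] --> l -> g i @[i --> F] --> l.
Proof. by move=> /funext ->. Qed.

Lemma norm_sin_le (x : R) : `|sin x| <= `|x|.
Proof.
have pos (y : R) : 0 <= y -> `|sin y| <= y.
  rewrite le_eqVlt => /predU1P[<-|y0]; first by rewrite sin0 normr0.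
  have [c _] := @MVT R (@sin R) (@cos R) 0 y y0 (fun z _ => is_derive_sin z)
    (continuous_subspaceT (@continuous_sin R)).
  rewrite sin0 !subr0 => ->; rewrite normrM (ger0_norm (ltW y0)).
  by rewrite ler_piMl ?(ltW y0) // cos_norm_le1.
have [x0|x0] := leP 0 x; first by rewrite (ger0_norm x0) pos.
by rewrite -[sin x]opprK -sinN normrN (ltr0_norm x0) pos // oppr_ge0 ltW.
Qed.

Lemma cvg_mul_sin_div (x : R) :
  n.+1%:R * sin (x / n.+1%:R) @[n --> \oo] --> x.
Proof.
have [->|x0] := eqVneq x 0.
  rewrite [X in X @ _](_ : _ = (fun=> 0)); first exact: cvg_cst.
  by apply/funext => n; rewrite mul0r sin0 mulr0.
have d0 : h^-1 *: (sin (h + 0) - sin 0) @[h --> 0^'] --> (1 : R).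
  have := @is_derive_sin R 0; rewrite cos0 => -[dv <-].
  move: dv => /cvg_ex[/= l cl].
  have E : 'D_1 sin (0 : R) = l.
    by apply/cvg_lim => //; exact: cl.
  rewrite E; apply: cvg_ext cl => h.
  by rewrite /= [h *: 1]mulr1.
have /cvgr_dnbhsP /(_ (fun n => x / n.+1%:R)) H := d0.
have c : x * ((x / n.+1%:R)^-1 *: (sin (x / n.+1%:R + 0) - sin 0)) @[n --> \oo] --> x.
  rewrite -[X in _ --> X]mulr1; apply: cvgMr; apply: H; split.
    by move=> n; rewrite mulf_neq0 // invr_neq0.
  rewrite -[X in _ --> X](mulr0 x); apply: cvgMr; exact: cvg_harmonic.
apply: cvg_ext c => n.
rewrite sin0 subr0 addr0 /GRing.scale /= invf_div mulrA [x * _]mulrC divfK //.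
Qed.

Lemma sqr_sin_half (x : R) : 2 * (1 - cos x) = (2 * sin (x / 2)) ^+ 2.
Proof.
set y := x / 2; have -> : x = y *+ 2 by rewrite -mulr_natr divfK.
by rewrite cos_mulr2n exprMn sin2cos2; ring.
Qed.

Lemma cvg_cos_quotient (x : R) :
  2 * (1 - cos (x / n.+1%:R)) * n.+1%:R ^+ 2 @[n --> \oo] --> x ^+ 2.
Proof.
have c : (2 * (n.+1%:R * sin (x / 2 / n.+1%:R))) ^+ 2 @[n --> \oo] --> (2 * (x / 2)) ^+ 2.
  have c1 : 2 * (n.+1%:R * sin (x / 2 / n.+1%:R)) @[n --> \oo] --> 2 * (x / 2).
    by apply: cvgMr; exact: cvg_mul_sin_div.
  by rewrite expr2; apply: (cvg_ext _ (cvgM c1 c1)) => n; rewrite expr2.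
have -> : x ^+ 2 = (2 * (x / 2)) ^+ 2 by congr (_ ^+ 2); field.
apply: cvg_ext c => n.
by rewrite sqr_sin_half -exprMn; congr (_ ^+ 2); rewrite [x / 2 / _]mulrAC; ring.
Qed.

(** With N = n + 1, the half-angle formula turns the expression into the square of 2 N sin (x / (2
    N)), and |sin y| <= |y|. *)
Lemma cos_quotient_bound (x : R) n :
  0 <= 2 * (1 - cos (x / n.+1%:R)) * n.+1%:R ^+ 2 <= x ^+ 2.
Proof.
rewrite sqr_sin_half -exprMn sqr_ge0 /= -[leRHS]real_normK ?num_real //.
rewrite -[leLHS]real_normK ?num_real // ler_sqr ?nnegrE //.
apply: le_trans (_ : _ <= `|2 * (x / n.+1%:R / 2) * n.+1%:R|) _.
  by rewrite !normrM ler_wpM2r // ler_wpM2l // -!normrM norm_sin_le.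
rewrite le_eqVlt; apply/orP; left; apply/eqP; congr `|_|; field.
by rewrite nat1r pnatr_eq0.
Qed.

Lemma fatou_integrable d (T : measurableType d) (mu : {measure set T -> \bar R})
    (f_ : nat -> T -> R) (f : T -> R) (K : R) :
  (forall n, measurable_fun setT (f_ n)) -> measurable_fun setT f ->
  (forall n t, 0 <= f_ n t) ->
  (forall n, (\int[mu]_t (f_ n t)%:E <= K%:E)%E) ->
  (forall t, f_ n t @[n --> \oo] --> f t) ->
  mu.-integrable setT (EFin \o f).
Proof.
move=> mf_ mf f0 fK cf.
have f00 t : 0 <= f t.
  by apply: (cvgr_to_ge (cf t)); apply: nearW => n; exact: f0.
apply/integrableP; split; first exact/measurable_EFinP.
have mE n : measurable_fun setT (fun t => (f_ n t)%:E) by apply/measurable_EFinP.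
have f0E n t : [set: T] t -> (0 <= (f_ n t)%:E)%E by rewrite lee_fin.
have := fatou mu measurableT mE f0E.
rewrite (eq_integral (fun t => `|(EFin \o f) t|%E)); last first.
  move=> t _ /=; rewrite is_cvg_limn_einfE; last first.
    by apply/cvg_ex; exists (f t)%:E; apply: cvg_EFin (cf t); exact: nearW.
  rewrite ger0_norm //; apply/cvg_lim => //.
  by apply: cvg_EFin (cf t); exact: nearW.
move=> /le_lt_trans; apply; apply: le_lt_trans (ltry K).
rewrite limn_einf_lim; apply: lime_le; first exact: is_cvg_einfs.
apply: nearW => n; apply: le_trans (fK n); apply: ereal_inf_lbound.
by exists n => /=.
Qed.

End trig_limits.

(** * Uncorrelated linear forms of independent Gaussian vectors *)

Section gaussian_family.
Variables (R : realType) (d : measure_display) (T : measurableType d).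
Variables (P : probability T R) (I : eqType) (dim : I -> nat).
Variables (vec : forall i, T -> 'cV[R]_(dim i)) (S : forall i, 'M[R]_(dim i)).
Variables (L : seq I) (GG : set (set T)).
Hypothesis uL : uniq L.
Hypothesis gvec : forall i, i \in L -> centered_gaussian P (vec i) (S i).
Hypothesis pS : forall i, i \in L -> posdef (S i).
Hypothesis mGG : forall G, GG G -> measurable G.
Hypothesis GGT : GG setT.
Hypothesis indep : forall (G : set T) (J : seq I) (E : I -> set T), GG G ->
  uniq J -> {subset J <= L} -> (forall i, i \in J -> sigma_vec (vec i) (E i)) ->
  P (G `&` \bigcap_(i in [set` J]) E i) = (P G * \prod_(i <- J) P (E i))%E.

Local Notation "\E Y" := (\int[P]_t Y t)%R (at level 10, Y at level 8).

Definition coef := forall i, 'cV[R]_(dim i).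
Implicit Types c e y : coef.

Definition coefD (a b : R) c e : coef := fun i => a *: c i + b *: e i.
Definition lin c (t : T) : R := \sum_(i <- L) ((c i)^T *m vec i t) 0 0.
(** The covariance of [lin c] and [lin e], the vectors being independent. As an algebraic expression
    it allows orthogonality to be checked by matrix computation. *)
Definition cov c e : R := \sum_(i <- L) bform (S i) (c i) (e i).

Lemma linD a b c e t : lin (coefD a b c e) t = a * lin c t + b * lin e t.
Proof.
rewrite /lin !big_distrr /= -big_split /=; apply: eq_bigr => i _.
by rewrite linearD /= !linearZ /= mulmxDl -!scalemxAl !mxE.
Qed.

Lemma covC c e : cov c e = cov e c.
Proof. by apply: eq_big_seq => i /pS[sS _]; rewrite bformC. Qed.

Lemma covDl a b c e y : cov (coefD a b c e) y = a * cov c y + b * cov e y.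
Proof.
rewrite /cov !big_distrr /= -big_split /=; apply: eq_bigr => i _.
by rewrite bformDl !bformZl.
Qed.

Lemma covDr a b c e y : cov y (coefD a b c e) = a * cov y c + b * cov y e.
Proof. by rewrite covC covDl !(covC y). Qed.

Lemma cov_ge0 c : 0 <= cov c c.
Proof.
rewrite /cov big_seq sumr_ge0 // => i iL; apply: possemidef_ge0.
exact/posdef_possemidef/pS.
Qed.

Lemma measurable_lin c : measurable_fun setT (lin c).
Proof. by apply: measurable_sum_seq => i /gvec gi; exact: measurable_dot gi _. Qed.

Section event.
Variable G : set T.
Hypothesis GGG : GG G.

Let indepX c (J : seq I) (B : I -> set R) : uniq J -> all (mem L) J ->
  (forall i, measurable (B i)) ->
  P (G `&` \bigcap_(i in [set` J]) ((fun t => ((c i)^T *m vec i t) 0 0) @^-1` B i)) =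
  (P G * \prod_(i <- J) P ((fun t => ((c i)^T *m vec i t) 0 0)%R @^-1` B i))%E.
Proof.
move=> uJ /allP JL mB; apply: indep => // i iJ; exact: sigma_vec_dot.
Qed.

Let mX c (i : I) : mem L i -> measurable_fun setT (fun t => ((c i)^T *m vec i t) 0 0).
Proof. by move=> /gvec gi; exact: measurable_dot gi _. Qed.

Let sinX c (i : I) : mem L i -> \E (sin \o (fun t => ((c i)^T *m vec i t) 0 0)) = 0.
Proof. by move=> iL; exact: gaussian_sin (gvec iL) _. Qed.

Lemma Rintegral_cos_lin c :
  \E (fun t => \1_G t * cos (lin c t)) = fine (P G) * expR (- cov c c / 2).
Proof.
rewrite (Rintegral_indep_cos (mGG GGG) (mX c) (indepX c) (sinX c)) //.
congr (_ * _); rewrite /cov -sumrN mulr_suml expR_sum.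
apply: eq_big_seq => i iL; exact: gaussian_cos (gvec iL) (pS iL) _.
Qed.

Lemma Rintegral_sin_lin c : \E (fun t => \1_G t * sin (lin c t)) = 0.
Proof.
rewrite (Rintegral_indep_sin (mGG GGG) (mX c) (indepX c) (sinX c)) => //; exact/allP.
Qed.

Let integrable_trig (f : R -> R) c a : measurable_fun setT f -> (forall x, `|f x| <= 1) ->
  P.-integrable setT (EFin \o (fun t => \1_G t * f (lin c t + a))).
Proof.
move=> mf f1; apply: (probability_bounded_integrable P (M := 1)) => [|t].
  apply: measurable_funM; first exact: measurable_indic (mGG GGG).
  apply: measurableT_comp => //; apply: measurable_funD => //; exact: measurable_lin.
by apply: norm_mul_le1 => //; exact: indic_norm_le1.
Qed.

Lemma Rintegral_cos_lin_shift c a :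
  \E (fun t => \1_G t * cos (lin c t + a)) =
  fine (P G) * expR (- cov c c / 2) * cos a.
Proof.
have ic := integrable_trig c 0 (@measurable_cos R) (@cos_norm_le1 R).
have iss := integrable_trig c 0 (@measurable_sin R) (@sin_norm_le1 R).
have ic' : P.-integrable setT (EFin \o (fun t => cos a * (\1_G t * cos (lin c t + 0)))).
  by apply: eq_integrable (integrableZl measurableT (cos a) ic).
have iss' : P.-integrable setT (EFin \o (fun t => sin a * (\1_G t * sin (lin c t + 0)))).
  by apply: eq_integrable (integrableZl measurableT (sin a) iss).
transitivity (\int[P]_t (cos a * (\1_G t * cos (lin c t + 0)) -
   sin a * (\1_G t * sin (lin c t + 0))))%R.
  by apply: eq_Rintegral => t _; rewrite addr0 cosD; ring.
rewrite RintegralB // !RintegralZl //.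
under eq_Rintegral do rewrite addr0.
under [X in _ - _ * X]eq_Rintegral do rewrite addr0.
by rewrite Rintegral_cos_lin Rintegral_sin_lin mulr0 subr0 mulrC.
Qed.

Lemma Rintegral_sin_lin_shift c a :
  \E (fun t => \1_G t * sin (lin c t + a)) =
  fine (P G) * expR (- cov c c / 2) * sin a.
Proof.
under eq_Rintegral do rewrite -cosBpihalf -addrA.
by rewrite Rintegral_cos_lin_shift cosBpihalf.
Qed.

(** As e and y are uncorrelated, s e + y and s e - y have the same variance, the sum of those of s e
    and y; after the product-to-sum formula the exponential of s e splits off. *)
Lemma orthogonal_cos e y s a : cov e y = 0 ->
  \E (fun t => \1_G t * (cos (s * lin e t) * cos (lin y t + a))) =
  expR (- (s ^+ 2 * cov e e) / 2) * \E (fun t => \1_G t * cos (lin y t + a)).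
Proof.
move=> ey; pose p := coefD s 1 e y; pose m := coefD s (-1) e y.
have ip := integrable_trig p a (@measurable_cos R) (@cos_norm_le1 R).
have im := integrable_trig m (- a) (@measurable_cos R) (@cos_norm_le1 R).
have ye : cov y e = 0 by rewrite covC.
transitivity (\int[P]_t (2^-1 * (\1_G t * cos (lin p t + a)) +
    2^-1 * (\1_G t * cos (lin m t + - a))))%R.
  apply: eq_Rintegral => t _; rewrite !linD.
  have -> : s * lin e t + 1 * lin y t + a = s * lin e t + (lin y t + a) by ring.
  have -> : s * lin e t + -1 * lin y t + - a = s * lin e t - (lin y t + a) by ring.
  by rewrite (cosD (s * _)) (cosB (s * _)); field.
rewrite RintegralD //; last 2 first.
- by apply: eq_integrable (integrableZl measurableT (2^-1) ip).
- by apply: eq_integrable (integrableZl measurableT (2^-1) im).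
rewrite !RintegralZl // !Rintegral_cos_lin_shift cosN !covDl !covDr ey ye.
set A := cov e e; set B := cov y y.
have -> : - (s * (s * A + 1 * 0) + 1 * (s * 0 + 1 * B)) / 2 = - (s ^+ 2 * A) / 2 + - B / 2 by field.
have -> : - (s * (s * A + -1 * 0) + -1 * (s * 0 + -1 * B)) / 2 = - (s ^+ 2 * A) / 2 + - B / 2 by field.
by rewrite expRD; field.
Qed.

Lemma orthogonal_sin e y s a : cov e y = 0 ->
  \E (fun t => \1_G t * (sin (s * lin e t) * cos (lin y t + a))) = 0.
Proof.
move=> ey; pose p := coefD s 1 e y; pose m := coefD s (-1) e y.
have ip := integrable_trig p a (@measurable_sin R) (@sin_norm_le1 R).
have im := integrable_trig m (- a) (@measurable_sin R) (@sin_norm_le1 R).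
have ye : cov y e = 0 by rewrite covC.
transitivity (\int[P]_t (2^-1 * (\1_G t * sin (lin p t + a)) +
    2^-1 * (\1_G t * sin (lin m t + - a))))%R.
  apply: eq_Rintegral => t _; rewrite !linD.
  have -> : s * lin e t + 1 * lin y t + a = s * lin e t + (lin y t + a) by ring.
  have -> : s * lin e t + -1 * lin y t + - a = s * lin e t - (lin y t + a) by ring.
  by rewrite (sinD (s * _)) (sinB (s * _)); field.
rewrite RintegralD //; last 2 first.
- by apply: eq_integrable (integrableZl measurableT (2^-1) ip).
- by apply: eq_integrable (integrableZl measurableT (2^-1) im).
rewrite !RintegralZl // !Rintegral_sin_lin_shift sinN !covDl !covDr ey ye.
set A := cov e e; set B := cov y y.
have -> : - (s * (s * A + 1 * 0) + 1 * (s * 0 + 1 * B)) / 2 = - (s ^+ 2 * A) / 2 + - B / 2 by field.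
have -> : - (s * (s * A + -1 * 0) + -1 * (s * 0 + -1 * B)) / 2 = - (s ^+ 2 * A) / 2 + - B / 2 by field.
by ring.
Qed.

End event.

(* The mean of 2 n^2 (1 - cos (x / n)), which tends to x^2 from below, at x = lin e. *)
Definition gauss_quotient e n : R :=
  2 * (1 - expR (- (n.+1%:R^-1 ^+ 2 * cov e e) / 2)) * n.+1%:R ^+ 2.

Lemma gauss_quotient_le e n : gauss_quotient e n <= cov e e.
Proof.
rewrite /gauss_quotient; set u := n.+1%:R^-1 ^+ 2 * cov e e / 2.
have -> : - (n.+1%:R^-1 ^+ 2 * cov e e) / 2 = - u by rewrite /u; field; rewrite nat1r pnatr_eq0.
have -> : cov e e = 2 * u * n.+1%:R ^+ 2 by rewrite /u; field; rewrite nat1r pnatr_eq0.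
rewrite ler_wpM2r ?sqr_ge0 // ler_wpM2l //.
by have := expR_ge1Dx (- u); lra.
Qed.

Lemma gauss_quotient_cvg e : gauss_quotient e n @[n --> \oo] --> cov e e.
Proof.
set v := cov e e; have v0 : 0 <= v by exact: cov_ge0.
have c : v - v ^+ 2 * @harmonic R n @[n --> \oo] --> v.
  rewrite -[X in _ --> X]subr0; apply: cvgB; first exact: cvg_cst.
  by rewrite -[X in _ --> X](mulr0 (v ^+ 2)); apply: cvgMr; exact: cvg_harmonic.
apply: (squeeze_cvgr _ c (cvg_cst v)); apply: nearW => n.
rewrite gauss_quotient_le andbT /gauss_quotient -/v /harmonic /=.
set N : R := n.+1%:R; have N1 : 1 <= N by rewrite ler1n.
have N0 : N != 0 by rewrite gt_eqF // (lt_le_trans ltr01).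
set u := N^-1 ^+ 2 * v / 2.
have u0 : 0 <= u by rewrite divr_ge0 // mulr_ge0 // sqr_ge0.
have -> : - (N^-1 ^+ 2 * v) / 2 = - u by rewrite /u; field.
(* Here (1 - u + u^2) (1 + u) = 1 + u^3 >= 1 and exp u >= 1 + u. *)
have e1 : expR (- u) <= 1 - u + u ^+ 2.
  rewrite expRN -[leLHS]mul1r ler_pdivrMr ?expR_gt0 //.
  have := expR_ge1Dx u; move: (expR u) => E uE.
  apply: le_trans (_ : _ <= (1 - u + u ^+ 2) * (1 + u)) _.
    by have := exprn_ge0 3 u0; rewrite -subr_ge0 => u3; rewrite -subr_ge0; move: u3; lra.
  by rewrite ler_wpM2l //; nra.
apply: le_trans (_ : _ <= 2 * (u - u ^+ 2) * N ^+ 2) _; last first.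
  by rewrite ler_wpM2r ?sqr_ge0 // ler_wpM2l //; lra.
have -> : 2 * (u - u ^+ 2) * N ^+ 2 = v - v ^+ 2 * (N^-1 * (N^-1 / 2)) by rewrite /u; field.
rewrite lerD2l lerN2 ler_wpM2l ?sqr_ge0 // ler_piMr ?invr_ge0 ?(le_trans _ N1) //.
have : N^-1 <= 1 by rewrite invf_le1 // (lt_le_trans ltr01).
by move: (N^-1) => w w1; rewrite ler_pdivrMr // mul1r (le_trans w1) // ler1n.
Qed.

Lemma Rintegral_cos_quotient (G : set T) e y a n : GG G -> cov e y = 0 ->
  \E (fun t => \1_G t * (2 * (1 - cos (lin e t / n.+1%:R)) * n.+1%:R ^+ 2 * cos (lin y t + a))) =
  gauss_quotient e n * \E (fun t => \1_G t * cos (lin y t + a)).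
Proof.
move=> GGG ey.
have mc (c : coef) b : measurable_fun setT (fun t => cos (lin c t + b)).
  apply: measurableT_comp; first exact: measurable_cos.
  by apply: measurable_funD => //; exact: measurable_lin.
have i1 : P.-integrable setT (EFin \o (fun t => \1_G t * cos (lin y t + a))).
  apply: (probability_bounded_integrable P (M := 1)) => [|t].
    by apply: measurable_funM => //; exact: measurable_indic (mGG GGG).
  by apply: norm_mul_le1; [exact: indic_norm_le1|exact: cos_norm_le1].
have i2 : P.-integrable setT (EFin \o (fun t => \1_G t *
    (cos (n.+1%:R^-1 * lin e t) * cos (lin y t + a)))).
  apply: (probability_bounded_integrable P (M := 1)) => [|t].
    apply: measurable_funM; first exact: measurable_indic (mGG GGG).
    apply: measurable_funM => //; apply: measurableT_comp; first exact: measurable_cos.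
    by apply: measurable_funM => //; exact: measurable_lin.
  by do !apply: norm_mul_le1; [exact: indic_norm_le1|exact: cos_norm_le1|exact: cos_norm_le1].
transitivity (\int[P]_t (2 * n.+1%:R ^+ 2 * (\1_G t * cos (lin y t + a) -
   \1_G t * (cos (n.+1%:R^-1 * lin e t) * cos (lin y t + a)))))%R.
  by apply: eq_Rintegral => t _; rewrite [lin e t / _]mulrC; ring.
have i3 : P.-integrable setT (EFin \o (fun t => \1_G t * cos (lin y t + a) -
   \1_G t * (cos (n.+1%:R^-1 * lin e t) * cos (lin y t + a)))).
  by apply: eq_integrable (integrableB measurableT i1 i2).
rewrite RintegralZl // RintegralB // orthogonal_cos // /gauss_quotient.
ring.
Qed.

Lemma measurable_cos_quotient e n :
  measurable_fun setT (fun t => 2 * (1 - cos (lin e t / n.+1%:R)) * n.+1%:R ^+ 2).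
Proof.
apply: measurable_funM => //; apply: measurable_funM => //.
apply: measurable_funB => //; apply: measurableT_comp; first exact: measurable_cos.
by apply: measurable_funM => //; exact: measurable_lin.
Qed.

(** The zero form, written with [coefD], specializes statements about a pair e, y to e alone. *)
Lemma coef0_orthogonal e : cov e (coefD 0 0 e e) = 0.
Proof. by rewrite covDr; ring. Qed.

(** Fatou's lemma: the bounded approximations of the square have mean [gauss_quotient e n], which
    never exceeds the variance. *)
Lemma integrable_sqr_lin e : P.-integrable setT (EFin \o (fun t => lin e t ^+ 2)).
Proof.
apply: (@fatou_integrable _ _ _ P
  (fun n t => 2 * (1 - cos (lin e t / n.+1%:R)) * n.+1%:R ^+ 2) _ (cov e e)).
- by move=> n; exact: measurable_cos_quotient.
- by apply: measurable_funX; exact: measurable_lin.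
- by move=> n t; have /andP[] := cos_quotient_bound (lin e t) n.
- move=> n.
  have ib : P.-integrable setT (EFin \o (fun t => 2 * (1 - cos (lin e t / n.+1%:R)) * n.+1%:R ^+ 2)).
    apply: (probability_bounded_integrable P (M := 4 * n.+1%:R ^+ 2)) => [|t].
      exact: measurable_cos_quotient.
    rewrite normrM [X in _ * X]ger0_norm ?sqr_ge0 // ler_wpM2r ?sqr_ge0 //.
    have := cos_norm_le1 (lin e t / n.+1%:R); rewrite !ler_norml => /andP[].
    by move: (cos _) => x *; apply/andP; split; lra.
  rewrite -[X in (X <= _)%E]fineK; last exact: integrable_fin_num.
  rewrite lee_fin -/(Rintegral _ _ _).
  have := Rintegral_cos_quotient 0 n GGT (coef0_orthogonal e).
  have L0 t : lin (coefD 0 0 e e) t = 0 by rewrite linD; ring.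
  under eq_Rintegral do rewrite indicT mul1r L0 addr0 cos0 mulr1.
  under [X in _ = _ * X]eq_Rintegral do rewrite indicT mul1r L0 addr0 cos0.
  rewrite Rintegral_cst // mul1r (_ : fine _ = 1); last first.
    by rewrite -[RHS]/(fine 1%E); congr fine; exact: probability_setT.
  by rewrite mulr1 => ->; exact: gauss_quotient_le.
- by move=> t; exact: cvg_cos_quotient.
Qed.

Lemma integrable_lin e : P.-integrable setT (EFin \o lin e).
Proof.
have i1 : P.-integrable setT (EFin \o (fun t : T => 1 : R)).
  by apply: (probability_bounded_integrable P (M := 1)) => // t; rewrite normr1.
have i2 : P.-integrable setT (EFin \o (fun t => 1 + lin e t ^+ 2)).
  by apply: eq_integrable (integrableD measurableT i1 (integrable_sqr_lin e)).
apply: le_integrable i2 => //.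
  by apply/measurable_EFinP; exact: measurable_lin.
move=> t _; rewrite /= lee_fin [leRHS]ger0_norm ?addr_ge0 ?sqr_ge0 //.
by rewrite -[X in 1 + X]real_normK ?num_real //; move: `|_| (normr_ge0 (lin e t)) => x; nra.
Qed.

(** The form [lin e] is the limit of N sin (lin e / N), dominated by |lin e|, and for the sine the
    integral vanishes exactly. *)
Lemma orthogonal_mean (G : set T) e y a : GG G -> cov e y = 0 ->
  \E (fun t => \1_G t * lin e t * cos (lin y t + a)) = 0.
Proof.
move=> GGG ey.
have mG : measurable_fun setT (\1_G : T -> R) by exact: measurable_indic (mGG GGG).
have mc : measurable_fun setT (fun t => cos (lin y t + a)).
  apply: measurableT_comp; first exact: measurable_cos.
  by apply: measurable_funD => //; exact: measurable_lin.
have me := measurable_lin e.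
have [_ c] : P.-integrable setT (EFin \o (fun t => \1_G t * lin e t * cos (lin y t + a))) /\
  \E (fun t => \1_G t * (n.+1%:R * sin (lin e t / n.+1%:R)) * cos (lin y t + a)) @[n --> \oo] -->
  \E (fun t => \1_G t * lin e t * cos (lin y t + a)).
  apply: Rintegral_cvg_dominated (integrable_norm (integrable_lin e)) _ => [n||t|n t].
  - apply: measurable_funM => //; apply: measurable_funM => //; apply: measurable_funM => //.
    apply: measurableT_comp; first exact: measurable_sin.
    by apply: measurable_funM.
  - by apply: measurable_funM => //; apply: measurable_funM.
  - by apply: cvgMl; apply: cvgMr; exact: cvg_mul_sin_div.
  - rewrite !normrM /=; apply: le_trans (ler_piMr _ (cos_norm_le1 _)) _; first by rewrite !mulr_ge0.
    apply: le_trans (ler_piMl _ (@indic_norm_le1 R T G t)) _; first by rewrite mulr_ge0.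
    rewrite mulrC -ler_pdivlMr ?normr_gt0 ?pnatr_eq0 // -normfV -normrM.
    exact: norm_sin_le.
rewrite -(cvg_lim (@Rhausdorff R) c).
have -> : (fun n => \E (fun t => \1_G t * (n.+1%:R * sin (lin e t / n.+1%:R)) * cos (lin y t + a))) = (fun=> 0).
  apply/funext => n.
  transitivity (\int[P]_t (n.+1%:R * (\1_G t * (sin (n.+1%:R^-1 * lin e t) * cos (lin y t + a)))))%R.
    by apply: eq_Rintegral => t _; rewrite [lin e t / _]mulrC; ring.
  rewrite RintegralZl //; first by rewrite orthogonal_sin // mulr0.
  apply: (probability_bounded_integrable P (M := 1)) => [|t].
    apply: measurable_funM => //; apply: measurable_funM => //.
    by apply: measurableT_comp; [exact: measurable_sin|exact: measurable_funM].
  by do !apply: norm_mul_le1; [exact: indic_norm_le1|exact: sin_norm_le1|exact: cos_norm_le1].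
exact: lim_cst.
Qed.

(** The same limit for the square: its cosine quotient contributes the factor [gauss_quotient e n],
    which tends to the variance. *)
Lemma orthogonal_variance (G : set T) e y a : GG G -> cov e y = 0 ->
  \E (fun t => \1_G t * (lin e t ^+ 2 - cov e e) * cos (lin y t + a)) = 0.
Proof.
move=> GGG ey.
have mG : measurable_fun setT (\1_G : T -> R) by exact: measurable_indic (mGG GGG).
have mc : measurable_fun setT (fun t => cos (lin y t + a)).
  apply: measurableT_comp; first exact: measurable_cos.
  by apply: measurable_funD => //; exact: measurable_lin.
have me := measurable_lin e.
pose f n t := 2 * (1 - cos (lin e t / n.+1%:R)) * n.+1%:R ^+ 2.
have [i1 c] : P.-integrable setT (EFin \o (fun t => \1_G t * (lin e t ^+ 2 * cos (lin y t + a)))) /\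
  \E (fun t => \1_G t * (f n t * cos (lin y t + a))) @[n --> \oo] -->
  \E (fun t => \1_G t * (lin e t ^+ 2 * cos (lin y t + a))).
  apply: Rintegral_cvg_dominated (integrable_sqr_lin e) _ => [n||t|n t].
  - apply: measurable_funM => //; apply: measurable_funM => //; exact: measurable_cos_quotient.
  - by apply: measurable_funM => //; apply: measurable_funM => //; exact: measurable_funX.
  - by apply: cvgMr; apply: cvgMl; exact: cvg_cos_quotient.
  - have /andP[f0 f1] := cos_quotient_bound (lin e t) n.
    rewrite !normrM; apply: le_trans (ler_piMl _ (@indic_norm_le1 R T G t)) _; first by rewrite mulr_ge0.
    apply: le_trans (ler_piMr _ (cos_norm_le1 _)) _ => //.
    by rewrite -?normrM /f ger0_norm.
have i2 : P.-integrable setT (EFin \o (fun t => \1_G t * cos (lin y t + a))).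
  apply: (probability_bounded_integrable P (M := 1)) => [|t]; first exact: measurable_funM.
  by apply: norm_mul_le1; [exact: indic_norm_le1|exact: cos_norm_le1].
have i3 : P.-integrable setT (EFin \o (fun t => cov e e * (\1_G t * cos (lin y t + a)))).
  by apply: eq_integrable (integrableZl measurableT (cov e e) i2).
transitivity (\int[P]_t (\1_G t * (lin e t ^+ 2 * cos (lin y t + a)) -
   cov e e * (\1_G t * cos (lin y t + a))))%R.
  by apply: eq_Rintegral => t _; ring.
rewrite RintegralB // RintegralZl //; apply/eqP; rewrite subr_eq0; apply/eqP.
rewrite -(cvg_lim (@Rhausdorff R) c); apply/(cvg_lim (@Rhausdorff R)).
apply: (@cvg_ext _ _ _ (fun n => gauss_quotient e n * \E (fun t => \1_G t * cos (lin y t + a)))).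
  by move=> n; rewrite -Rintegral_cos_quotient.
by apply: cvgMl; exact: gauss_quotient_cvg.
Qed.

Section box.
Variables (J : Type) (K : seq J) (y : J -> coef) (B : J -> set R).
Hypothesis mB : forall j, measurable (B j).

Let box t : R := \prod_(j <- K) \1_(B j) (lin (y j) t).

Let V e : set (T -> R) := [set v | exists2 c, cov e c = 0 & v = lin c].

(** The forms uncorrelated with e are a vector space V of functions. Orthogonality to their cosines
    makes each indicator of a form in V a multiplier, and the box is a product of such
    indicators. *)
Lemma orthogonal_box (X : T -> R) e : P.-integrable setT (EFin \o X) ->
  (forall c a, cov e c = 0 -> \E (fun t => X t * cos (lin c t + a)) = 0) ->
  (forall j, cov e (y j) = 0) ->
  \E (fun t => X t * \prod_(j <- K) \1_(B j) (lin (y j) t)) = 0.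
Proof.
move=> iX X0 ey.
have mV v : V e v -> measurable_fun setT v by move=> [c _ ->]; exact: measurable_lin.
have VD a b v w : V e v -> V e w -> V e (fun t => a * v t + b * w t).
  move=> [c ec ->] [c' ec' ->]; exists (coefD a b c c').
    by rewrite covDr ec ec' !mulr0 addr0.
  by apply/funext => t; rewrite linD.
have V0 : V e (fun=> 0).
  exists (coefD 0 0 e e); first exact: coef0_orthogonal.
  by apply/funext => t; rewrite linD; ring.
have X0' v a : V e v -> \E (fun t => X t * cos (v t + a)) = 0.
  by move=> [c ec ->]; exact: X0.
apply: (annihilated_Rintegral (V := V e) V0).
elim: K => [|j K' IH].
  have := annihilated1 X0'; congr annihilated; apply/funext => t.
  by rewrite big_nil.
have Vj : V e (lin (y j)) by exists (y j).
have := multiplier_indic iX mV VD Vj (mB j) IH; congr annihilated.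
by apply/funext => t; rewrite big_cons mulrC.
Qed.

End box.

End gaussian_family.

(** * The Kalman filter as a linear map of the noises *)

Section kalman.
Variables (R : realType) (n m : nat).
Variables (A : 'M[R]_n) (C : 'M[R]_(m, n)) (Q S0 : 'M[R]_n) (V : 'M[R]_m).
Hypothesis pQ : posdef Q.
Hypothesis pV : posdef V.
Hypothesis pS0 : posdef S0.

(** Decisions and receptions are not noises; dimension 0 lets all families be indexed by
    [source]. *)
Definition noise_dim (s : source) : nat :=
  match s with
  | InitialState | ProcessNoise _ => n
  | MeasurementNoise _ => m
  | _ => 0
  end.

Definition noise_cov (s : source) : 'M[R]_(noise_dim s) :=
  match s with
  | InitialState => S0
  | ProcessNoise _ => Q
  | MeasurementNoise _ => V
  | _ => 0
  end.

(** Enough noises for the states up to time N and the measurements before time N. *)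
Definition noise_list (N : nat) : seq source :=
  InitialState :: [seq ProcessNoise j | j <- iota 0 N] ++
  [seq MeasurementNoise j | j <- iota 0 N].

(* A linear map from the noises to R^p, one matrix per source. *)
Definition vcoef (p : nat) := forall s, 'M[R]_(p, noise_dim s).

Definition vadd p (W W' : vcoef p) : vcoef p := fun s => W s + W' s.
Definition vmul p q (B : 'M[R]_(p, q)) (W : vcoef q) : vcoef p := fun s => B *m W s.

Definition coef_init : vcoef n :=
  fun s => match s with InitialState => 1%:M | _ => 0 end.
Definition coef_process (k : nat) : vcoef n :=
  fun s => match s with ProcessNoise j => if j == k then 1%:M else 0 | _ => 0 end.
Definition coef_meas (k : nat) : vcoef m :=
  fun s => match s with MeasurementNoise j => if j == k then 1%:M else 0 | _ => 0 end.

Definition vcov N p q (W : vcoef p) (W' : vcoef q) : 'M[R]_(p, q) :=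
  \sum_(s <- noise_list N) W s *m noise_cov s *m (W' s)^T.

Section vcov.
Variable N : nat.
Local Notation vcov := (@vcov N _ _).

Lemma vcovDl p q (W1 W2 : vcoef p) (W : vcoef q) :
  vcov (vadd W1 W2) W = vcov W1 W + vcov W2 W.
Proof.
by rewrite /vcov -big_split /=; apply: eq_bigr => s _; rewrite !mulmxDl.
Qed.

Lemma vcovDr p q (W1 W2 : vcoef p) (W : vcoef q) :
  vcov W (vadd W1 W2) = vcov W W1 + vcov W W2.
Proof.
by rewrite /vcov -big_split /=; apply: eq_bigr => s _; rewrite linearD /= mulmxDr.
Qed.

Lemma vcovMl p q r (B : 'M[R]_(p, q)) (W : vcoef q) (W' : vcoef r) :
  vcov (vmul B W) W' = B *m vcov W W'.
Proof.
by rewrite /vcov mulmx_sumr; apply: eq_bigr => s _; rewrite /vmul !mulmxA.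
Qed.

Lemma vcovMr p q r (B : 'M[R]_(p, q)) (W : vcoef q) (W' : vcoef r) :
  vcov W' (vmul B W) = vcov W' W *m B^T.
Proof.
by rewrite /vcov mulmx_suml; apply: eq_bigr => s _; rewrite /vmul trmx_mul !mulmxA.
Qed.

Lemma vcovC p q (W : vcoef p) (W' : vcoef q) : vcov W W' = (vcov W' W)^T.
Proof.
rewrite /vcov linear_sum /=; apply: eq_bigr => s _.
rewrite !trmx_mul trmxK mulmxA; congr (_ *m _ *m _).
case: pQ pV pS0 => sQ _ [sV _] [sS _].
by case: s => //=; rewrite trmx0.
Qed.

Lemma vcov_split p q (W : vcoef p) (W' : vcoef q) : vcov W W' =
  W InitialState *m S0 *m (W' InitialState)^T +
  (\sum_(j < N) W (ProcessNoise j) *m Q *m (W' (ProcessNoise j))^T +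
   \sum_(j < N) W (MeasurementNoise j) *m V *m (W' (MeasurementNoise j))^T).
Proof.
rewrite /vcov /noise_list big_cons big_cat /= !big_map.
have E p' q' (F : nat -> 'M[R]_(p', q')) : \sum_(j <- iota 0 N) F j = \sum_(j < N) F j.
  by rewrite -(big_mkord xpredT F) /index_iota subn0.
by rewrite !E.
Qed.

Lemma vcov_process p (W : vcoef p) k : (k < N)%N ->
  vcov W (coef_process k) = W (ProcessNoise k) *m Q.
Proof.
move=> kN; rewrite vcov_split /= trmx0 mulmx0 add0r.
rewrite [X in _ + X]big1 ?addr0; last by move=> j _; rewrite trmx0 mulmx0.
rewrite (bigD1 (Ordinal kN)) //= eqxx trmx1 mulmx1 big1 ?addr0 // => j jk.
by rewrite ifN ?trmx0 ?mulmx0.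
Qed.

Lemma vcov_meas p (W : vcoef p) k : (k < N)%N ->
  vcov W (coef_meas k) = W (MeasurementNoise k) *m V.
Proof.
move=> kN; rewrite vcov_split /= trmx0 mulmx0 add0r.
rewrite big1 ?add0r; last by move=> j _ /=; rewrite mulmx0.
rewrite (bigD1 (Ordinal kN)) //= eqxx trmx1 mulmx1 big1 ?addr0 // => j jk.
by rewrite ifN ?trmx0 ?mulmx0.
Qed.

Lemma vcov_init : vcov coef_init coef_init = S0.
Proof.
rewrite vcov_split /= trmx1 mulmx1 mul1mx !big1 ?addr0 // => j _ /=; by rewrite ?trmx0 ?mulmx0 ?mul0mx.
Qed.

End vcov.

Variable g : nat -> bool.

Fixpoint cov_along (k : nat) : 'M[R]_n :=
  if k is j.+1 then riccati_step A C Q V (g j) (cov_along j) else S0.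

Definition gain_along k : 'M[R]_(n, m) := if g k then gain C V (cov_along k) else 0.

Fixpoint state_coef k : vcoef n :=
  if k is j.+1 then vadd (vmul A (state_coef j)) (coef_process j) else coef_init.

Definition meas_coef k : vcoef m := vadd (vmul C (state_coef k)) (coef_meas k).

(** With W the coefficients of the prediction error e and v the measurement noise, this is the
    filtering error (1 - K C) e - K v. *)
Definition filter_coef k (W : vcoef n) : vcoef n :=
  vadd (vmul (1%:M - gain_along k *m C) W) (vmul (- gain_along k) (coef_meas k)).

Fixpoint error_coef k : vcoef n :=
  if k is j.+1 then vadd (vmul A (filter_coef j (error_coef j))) (coef_process j)
  else coef_init.

Fixpoint pred_coef k : vcoef n :=
  if k is j.+1 then
    vmul A (vadd (pred_coef j) (vmul (gain_along j)
      (vadd (meas_coef j) (vmul (- C) (pred_coef j)))))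
  else fun s => 0.

Lemma cov_along_possemidef k : possemidef (cov_along k).
Proof.
elim: k => [|k IH] /=; first exact: posdef_possemidef.
by apply: step_possemidef => //; exact: posdef_possemidef.
Qed.

Lemma state_coef_decomp k s : state_coef k s = error_coef k s + pred_coef k s.
Proof.
elim: k s => [|k IH] s /=; first by rewrite addr0.
rewrite /vadd /vmul /filter_coef /meas_coef /vadd /vmul IH.
set K := gain_along k; set E := error_coef k s; set X := pred_coef k s.
rewrite !(mulmxDr, mulmxDl, mulNmx, mulmxN, mul1mx, mulmxA, opprD, mulmxBl).
rewrite mulmx1.
set a := A *m E; set b := A *m X; set c := A *m K *m C *m E; set e := A *m K *m C *m X.
set f := A *m K *m coef_meas k s; set h := coef_process k s.
by apply/matrixP => i j; rewrite !mxE; ring.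
Qed.

Lemma coef_process_future k j : (k <= j)%N ->
  state_coef k (ProcessNoise j) = 0 /\ error_coef k (ProcessNoise j) = 0.
Proof.
elim: k => [//|k IH] kj /=; have [IH1 IH2] := IH (ltnW kj).
have jk : (j == k) = false by apply/negbTE; rewrite neq_ltn kj orbT.
by rewrite /vadd /vmul /filter_coef /vadd /vmul /= IH1 IH2 jk !mulmx0 !addr0 ?mulmx0.
Qed.

Lemma coef_meas_future k j : (k <= j)%N ->
  state_coef k (MeasurementNoise j) = 0 /\ error_coef k (MeasurementNoise j) = 0.
Proof.
elim: k => [//|k IH] kj /=; have [IH1 IH2] := IH (ltnW kj).
have jk : (j == k) = false by apply/negbTE; rewrite neq_ltn kj orbT.
by rewrite /vadd /vmul /filter_coef /vadd /vmul /= IH1 IH2 jk !mulmx0 !addr0 ?mulmx0.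
Qed.

Section orthogonality.
Variable N : nat.
Local Notation vcov := (@vcov N _ _).

Lemma vcov_process_future p (W : vcoef p) k : (k < N)%N -> W (ProcessNoise k) = 0 ->
  vcov W (coef_process k) = 0 /\ vcov (coef_process k) W = 0.
Proof.
move=> kN W0; have E : vcov W (coef_process k) = 0 by rewrite vcov_process // W0 mul0mx.
by split=> //; rewrite vcovC E trmx0.
Qed.

Lemma vcov_meas_future p (W : vcoef p) k : (k < N)%N -> W (MeasurementNoise k) = 0 ->
  vcov W (coef_meas k) = 0 /\ vcov (coef_meas k) W = 0.
Proof.
move=> kN W0; have E : vcov W (coef_meas k) = 0 by rewrite vcov_meas // W0 mul0mx.
by split=> //; rewrite vcovC E trmx0.
Qed.

Lemma vcov_error_filter k : (k < N)%N ->
  vcov (error_coef k) (error_coef k) = cov_along k ->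
  vcov (filter_coef k (error_coef k)) (filter_coef k (error_coef k)) =
  filter_cov C V (g k) (cov_along k).
Proof.
move=> kN E; have [e1 e2] := vcov_meas_future kN (coef_meas_future (leqnn k)).2.
rewrite /filter_coef !(vcovDl, vcovDr, vcovMl, vcovMr) E e1 e2.
rewrite !(mul0mx, mulmx0, addr0, add0r) vcov_meas //= eqxx mul1mx.
rewrite [(- _)^T]linearN /= !(mulmxN, mulNmx) opprK /gain_along /filter_cov /joseph !mulmxA.
by case: (g k) => //; rewrite !mul0mx subr0 trmx1 mulmx1 mul1mx addr0.
Qed.

Lemma filter_process_future k : filter_coef k (error_coef k) (ProcessNoise k) = 0.
Proof.
by rewrite /filter_coef /vadd /vmul /= (coef_process_future (leqnn k)).2 !mulmx0 addr0.
Qed.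

Lemma vcov_error k : (k <= N)%N -> vcov (error_coef k) (error_coef k) = cov_along k.
Proof.
elim: k => [|k IH] kN /=; first exact: vcov_init.
have [e1 e2] := vcov_process_future kN (filter_process_future k).
have := vcov_error_filter kN (IH (ltnW kN)).
move: (filter_coef _ _) e1 e2 => F e1 e2 EF.
rewrite !(vcovDl, vcovDr, vcovMl, vcovMr) e1 e2 !(mul0mx, mulmx0, addr0, add0r).
by rewrite vcov_process //= eqxx mul1mx EF mulmxA.
Qed.

Lemma vcov_filter k : (k < N)%N ->
  vcov (filter_coef k (error_coef k)) (filter_coef k (error_coef k)) =
  filter_cov C V (g k) (cov_along k).
Proof. by move=> kN; rewrite vcov_error_filter // vcov_error // ltnW. Qed.

(** The predictor is built linearly from the received measurements alone, the gain being 0 at the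
    other times. *)
Lemma vcov_pred0 p (Z : vcoef p) k :
  (forall j, (j < k)%N -> g j -> vcov Z (meas_coef j) = 0) -> vcov Z (pred_coef k) = 0.
Proof.
elim: k => [|k IH] H /=.
  by rewrite /vcov big1 // => s _; rewrite trmx0 mulmx0.
have IHk : vcov Z (pred_coef k) = 0 by apply: IH => j jk; apply: H; exact: ltnW.
rewrite vcovMr vcovDr vcovMr vcovDr vcovMr IHk mul0mx addr0 add0r.
rewrite /gain_along; case: ifP => gk; last by rewrite trmx0 mulmx0 mul0mx.
by rewrite H // !mul0mx.
Qed.

Lemma meas_coef_past j k : (j < k)%N ->
  meas_coef j (MeasurementNoise k) = 0 /\ meas_coef j (ProcessNoise k) = 0.
Proof.
move=> jk; rewrite /meas_coef /vadd /vmul /= (coef_process_future (ltnW jk)).1.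
by rewrite (coef_meas_future (ltnW jk)).1 !mulmx0 !addr0 gtn_eqF // addr0.
Qed.

Lemma meas_coef_process j : meas_coef j (ProcessNoise j) = 0.
Proof.
by rewrite /meas_coef /vadd /vmul /= (coef_process_future (leqnn j)).1 mulmx0 addr0.
Qed.

(** For j < k the correction adds only the fresh measurement noise, which the past does not contain.
    For j = k the measurement is C e + C x + v with x the predictor: x drops out by [vcov_pred0],
    and the rest cancels by [gain_orthogonal]. *)
Lemma vcov_filter_meas_step k j : (k < N)%N -> (j <= k)%N -> g j ->
  (forall i, (i < k)%N -> g i -> vcov (error_coef k) (meas_coef i) = 0) ->
  vcov (filter_coef k (error_coef k)) (meas_coef j) = 0.
Proof.
move=> kN jk gj IH.
have past i : (i < k)%N -> g i -> vcov (filter_coef k (error_coef k)) (meas_coef i) = 0.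
  move=> ik gi; have [_ e] := vcov_meas_future kN (meas_coef_past ik).1.
  by rewrite /filter_coef vcovDl !vcovMl IH // e !mulmx0 addr0.
move: jk; rewrite leq_eqVlt => /predU1P[jk|jk]; last exact: past.
rewrite {j}jk in gj *.
have pred0 := vcov_pred0 past.
have [e1 e2] := vcov_meas_future kN (coef_meas_future (leqnn k)).2.
have ms s : meas_coef k s = vadd (vadd (vmul C (error_coef k)) (vmul C (pred_coef k))) (coef_meas k) s.
  by rewrite /meas_coef /vadd /vmul state_coef_decomp mulmxDr.
have -> : vcov (filter_coef k (error_coef k)) (meas_coef k) =
    vcov (filter_coef k (error_coef k))
      (vadd (vadd (vmul C (error_coef k)) (vmul C (pred_coef k))) (coef_meas k)).
  by rewrite /vcov; apply: eq_bigr => s _; rewrite ms.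
rewrite !vcovDr (vcovMr _ C (pred_coef k)) pred0 mul0mx addr0 (vcovMr _ C (error_coef k)).
rewrite /filter_coef !(vcovDl, vcovMl) vcov_error ?(ltnW kN) // e1 e2.
rewrite !(mulmx0, mul0mx, addr0, add0r) vcov_meas //= eqxx mul1mx.
rewrite /gain_along gj gain_orthogonal //; last exact: cov_along_possemidef.
by rewrite mulNmx subrr.
Qed.

Lemma vcov_error_meas k j : (k <= N)%N -> (j < k)%N -> g j ->
  vcov (error_coef k) (meas_coef j) = 0.
Proof.
elim: k j => [//|k IH] j kN jk gj /=.
rewrite vcovDl vcovMl vcov_filter_meas_step // ?mulmx0 ?add0r; last first.
  by move=> i ik gi; apply: IH => //; exact: ltnW.
have W0 : meas_coef j (ProcessNoise k) = 0.
  move: jk; rewrite ltnS leq_eqVlt => /predU1P[->|jk]; first exact: meas_coef_process.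
  exact: (meas_coef_past jk).2.
by have [_ ->] := vcov_process_future kN W0.
Qed.

Lemma vcov_filter_meas k j : (k < N)%N -> (j <= k)%N -> g j ->
  vcov (filter_coef k (error_coef k)) (meas_coef j) = 0.
Proof.
move=> kN jk gj; apply: vcov_filter_meas_step => // i ik gi.
by apply: vcov_error_meas => //; exact: ltnW.
Qed.

End orthogonality.

End kalman.

(** * The random vectors realizing the coefficients *)

Section noise_model.
Variables (R : realType) (n m : nat).
Variables (A : 'M[R]_n) (C : 'M[R]_(m, n)) (Q S0 : 'M[R]_n) (V : 'M[R]_m).
Variable M : realization R n m.

Local Notation noise_dim := (noise_dim n m).
Local Notation noise_cov := (noise_cov Q S0 V).
Local Notation vcoef := (@vcoef R n m).

Definition noise_vec (s : source) : Omega M -> 'cV[R]_(noise_dim s) :=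
  match s with
  | InitialState => init_state M
  | ProcessNoise j => process_noise M j
  | MeasurementNoise j => meas_noise M j
  | _ => fun=> 0
  end.

Definition vlin N p (W : vcoef p) (t : Omega M) : 'cV[R]_p :=
  \sum_(s <- noise_list N) W s *m noise_vec s t.

Definition row_coef p (W : vcoef p) (a : 'cV[R]_p) : coef R noise_dim :=
  fun s => (W s)^T *m a.

Section vlin.
Variable N : nat.
Local Notation vlin := (@vlin N _).
Local Notation vcov := (@vcov R n m Q S0 V N _ _).

Lemma lin_row_coef p (W : vcoef p) a t :
  lin noise_vec (noise_list N) (row_coef W a) t = (a^T *m vlin W t) 0 0.
Proof.
rewrite /lin /vlin mulmx_sumr summxE; apply: eq_bigr => s _.
by rewrite /row_coef trmx_mul trmxK mulmxA.
Qed.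

Lemma cov_row_coef p q (W : vcoef p) (W' : vcoef q) a b :
  cov noise_cov (noise_list N) (row_coef W a) (row_coef W' b) =
  (a^T *m vcov W W' *m b) 0 0.
Proof.
rewrite /cov /vcov mulmx_sumr mulmx_suml summxE; apply: eq_bigr => s _.
by rewrite /bform /row_coef trmx_mul trmxK !mulmxA.
Qed.

Lemma vlinD p (W W' : vcoef p) t : vlin (vadd W W') t = vlin W t + vlin W' t.
Proof. by rewrite /vlin -big_split /=; apply: eq_bigr => s _; rewrite mulmxDl. Qed.

Lemma vlinM p q (B : 'M[R]_(p, q)) (W : vcoef q) t : vlin (vmul B W) t = B *m vlin W t.
Proof.
by rewrite /vlin mulmx_sumr; apply: eq_bigr => s _; rewrite /vmul !mulmxA.
Qed.

Lemma vlin_split p (W : vcoef p) t : vlin W t =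
  W InitialState *m init_state M t +
  (\sum_(j < N) W (ProcessNoise j) *m process_noise M j t +
   \sum_(j < N) W (MeasurementNoise j) *m meas_noise M j t).
Proof.
rewrite /vlin /noise_list big_cons big_cat /= !big_map.
have E p' (F : nat -> 'cV[R]_p') : \sum_(j <- iota 0 N) F j = \sum_(j < N) F j.
  by rewrite -(big_mkord xpredT F) /index_iota subn0.
by rewrite !E.
Qed.

Lemma vlin_init t : vlin (@coef_init R n m) t = init_state M t.
Proof.
by rewrite vlin_split /= mul1mx !big1 ?addr0 // => j _; rewrite mul0mx.
Qed.

Lemma vlin_process k t : (k < N)%N -> vlin (@coef_process R n m k) t = process_noise M k t.
Proof.
move=> kN; rewrite vlin_split /= mul0mx add0r.
rewrite [X in _ + X]big1 ?addr0; last by move=> j _; rewrite mul0mx.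
rewrite (bigD1 (Ordinal kN)) //= eqxx mul1mx big1 ?addr0 // => j jk.
by rewrite ifN ?mul0mx.
Qed.

Lemma vlin_meas k t : (k < N)%N -> vlin (@coef_meas R n m k) t = meas_noise M k t.
Proof.
move=> kN; rewrite vlin_split /= mul0mx add0r.
rewrite big1 ?add0r; last by move=> j _; rewrite mul0mx.
rewrite (bigD1 (Ordinal kN)) //= eqxx mul1mx big1 ?addr0 // => j jk.
by rewrite ifN ?mul0mx.
Qed.

Lemma vlin_state k t : (k <= N)%N -> vlin (state_coef m A k) t = state A k t.
Proof.
elim: k => [|k IH] kN /=; first exact: vlin_init.
by rewrite vlinD vlinM IH ?vlin_process // ltnW.
Qed.

Lemma vlin_measurement k t : (k < N)%N -> vlin (meas_coef A C k) t = measurement A C k t.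
Proof. by move=> kN; rewrite vlinD vlinM vlin_state ?vlin_meas // ltnW. Qed.

End vlin.

Section estimator.
Variable g : nat -> bool.
Variable y : nat -> 'cV[R]_m.

Local Notation K := (gain_along A C Q S0 V g).

(** The sequence y is arbitrary because the recursion is evaluated both on the true measurements,
    for the error, and on the received ones, for measurability. The two agree wherever g holds. *)
Fixpoint predictor (k : nat) : 'cV[R]_n :=
  if k is j.+1 then A *m (predictor j + K j *m (y j - C *m predictor j)) else 0.

Definition estimator (k : nat) : 'cV[R]_n :=
  predictor k + K k *m (y k - C *m predictor k).

End estimator.

Lemma eq_predictor (g g' : nat -> bool) (y y' : nat -> 'cV[R]_m) k :
  (forall j, (j < k)%N -> g j = g' j) ->
  (forall j, (j < k)%N -> g j -> y j = y' j) ->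
  cov_along A C Q S0 V g k = cov_along A C Q S0 V g' k /\
  predictor g y k = predictor g' y' k.
Proof.
elim: k => [//|k IH] gg yy /=.
have [E1 E2] := IH (fun j jk => gg j (ltnW jk)) (fun j jk => yy j (ltnW jk)).
rewrite E1 E2 /gain_along E1 gg //; split=> //.
case: ifP => gk; last by rewrite !mul0mx.
by rewrite yy // gg.
Qed.

Lemma eq_estimator (g g' : nat -> bool) (y y' : nat -> 'cV[R]_m) k :
  (forall j, (j <= k)%N -> g j = g' j) ->
  (forall j, (j <= k)%N -> g j -> y j = y' j) ->
  cov_along A C Q S0 V g k = cov_along A C Q S0 V g' k /\
  estimator g y k = estimator g' y' k.
Proof.
move=> gg yy.
have [E1 E2] := eq_predictor (fun j jk => gg j (ltnW jk)) (fun j jk => yy j (ltnW jk)).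
rewrite /estimator E2 /gain_along E1 gg //; split=> //.
case: ifP => gk; last by rewrite !mul0mx.
by rewrite yy // gg.
Qed.

Lemma vlin_pred N g k t : (k <= N)%N ->
  vlin N (pred_coef A C Q S0 V g k) t = predictor g (fun j => measurement A C j t) k.
Proof.
elim: k => [|k IH] kN /=; first by rewrite /vlin big1 // => s _; rewrite mul0mx.
rewrite vlinM vlinD vlinM vlinD vlinM IH ?(ltnW kN) // vlin_measurement //.
by rewrite mulNmx.
Qed.

Lemma estimation_error N g k t : (k < N)%N ->
  state A k t - estimator g (fun j => measurement A C j t) k =
  vlin N (filter_coef A C Q S0 V g k (error_coef A C Q S0 V g k)) t.
Proof.
move=> kN; rewrite /estimator -(vlin_pred g t (ltnW kN)) -(vlin_measurement t kN).
rewrite -(vlin_state t (ltnW kN)) vlinD !vlinM vlinD vlinM.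
have E : vlin N (state_coef m A k) t =
    vlin N (error_coef A C Q S0 V g k) t + vlin N (pred_coef A C Q S0 V g k) t.
  rewrite /vlin -big_split /=; apply: eq_bigr => s _.
  by rewrite -mulmxDl -state_coef_decomp.
rewrite E; set e := vlin N (error_coef _ _ _ _ _ _ _) t; set x := vlin N _ t.
set v := vlin N _ t; set K := gain_along _ _ _ _ _ _ _.
rewrite (vlinM N (- K)) -/v.
rewrite !(mulmxDr, mulmxDl, mulmxBl, mul1mx, mulNmx, mulmxN, opprD, opprK) !mulmxA.
apply/matrixP => i j; rewrite !mxE; ring.
Qed.

End noise_model.

(** * Conditional expectation given the channel outputs *)

Section conditional_expectation.
Variables (R : realType) (d : measure_display) (T : measurableType d).
Variable P : probability T R.

Local Notation "\E Y" := (\int[P]_t Y t)%R (at level 10, Y at level 8).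

Lemma integrable_mul_indic (X : T -> R) (E : set T) : measurable E ->
  P.-integrable setT (EFin \o X) -> P.-integrable setT (EFin \o (fun t => X t * \1_E t)).
Proof.
move=> mE iX; apply: (integrable_mul_bounded (M := 1)) => // t.
exact: indic_norm_le1.
Qed.

Lemma Rintegral_mul_indic (X : T -> R) (E : set T) :
  \E (fun t => X t * \1_E t) = (\int[P]_(t in E) X t)%R.
Proof.
rewrite [RHS]Rintegral_mkcond; apply: eq_Rintegral => t _.
by rewrite patchE [\1_E t]indicE; case: (t \in E); rewrite ?mulr1 ?mulr0.
Qed.

Lemma dynkin_annihilate (X : T -> R) (Pi : set (set T)) :
  P.-integrable setT (EFin \o X) -> \E X = 0 -> setI_closed Pi ->
  Pi `<=` measurable -> (forall A, Pi A -> \E (fun t => X t * \1_A t) = 0) ->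
  forall E, <<s Pi >> E -> \E (fun t => X t * \1_E t) = 0.
Proof.
move=> iX X0 PiI Pim HPi.
have sub : <<s Pi >> `<=` (@measurable _ T).
  by apply: smallest_sub; [exact: sigma_algebra_measurable|exact: Pim].
apply: (@dynkin_induction _ (g_sigma_algebraType Pi) Pi
  (fun E => \E (fun t => X t * \1_E t) = 0)) => //.
- by rewrite -[RHS]X0; apply: eq_Rintegral => t _; rewrite indicT mulr1.
- move=> S mS IH; have mS' := sub _ mS.
  transitivity (\int[P]_t (X t - X t * \1_S t))%R.
    apply: eq_Rintegral => t _; rewrite !indicE in_setC; case: (_ \in _); rewrite /=; ring.
  by rewrite RintegralB ?X0 ?IH ?subr0 //; exact: integrable_mul_indic.
- move=> F0 mF0 tF0 IH0; pose F : nat -> set T := F0.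
  have mF n : measurable (F n) := sub _ (mF0 n).
  have tF : trivIset setT F := tF0.
  have IH n : \E (fun t => X t * \1_(F n) t) = 0 := IH0 n.
  change (\E (fun t => X t * \1_(\bigcup_k F k) t) = 0).
  have mU : measurable (\bigcup_k F k) by exact: bigcup_measurable.
  have H n : \E (fun t => X t * \1_(\bigcup_(k < n) F k) t) = 0.
    elim: n => [|n IHn].
      under eq_Rintegral do rewrite bigcup_mkord big_ord0 indic0 mulr0.
      by rewrite Rintegral_cst // mul0r.
    transitivity (\int[P]_t (X t * \1_(\bigcup_(k < n) F k) t + X t * \1_(F n) t))%R.
      by apply: eq_Rintegral => t _; rewrite -mulrDr indic_bigcupS.
    have mUn : measurable (\bigcup_(k < n) F k) by exact: bigcup_measurable.
    by rewrite RintegralD ?IHn ?IH ?addr0 //; exact: integrable_mul_indic.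
  have mX : measurable_fun setT X by apply/measurable_EFinP; exact: (measurable_int P).
  have [_ c] : P.-integrable setT (EFin \o (fun t => X t * \1_(\bigcup_k F k) t)) /\
     \E (fun t => X t * \1_(\bigcup_(k < n) F k) t) @[n --> \oo] -->
     \E (fun t => X t * \1_(\bigcup_k F k) t).
    apply: Rintegral_cvg_dominated (integrable_norm iX) _ => [n||t|n t].
    + by apply: measurable_funM => //; apply: measurable_indic; exact: bigcup_measurable.
    + by apply: measurable_funM => //; exact: measurable_indic.
    + by apply: cvgMr; exact: indic_bigcup_cvg.
    + by rewrite normrM ler_piMr // indic_norm_le1.
  rewrite -(cvg_lim (@Rhausdorff R) c).
  have -> : (fun n => \E (fun t => X t * \1_(\bigcup_(k < n) F k) t)) = (fun=> 0).
    by apply/funext => n; exact: H.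
  exact: lim_cst.
Qed.

Section sub_sigma_algebra.
Variable gen : set (set T).
Hypothesis gen_measurable : gen `<=` measurable.
Local Notation G := <<s gen >>.

Lemma sub_sigma_measurable : G `<=` measurable.
Proof. by apply: smallest_sub; [exact: sigma_algebra_measurable|]. Qed.

Lemma is_cond_expP (X Z : T -> R) : P.-integrable setT (EFin \o X) ->
  P.-integrable setT (EFin \o Z) ->
  (forall B, measurable B -> G (Z @^-1` B)) ->
  (forall E, G E -> \E (fun t => (X t - Z t) * \1_E t) = 0) ->
  is_cond_exp P G X Z.
Proof.
move=> iX iZ mZ H; split=> // E GE; have mE := sub_sigma_measurable GE.
have iXE : P.-integrable E (EFin \o X) by exact: integrableS iX.
have iZE : P.-integrable E (EFin \o Z) by exact: integrableS iZ.
have := H E GE; rewrite Rintegral_mul_indic RintegralB // => /eqP.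
rewrite subr_eq0 => /eqP XZ.
rewrite -[LHS]fineK ?integrable_fin_num // -[RHS]fineK ?integrable_fin_num //.
by congr EFin; exact: (esym XZ).
Qed.

Lemma is_cond_exp_Rintegral (X Z : T -> R) E : is_cond_exp P G X Z -> G E ->
  (\int[P]_(t in E) Z t)%R = (\int[P]_(t in E) X t)%R.
Proof. by move=> [_ _ H] GE; rewrite /Rintegral H. Qed.

(** The set where Z' < Z belongs to the sigma-algebra, so Z - Z', positive there, has integral 0
    over it. *)
Lemma is_cond_exp_ae_le (X Z Z' : T -> R) :
  is_cond_exp P G X Z -> is_cond_exp P G X Z' ->
  {ae P, forall t, Z t <= Z' t}.
Proof.
move=> cZ cZ'; have [mZ iZ _] := cZ; have [mZ' iZ' _] := cZ'.
have mZG (W : T -> R) : (forall B, measurable B -> G (W @^-1` B)) ->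
    measurable_fun setT (W : g_sigma_algebraType gen -> R).
  by move=> mW _ B mB; rewrite setTI; exact: mW.
pose D := [set t | Z' t < Z t].
have GD : G D.
  have /(_ measurableT _ (measurable_itv `]0, +oo[)) :=
    measurable_funB (mZG _ mZ) (mZG _ mZ').
  rewrite setTI; congr (G _); apply/seteqP; split=> t /=; rewrite in_itv /= andbT subr_gt0 //.
have mD := sub_sigma_measurable GD.
have iD : P.-integrable D (EFin \o (fun t => Z t - Z' t)).
  by apply: integrableS (subsetT D) _ => //; apply: eq_integrable (integrableB measurableT iZ iZ').
have iZD : P.-integrable D (EFin \o Z) by exact: integrableS iZ.
have iZD' : P.-integrable D (EFin \o Z') by exact: integrableS iZ'.
have E0 : (\int[P]_(t in D) (Z t - Z' t))%R = 0.
  by rewrite RintegralB // (is_cond_exp_Rintegral cZ GD) (is_cond_exp_Rintegral cZ' GD) subrr.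
have I0 : (\int[P]_(t in D) `|(Z t - Z' t)%:E| = 0)%E.
  rewrite (eq_integral (fun t => (Z t - Z' t)%:E)); last first.
    move=> t; rewrite inE /D /= => Dt; rewrite ger0_norm // subr_ge0; exact: ltW.
  rewrite -[LHS]fineK; last exact: integrable_fin_num iD.
  by rewrite -/(Rintegral _ _ _) E0.
have mDZ : measurable_fun D (fun t => (Z t - Z' t)%:E) by exact: (measurable_int P).
have /(ae_eq_integral_abs P mD mDZ) := I0.
apply: filterS => t H; rewrite leNgt; apply/negP => Dt.
by have := H Dt; rewrite /= => -[] /eqP; rewrite subr_eq0 gt_eqF.
Qed.

Lemma is_cond_exp_ae_eq (X Z Z' : T -> R) :
  is_cond_exp P G X Z -> is_cond_exp P G X Z' ->
  {ae P, forall t, Z t = Z' t}.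
Proof.
move=> cZ cZ'; have := is_cond_exp_ae_le cZ cZ'; have := is_cond_exp_ae_le cZ' cZ.
by apply: filterS2 => t; move=> ge le; apply/eqP; rewrite eq_le le ge.
Qed.

Lemma cond_exp_is (X Z : T -> R) : is_cond_exp P G X Z ->
  is_cond_exp P G X (cond_exp P G X).
Proof.
move=> cZ; rewrite /cond_exp.
exact: (@xgetPex _ (cst 0) [set Z | is_cond_exp P G X Z] (ex_intro _ Z cZ)).
Qed.

End sub_sigma_algebra.

End conditional_expectation.

Lemma delta_dot (R : realType) n (x : 'cV[R]_n) l :
  ((delta_mx l 0 : 'cV_n)^T *m x) 0 0 = x l 0.
Proof. by rewrite trmx_delta -rowE mxE. Qed.

Lemma integrable_subR (R : realType) d (T : measurableType d) (P : probability T R)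
    (f g : T -> R) : P.-integrable setT (EFin \o f) -> P.-integrable setT (EFin \o g) ->
  P.-integrable setT (EFin \o (fun t => f t - g t)).
Proof. by move=> fi gi; apply: eq_integrable (integrableB measurableT fi gi). Qed.

Lemma Rintegral_sum_seq (R : realType) d (T : measurableType d) (P : probability T R)
    (I : eqType) (r : seq I) (f : I -> T -> R) :
  (forall x, x \in r -> P.-integrable setT (EFin \o f x)) ->
  P.-integrable setT (EFin \o (fun t => \sum_(x <- r) f x t)) /\
  (\int[P]_t \sum_(x <- r) f x t)%R = \sum_(x <- r) (\int[P]_t f x t)%R.
Proof.
elim: r => [|x r IH] fi.
  split; last by under eq_Rintegral do rewrite big_nil; rewrite big_nil Rintegral_cst // mul0r.
  by apply: eq_integrable (integrable0 P setT) => // t _; rewrite /= big_nil.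
have ix : P.-integrable setT (EFin \o f x) by apply: fi; rewrite mem_head.
have [i1 i2] : P.-integrable setT (EFin \o (fun t => \sum_(x <- r) f x t)) /\
  (\int[P]_t \sum_(x <- r) f x t)%R = \sum_(x <- r) (\int[P]_t f x t)%R.
  by apply: IH => y yr; apply: fi; rewrite in_cons yr orbT.
split; first by apply: eq_integrable (integrableD measurableT ix i1) => // t _; rewrite /= big_cons.
by under eq_Rintegral do rewrite big_cons; rewrite RintegralD // big_cons i2.
Qed.

(** * Arrival patterns as words, and the list of noises *)

Fixpoint words (k : nat) : seq (seq bool) :=
  if k is j.+1 then [seq true :: w | w <- words j] ++ [seq false :: w | w <- words j]
  else [:: [::]].

Lemma mem_words k w : (w \in words k) = (size w == k).
Proof.
elim: k w => [|k IH] [|b w] //=.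
  by rewrite mem_cat; apply/negbTE; rewrite negb_or; apply/andP; split; apply/negP => /mapP[].
rewrite mem_cat eqSS -IH; apply/orP/idP => [[] /mapP[v vk [_ ->]] //|wk].
by case: b; [left|right]; apply/mapP; exists w.
Qed.

Lemma words_uniq k : uniq (words k).
Proof.
elim: k => [//|k IH] /=; rewrite cat_uniq !map_inj_uniq ?IH ?andbT /=; try by move=> x y [].
by apply/hasPn => w /mapP[v _ ->]; apply/negP => /mapP[].
Qed.

Definition is_noise (s : source) : bool :=
  match s with
  | InitialState | ProcessNoise _ | MeasurementNoise _ => true
  | _ => false
  end.

Lemma noise_list_is_noise N : all is_noise (noise_list N).
Proof. by rewrite /noise_list /= all_cat !all_map /=; apply/andP; split; apply/allP. Qed.

Lemma noise_list_uniq N : uniq (noise_list N).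
Proof.
rewrite /noise_list /= cat_uniq mem_cat negb_or.
apply/and3P; split.
- by apply/andP; split; apply/negP => /mapP[].
- by rewrite map_inj_uniq ?iota_uniq // => x y [].
apply/andP; split; last by rewrite map_inj_uniq ?iota_uniq // => x y [].
by apply/hasPn => s /mapP[x _ ->]; apply/negP => /mapP[].
Qed.

(** * The conditional estimate and covariance, pattern by pattern *)

Section filtering.
Variables (R : realType) (n m : nat).
Variables (A : 'M[R]_n) (C : 'M[R]_(m, n)) (Q S0 : 'M[R]_n) (V : 'M[R]_m).
Variable M : realization R n m.
Variables (send : nat -> Omega M -> bool) (i : receiver) (weight : seq bool -> R).

Local Notation T := (Omega M).
Local Notation P := (Pr M).
Local Notation "\E Y" := (\int[Pr M]_t Y t)%R (at level 10, Y at level 8).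

Definition arrival (k : nat) (t : T) : bool := send k t && reception M i k t.

Definition pattern (w : seq bool) : set T :=
  [set t | mkseq (arrival ^~ t) (size w) = w].

Hypothesis pQ : posdef Q.
Hypothesis pV : posdef V.
Hypothesis pS0 : posdef S0.
Hypothesis gauss0 : centered_gaussian P (init_state M) S0.
Hypothesis gaussW : forall k, centered_gaussian P (process_noise M k) Q.
Hypothesis gaussV : forall k, centered_gaussian P (meas_noise M k) V.
Hypothesis measurable_arrival : forall k, measurable [set t | arrival k t].
Hypothesis indep_pattern : forall (w : seq bool) (J : seq source) (E : source -> set T),
  uniq J -> all is_noise J ->
  (forall s, s \in J -> sigma_vec (@noise_vec R n m M s) (E s)) ->
  P (pattern w `&` \bigcap_(s in [set` J]) E s) =
  ((weight w)%:E * \prod_(s <- J) P (E s))%E.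

Lemma pattern_bigcap w :
  pattern w = \bigcap_(j in `I_(size w)) [set t | arrival j t = nth false w j].
Proof.
apply/seteqP; split=> t /=.
  by move=> E j /= jw; rewrite -[in RHS]E nth_mkseq.
move=> H; apply: (@eq_from_nth _ false); first by rewrite size_mkseq.
by move=> j; rewrite size_mkseq => jw; rewrite nth_mkseq // H.
Qed.

Lemma measurable_pattern w : measurable (pattern w).
Proof.
rewrite pattern_bigcap; apply: fin_bigcap_measurable => // j _.
case: (nth false w j); first exact: measurable_arrival.
rewrite (_ : [set t | _] = ~` [set t | arrival j t]); first exact: measurableC.
by apply/seteqP; split=> t /=; [move=> ->|move/negP/negbTE].
Qed.

Lemma prob_pattern w : P (pattern w) = (weight w)%:E.
Proof.
have := @indep_pattern w [::] (fun=> setT) isT isT (fun=> ltac:(by [])).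
by rewrite big_nil mule1 set_nil bigcap_set0 setIT.
Qed.

(** The events independent of the noises to which the Gaussian lemmas are applied; the empty word
    gives the sure event. *)
Definition pattern_events : set (set T) := [set G | exists w, G = pattern w].

Lemma pattern_eventsT : pattern_events setT.
Proof. by exists [::]; apply/seteqP; split. Qed.

Section horizon.
Variable k : nat.
Local Notation N := k.+1.
Local Notation L := (noise_list N).
Local Notation vec := (@noise_vec R n m M).
Local Notation Sg := (noise_cov Q S0 V).

Let gvec s : s \in L -> centered_gaussian P (vec s) (Sg s).
Proof.
move=> /(allP (noise_list_is_noise N)).
case: s => [_|j _|j _|j H|r j H]; [exact: gauss0|exact: gaussW|exact: gaussV| |];
  discriminate H.
Qed.

Let pSg s : s \in L -> posdef (Sg s).
Proof.
move=> /(allP (noise_list_is_noise N)).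
case: s => [_|j _|j _|j H|r j H]; [exact: pS0|exact: pQ|exact: pV| |];
  discriminate H.
Qed.

Let mGG G : pattern_events G -> measurable G.
Proof. by move=> [w ->]; exact: measurable_pattern. Qed.

Let indepGG (G : set T) (J : seq source) (E : source -> set T) : pattern_events G ->
  uniq J -> {subset J <= L} -> (forall s, s \in J -> sigma_vec (vec s) (E s)) ->
  P (G `&` \bigcap_(s in [set` J]) E s) = (P G * \prod_(s <- J) P (E s))%E.
Proof.
move=> [w ->] uJ JL HE; rewrite indep_pattern // ?prob_pattern //.
by apply/allP => s /JL; exact: (allP (noise_list_is_noise N)).
Qed.

Local Notation lin := (lin vec L).
Local Notation lcov := (cov Sg L).

Lemma measurable_measurement j l : (j <= k)%N ->
  measurable_fun setT (fun t : T => measurement A C j t l 0 : R).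
Proof.
move=> jk; rewrite (_ : (fun t => _) = lin (row_coef (meas_coef A C j) (delta_mx l 0))).
  exact: measurable_lin gvec _.
by apply/funext => t; rewrite lin_row_coef vlin_measurement // delta_dot.
Qed.

Definition info_gen : set (set T) :=
  [set E | exists2 j : nat, (j <= k)%N &
     E = channel_output A C send i j @^-1` [set None] \/
     exists (l : 'I_m) (B : set R), measurable B /\
       E = channel_output A C send i j @^-1` (Some @` [set z : 'cV[R]_m | B (z l 0)])].

Lemma channel_output_None j :
  channel_output A C send i j @^-1` [set None] = ~` [set t | arrival j t].
Proof.
apply/seteqP; split=> t; rewrite /= /channel_output /channel_input /arrival;
  by case: (send j t); case: (reception M i j t).
Qed.

Lemma channel_output_Some j (D : set 'cV[R]_m) :
  channel_output A C send i j @^-1` (Some @` D) =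
  [set t | arrival j t] `&` [set t | D (measurement A C j t)].
Proof.
apply/seteqP; split=> t; rewrite /= /channel_output /channel_input /arrival.
  by case: (send j t); case: (reception M i j t) => -[z Dz] //= [<-].
by move=> [/andP[-> ->] Dm]; exists (measurement A C j t).
Qed.

Lemma info_gen_measurable : info_gen `<=` measurable.
Proof.
move=> _ [j jk [->|[l [B [mB ->]]]]].
  by rewrite channel_output_None; exact: measurableC.
rewrite channel_output_Some; apply: measurableI => //.
by have := measurable_measurement l jk measurableT mB; rewrite setTI.
Qed.

Local Notation IT := (g_sigma_algebraType info_gen).

Lemma info_arrival j b : (j <= k)%N -> <<s info_gen>> [set t | arrival j t = b].
Proof.
move=> jk; have H : <<s info_gen>> (~` [set t | arrival j t]).
  by apply: sub_sigma_algebra; exists j => //; left; rewrite channel_output_None.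
case: b; last first.
  rewrite (_ : [set t | _] = ~` [set t | arrival j t]) //.
  by apply/seteqP; split=> t /=; [move=> ->|move/negP/negbTE].
rewrite (_ : [set t | _] = ~` (~` [set t | arrival j t])); last by rewrite setCK.
exact: (@measurableC _ IT).
Qed.

Lemma info_pattern w : size w = k.+1 -> <<s info_gen>> (pattern w).
Proof.
move=> sw; rewrite pattern_bigcap; apply: (@fin_bigcap_measurable _ IT) => // j /=.
by rewrite sw ltnS => jk; exact: info_arrival.
Qed.

(** The default 0 stands for a lost packet; the estimator multiplies it by the gain 0. *)
Definition received (j : nat) (t : T) : 'cV[R]_m :=
  if arrival j t then measurement A C j t else 0.

Lemma measurable_received j l : (j <= k)%N ->
  measurable_fun setT (fun t : IT => received j t l 0 : R).
Proof.
move=> jk _ B mB; rewrite setTI.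
have S1 : <<s info_gen>> ([set t | arrival j t] `&` [set t | B (measurement A C j t l 0)]).
  apply: sub_sigma_algebra; exists j => //; right; exists l, B; split => //.
  by rewrite channel_output_Some.
(* The default value decides whether the event of a lost packet belongs to the preimage of B. *)
have [B0|B0] := pselect (B 0); last first.
  rewrite (_ : _ @^-1` B = [set t | arrival j t] `&` [set t | B (measurement A C j t l 0)]) //.
  apply/seteqP; split=> t; rewrite /= /received; case: (arrival j t) => /=.
  - by [].
  - by rewrite mxE => /B0.
  - by move=> [].
  - by move=> [].
rewrite (_ : _ @^-1` B = ([set t | arrival j t] `&` [set t | B (measurement A C j t l 0)]) `|`
   [set t | arrival j t = false]).
  by apply: (@measurableU _ IT) => //; exact: info_arrival.
apply/seteqP; split=> t; rewrite /= /received; case: (arrival j t) => /=.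
- by move=> ?; left.
- by move=> _; right.
- by move=> [[]|].
- by move=> _; rewrite mxE.
Qed.

Section word.
Variable w : seq bool.
Hypothesis sw : size w = k.+1.
Local Notation g := (nth false w).

Definition word_error : vcoef R n m n :=
  filter_coef A C Q S0 V g k (error_coef A C Q S0 V g k).

Definition observation := (nat * 'I_m * {B : set R | measurable B})%type.

Definition observed (x : observation) : bool := (x.1.1 <= k)%N && g x.1.1.

Definition observation_indic (x : observation) (t : T) : R :=
  \1_(sval x.2) (measurement A C x.1.1 t x.1.2 0).

(* Once the arrival pattern is fixed, an event known to the receiver constrains only
   the measurements that arrived. *)
Definition observation_events : set (set T) := [set E | measurable E /\
  exists (b : bool) (K : seq observation), all observed K /\
    forall t, \1_(pattern w) t * \1_E t =
      \1_(pattern w) t * (b%:R * \prod_(x <- K) observation_indic x t)].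

Lemma observation_events_setI : setI_closed observation_events.
Proof.
move=> E F [mE [b [K [oK EK]]]] [mF [c [K' [oK' FK']]]]; split; first exact: measurableI.
exists (b && c), (K ++ K'); split=> [|t]; first by rewrite all_cat oK oK'.
have p2 : \1_(pattern w) t * \1_(pattern w) t = \1_(pattern w) t :> R.
  by rewrite !indicE; case: (_ \in _); rewrite ?mulr1 ?mulr0.
rewrite indicI /= -{1}p2 mulrACA EK FK' mulrACA p2 big_cat /=.
by congr (_ * _); rewrite mulrACA; congr (_ * _); case: b c {EK FK'} => -[]; rewrite ?mulr0 ?mul0r ?mulr1.
Qed.

(** Measurements that were not received get the zero form, so that the orthogonality demanded by
    [orthogonal_box] holds for every x. *)
Let obs_coef (x : observation) : coef R (noise_dim n m) :=
  if observed x then row_coef (meas_coef A C x.1.1) (delta_mx x.1.2 0) else fun=> 0.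

Lemma lin_obs_coef x t : observed x -> lin (obs_coef x) t = measurement A C x.1.1 t x.1.2 0.
Proof.
move=> ox; rewrite /obs_coef ox lin_row_coef; case/andP: ox => xk _.
by rewrite vlin_measurement // delta_dot.
Qed.

Lemma cov_obs_coef a x : lcov (row_coef word_error a) (obs_coef x) = 0.
Proof.
rewrite /obs_coef; case: ifP => [/andP[xk gx]|_].
  by rewrite cov_row_coef vcov_filter_meas // mulmx0 mul0mx mxE.
by rewrite /cov big1 // => s _; rewrite bform0r.
Qed.

(** On the pattern w each generating event is empty or a box in the received measurements, which are
    uncorrelated with the filtering error of w. Boxes are settled by [orthogonal_box], and a Dynkin
    argument does the rest. *)
Lemma word_annihilate (Z : T -> R) a E :
  P.-integrable setT (EFin \o (fun t => \1_(pattern w) t * Z t)) ->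
  (forall c b, lcov (row_coef word_error a) c = 0 ->
    \E (fun t => \1_(pattern w) t * Z t * cos (lin c t + b)) = 0) ->
  <<s observation_events>> E ->
  \E (fun t => \1_(pattern w) t * Z t * \1_E t) = 0.
Proof.
move=> iZ Z0.
have box (K : seq observation) : all observed K ->
    \E (fun t => \1_(pattern w) t * Z t * \prod_(x <- K) observation_indic x t) = 0.
  move=> oK.
  have := orthogonal_box gvec pSg K (fun x : observation => svalP x.2) iZ Z0 (cov_obs_coef a).
  move=> <-; apply: eq_Rintegral => t _; congr (_ * _).
  elim: K oK => [|x K IH] /= oK; first by rewrite !big_nil.
  have /andP[ox oK'] := oK.
  by rewrite !big_cons IH // /observation_indic lin_obs_coef.
apply: dynkin_annihilate => //.
- by have := box [::] isT; under eq_Rintegral do rewrite big_nil mulr1.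
- exact: observation_events_setI.
- by move=> F [].
move=> F [mF [b [K [oK HK]]]].
transitivity (\int[P]_t (b%:R * (\1_(pattern w) t * Z t * \prod_(x <- K) observation_indic x t)))%R.
  by apply: eq_Rintegral => t _; rewrite mulrAC HK; ring.
rewrite RintegralZl //; first by rewrite box // mulr0.
apply: (integrable_mul_bounded (M := 1) iZ) => [|t].
  elim: (K) oK => [|x K' IH] /= oK; first by under eq_fun do rewrite big_nil; exact: measurable_cst.
  have /andP[ox oK'] := oK.
  under eq_fun do rewrite big_cons; apply: measurable_funM; last exact: IH.
  apply: measurableT_comp; first by apply: measurable_indic; exact: svalP x.2.
  rewrite (_ : (fun t => _) = lin (obs_coef x)); first exact: measurable_lin gvec _.
  by apply/funext => t; rewrite lin_obs_coef.
elim: (K) => [|x K' IH]; first by rewrite big_nil normr1.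
by rewrite big_cons; apply: norm_mul_le1 => //; exact: indic_norm_le1.
Qed.

Lemma info_gen_observation : info_gen `<=` observation_events.
Proof.
move=> E gE; have mE := info_gen_measurable gE; split=> //.
have pat t j : (j <= k)%N -> pattern w t -> arrival j t = g j.
  by move=> jk pt; rewrite -[in RHS](pt : _ = w) nth_mkseq // sw.
case: gE mE => j jk [->|[l [B [mB ->]]]] _.
  exists (~~ g j), [::]; split=> // t; rewrite big_nil mulr1 channel_output_None.
  rewrite !indicE; have [tw|tw] := boolP (t \in pattern w); last by rewrite !mul0r.
  rewrite !mul1r in_setC; congr ((~~ _)%:R).
  move: tw; rewrite inE => /(pat t j jk) <-.
  by apply/idP/idP; rewrite inE.
exists (g j), (if g j then [:: (j, l, exist _ B mB)] else [::]); split=> [|t].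
  by case: ifP => //= gj; rewrite /observed /= jk gj.
rewrite channel_output_Some indicI /= [\1_(pattern w) t]indicE.
have [tw|tw] := boolP (t \in pattern w); last by rewrite !mul0r.
rewrite !mul1r [\1_[set t0 | arrival j t0] t]indicE.
have -> : (t \in [set t0 | arrival j t0]) = g j.
  move: tw; rewrite inE => /(pat t j jk) <-.
  by apply/idP/idP; rewrite inE.
case: (g j); last by rewrite !mul0r.
rewrite big_cons big_nil mulr1; congr (_ * _).
Qed.

Lemma info_observation E : <<s info_gen>> E -> <<s observation_events>> E.
Proof.
apply: smallest_sub; first exact: smallest_sigma_algebra.
by move=> F /info_gen_observation ?; exact: sub_sigma_algebra.
Qed.

Lemma word_mean a E : <<s info_gen>> E ->
  \E (fun t => \1_(pattern w) t * lin (row_coef word_error a) t * \1_E t) = 0.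
Proof.
move=> /info_observation HE; have Gw : pattern_events (pattern w) by exists w.
apply: (@word_annihilate _ a _ _ _ HE) => [|c b ec].
  have := integrable_mul_indic (measurable_pattern w)
    (integrable_lin (noise_list_uniq N) gvec pSg mGG pattern_eventsT indepGG (row_coef word_error a)).
  by apply: eq_integrable => // t _; rewrite /= mulrC.
exact: (orthogonal_mean (noise_list_uniq N) gvec pSg mGG pattern_eventsT indepGG b Gw ec).
Qed.

Lemma word_variance a E : <<s info_gen>> E ->
  \E (fun t => \1_(pattern w) t * (lin (row_coef word_error a) t ^+ 2 -
     bform (filter_cov C V (g k) (cov_along A C Q S0 V g k)) a a) * \1_E t) = 0.
Proof.
move=> /info_observation HE; have Gw : pattern_events (pattern w) by exists w.
have -> : bform (filter_cov C V (g k) (cov_along A C Q S0 V g k)) a a =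
    lcov (row_coef word_error a) (row_coef word_error a).
  by rewrite cov_row_coef vcov_filter.
apply: (@word_annihilate _ a _ _ _ HE) => [|c b ec].
  have i1 := integrable_sqr_lin (noise_list_uniq N) gvec pSg mGG pattern_eventsT indepGG (row_coef word_error a).
  have i2 : P.-integrable setT (EFin \o (fun=> lcov (row_coef word_error a) (row_coef word_error a))).
    by apply: (probability_bounded_integrable P).
  have := integrable_mul_indic (measurable_pattern w) (integrableB measurableT i1 i2).
  by apply: eq_integrable => // t _; rewrite /= mulrC.
exact: (orthogonal_variance (noise_list_uniq N) gvec pSg mGG pattern_eventsT indepGG b Gw ec).
Qed.

End word.

Definition word_of (t : T) : seq bool := mkseq (arrival ^~ t) k.+1.

Lemma word_of_words t : word_of t \in words k.+1.
Proof. by rewrite mem_words size_mkseq. Qed.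

(** Exactly one pattern of length k + 1 occurs at t. This turns quantities that depend on the
    arrivals into finite sums. *)
Lemma sum_words (f : seq bool -> R) t :
  \sum_(w <- words k.+1) \1_(pattern w) t * f w = f (word_of t).
Proof.
rewrite (bigD1_seq (word_of t)) ?words_uniq ?word_of_words // big_seq_cond big1.
  have pw : pattern (word_of t) t by rewrite -[pattern _ _]/(mkseq _ (size _) = _) /word_of size_mkseq.
  by rewrite [LHS]addr0 indicE mem_set // mul1r.
move=> w /andP[]; rewrite mem_words => /eqP sw wt.
rewrite indicE memNset ?mul0r // /pattern /= sw => E.
by rewrite -E eqxx in wt.
Qed.

Definition kalman_estimate (t : T) : 'cV[R]_n :=
  estimator A C Q S0 V (nth false (word_of t)) (fun j => measurement A C j t) k.

Definition deviation (a : 'cV[R]_n) (t : T) : R :=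
  (a^T *m (state A k t - kalman_estimate t)) 0 0.

Definition word_cov (w : seq bool) : 'M[R]_n :=
  filter_cov C V (nth false w k) (cov_along A C Q S0 V (nth false w) k).

Lemma word_cov_possemidef w : possemidef (word_cov w).
Proof. by apply: filter_cov_possemidef => //; exact: cov_along_possemidef. Qed.

Lemma deviationE a t :
  deviation a t = lin (row_coef (word_error (word_of t)) a) t.
Proof. by rewrite /deviation (@estimation_error _ _ _ _ _ _ _ _ _ N) // lin_row_coef. Qed.

Lemma deviationD a b c e t :
  deviation (a *: b + c *: e) t = a * deviation b t + c * deviation e t.
Proof.
by rewrite /deviation [(_ + _)^T]linearD /= ![(_ *: _)^T]linearZ /= mulmxDl -!scalemxAl !mxE.
Qed.

Lemma deviation_delta l t : deviation (delta_mx l 0) t = state A k t l 0 - kalman_estimate t l 0.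
Proof. by rewrite /deviation delta_dot !mxE. Qed.

Lemma deviation_sum a t : deviation a t =
  \sum_(w <- words k.+1) \1_(pattern w) t * lin (row_coef (word_error w) a) t.
Proof. by rewrite (sum_words (fun w => lin (row_coef (word_error w) a) t)) deviationE. Qed.

Lemma deviation_sqr_sum a t : deviation a t ^+ 2 - bform (word_cov (word_of t)) a a =
  \sum_(w <- words k.+1) \1_(pattern w) t *
     (lin (row_coef (word_error w) a) t ^+ 2 - bform (word_cov w) a a).
Proof.
rewrite (sum_words (fun w => lin (row_coef (word_error w) a) t ^+ 2 - bform (word_cov w) a a)).
by rewrite deviationE.
Qed.

Let i_lin c : P.-integrable setT (EFin \o lin c).
Proof. exact: (integrable_lin (noise_list_uniq N) gvec pSg mGG pattern_eventsT indepGG). Qed.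

Let i_sqr_lin c : P.-integrable setT (EFin \o (fun t => lin c t ^+ 2)).
Proof. exact: (integrable_sqr_lin (noise_list_uniq N) gvec pSg mGG pattern_eventsT indepGG). Qed.

Let i_cst (c : R) : P.-integrable setT (EFin \o (fun=> c)).
Proof. exact: (probability_bounded_integrable P (M := `|c|)). Qed.

Let i_pat w f : P.-integrable setT (EFin \o f) ->
  P.-integrable setT (EFin \o (fun t => \1_(pattern w) t * f t)).
Proof.
move=> fi; have := integrable_mul_indic (measurable_pattern w) fi.
by apply: eq_integrable => // t _; rewrite /= mulrC.
Qed.

Lemma integrable_deviation a : P.-integrable setT (EFin \o deviation a).
Proof.
have [H _] := @Rintegral_sum_seq _ _ _ P _ (words k.+1)
  (fun w t => \1_(pattern w) t * lin (row_coef (word_error w) a) t) (fun w _ => i_pat w (i_lin _)).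
by apply: eq_integrable H => // t _; rewrite /= deviation_sum.
Qed.

Lemma integrable_word_fun (f : seq bool -> R) :
  P.-integrable setT (EFin \o (fun t => f (word_of t))).
Proof.
have [H _] := @Rintegral_sum_seq _ _ _ P _ (words k.+1)
  (fun w t => \1_(pattern w) t * f w) (fun w _ => i_pat w (i_cst (f w))).
by apply: eq_integrable H => // t _; rewrite /= (sum_words f).
Qed.

Lemma Rintegral_word_fun (f : seq bool -> R) :
  \E (fun t => f (word_of t)) = \sum_(w <- words k.+1) weight w * f w.
Proof.
have [_ H] := @Rintegral_sum_seq _ _ _ P _ (words k.+1)
  (fun w t => \1_(pattern w) t * f w) (fun w _ => i_pat w (i_cst (f w))).
under eq_Rintegral do rewrite -(sum_words f).
rewrite H; apply: eq_bigr => w _.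
rewrite RintegralZr //; last first.
  apply: (probability_bounded_integrable P (M := 1)) => [|t]; last exact: indic_norm_le1.
  exact: measurable_indic (measurable_pattern w).
congr (_ * _); rewrite /Rintegral integral_indic //; last exact: measurable_pattern.
rewrite setIT; exact: (congr1 fine (prob_pattern w)).
Qed.

Lemma measurable_info_word_fun (f : seq bool -> T -> R) :
  (forall w, w \in words k.+1 -> measurable_fun setT (f w : IT -> R)) ->
  measurable_fun setT (fun t : IT => f (word_of t) t).
Proof.
move=> mf; rewrite (_ : (fun t => _) = (fun t : IT => \sum_(w <- words k.+1) \1_(pattern w) t * f w t)).
  apply: (@measurable_sum_seq _ _ IT) => w wk; apply: measurable_funM; last exact: mf.
  apply: (@measurable_indic _ IT); apply: info_pattern.
  by move: wk; rewrite mem_words => /eqP.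
by apply/funext => t; rewrite (sum_words (fun w => f w t)).
Qed.

Lemma integrable_deviation_sqr a : P.-integrable setT (EFin \o (fun t => deviation a t ^+ 2)).
Proof.
have iw w : P.-integrable setT (EFin \o (fun t => \1_(pattern w) t *
     (lin (row_coef (word_error w) a) t ^+ 2 - bform (word_cov w) a a))).
  by apply/i_pat; apply: eq_integrable (integrableB measurableT (i_sqr_lin _) (i_cst _)).
have [H _] := @Rintegral_sum_seq _ _ _ P _ (words k.+1) _ (fun w _ => iw w).
have i2 := integrable_word_fun (fun w => bform (word_cov w) a a).
apply: eq_integrable (integrableD measurableT H i2) => // t _.
by rewrite /= -deviation_sqr_sum -EFinD subrK.
Qed.

Lemma deviation_mean a E : <<s info_gen>> E ->
  \E (fun t => deviation a t * \1_E t) = 0.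
Proof.
move=> HE; have mE := sub_sigma_measurable info_gen_measurable HE.
have [_ H] := @Rintegral_sum_seq _ _ _ P _ (words k.+1)
  (fun w t => \1_(pattern w) t * lin (row_coef (word_error w) a) t * \1_E t)
  (fun w _ => integrable_mul_indic mE (i_pat w (i_lin _))).
under eq_Rintegral do rewrite deviation_sum mulr_suml.
rewrite H big_seq big1 // => w; rewrite mem_words => /eqP sw.
exact: word_mean.
Qed.

Lemma deviation_variance a E : <<s info_gen>> E ->
  \E (fun t => (deviation a t ^+ 2 - bform (word_cov (word_of t)) a a) * \1_E t) = 0.
Proof.
move=> HE; have mE := sub_sigma_measurable info_gen_measurable HE.
have iw w : P.-integrable setT (EFin \o (fun t => \1_(pattern w) t *
     (lin (row_coef (word_error w) a) t ^+ 2 - bform (word_cov w) a a))).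
  by apply/i_pat; apply: eq_integrable (integrableB measurableT (i_sqr_lin _) (i_cst _)).
have [_ H] := @Rintegral_sum_seq _ _ _ P _ (words k.+1) _
  (fun w _ => integrable_mul_indic mE (iw w)).
under eq_Rintegral do rewrite deviation_sqr_sum mulr_suml.
rewrite H big_seq big1 // => w; rewrite mem_words => /eqP sw.
exact: word_variance.
Qed.

(** Polarization, which reduces mixed second moments to [deviation_variance]. *)
Lemma deviation_polar a b t : deviation a t * deviation b t =
  4^-1 * (deviation (1 *: a + 1 *: b) t ^+ 2 - deviation (1 *: a + (-1) *: b) t ^+ 2).
Proof. by rewrite !deviationD; field. Qed.

Lemma integrable_deviation_mul a b :
  P.-integrable setT (EFin \o (fun t => deviation a t * deviation b t)).
Proof.
have i1 := integrable_deviation_sqr (1 *: a + 1 *: b).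
have i2 := integrable_deviation_sqr (1 *: a + (-1) *: b).
apply: eq_integrable (integrableZl measurableT 4^-1 (integrableB measurableT i1 i2)) => // t _.
by rewrite /= deviation_polar.
Qed.

Lemma deviation_covariance a b E : <<s info_gen>> E ->
  \E (fun t => (deviation a t * deviation b t - bform (word_cov (word_of t)) a b) * \1_E t) = 0.
Proof.
move=> HE; have mE := sub_sigma_measurable info_gen_measurable HE.
pose D c t := (deviation c t ^+ 2 - bform (word_cov (word_of t)) c c) * \1_E t.
have iD c : P.-integrable setT (EFin \o D c).
  exact (integrable_mul_indic mE (integrable_subR (integrable_deviation_sqr c)
    (integrable_word_fun (fun w => bform (word_cov w) c c)))).
have i3 := integrable_subR (iD (1 *: a + 1 *: b)) (iD (1 *: a + (-1) *: b)).
transitivity (\int[P]_t (4^-1 * (D (1 *: a + 1 *: b) t - D (1 *: a + (-1) *: b) t)))%R.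
  apply: eq_Rintegral => t _; rewrite deviation_polar /D.
  have [sW _] := word_cov_possemidef (word_of t).
  by rewrite !(bformDl, bformDr) !(bformZl, bformZr) (bformC b a sW); field.
by rewrite RintegralZl // RintegralB // /D !deviation_variance // subrr mulr0.
Qed.

Lemma measurable_info_mulmx p q (B : 'M[R]_(p, q)) (x : T -> 'cV[R]_q) :
  (forall l, measurable_fun setT (fun t : IT => x t l 0 : R)) ->
  forall l, measurable_fun setT (fun t : IT => (B *m x t) l 0 : R).
Proof.
move=> mx l; rewrite (_ : (fun t => _) = (fun t : IT => \sum_j B l j * x t j 0)).
  by apply: measurable_sum => j; apply: measurable_funM.
by apply/funext => t; rewrite mxE.
Qed.

Lemma measurable_info_predictor (g : nat -> bool) k' : (k' <= k)%N ->
  forall l, measurable_fun setT (fun t : IT => predictor A C Q S0 V g (received ^~ t) k' l 0 : R).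
Proof.
elim: k' => [|j IH] jk l /=; first by under eq_fun do rewrite mxE; exact: measurable_cst.
have IHj := IH (ltnW jk).
apply: measurable_info_mulmx => {}l; under eq_fun do rewrite mxE.
apply: measurable_funD; first exact: IHj.
apply: measurable_info_mulmx => {}l; under eq_fun do rewrite !mxE.
apply: measurable_funB; first exact: measurable_received (ltnW jk).
have := measurable_info_mulmx C IHj l.
by under eq_fun do rewrite mxE.
Qed.

(** The estimate is unchanged when the measurements are replaced by the received ones, and these are
    known to the receiver; the word selecting the gains is known as well. *)
Lemma measurable_info_kalman l :
  measurable_fun setT (fun t : IT => kalman_estimate t l 0 : R).
Proof.
rewrite (_ : (fun t => _) = (fun t : IT =>
   estimator A C Q S0 V (nth false (word_of t)) (received ^~ t) k l 0)); last first.
  apply/funext => t; rewrite /kalman_estimate.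
  have H j : (j <= k)%N -> nth false (word_of t) j -> measurement A C j t = received j t.
    by move=> jk; rewrite nth_mkseq // /received => ->.
  by have [_ ->] := @eq_estimator _ _ _ A C Q S0 V _ _ _ _ k (fun _ _ => erefl) H.
apply: (measurable_info_word_fun (f := fun w t => estimator A C Q S0 V (nth false w) (received ^~ t) k l 0)).
move=> w _; have mp := measurable_info_predictor (nth false w) (leqnn k).
rewrite /estimator; under eq_fun do rewrite mxE.
apply: measurable_funD; first exact: mp.
apply: measurable_info_mulmx => {}l; under eq_fun do rewrite !mxE.
apply: measurable_funB; first exact: measurable_received.
have := measurable_info_mulmx C mp l.
by under eq_fun do rewrite mxE.
Qed.

Lemma integrable_state l : P.-integrable setT (EFin \o (fun t : T => state A k t l 0 : R)).
Proof.
apply: eq_integrable (i_lin (row_coef (state_coef m A k) (delta_mx l 0))) => // t _.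
by rewrite /= lin_row_coef vlin_state // delta_dot.
Qed.

Lemma kalman_is_cond_exp l :
  is_cond_exp P (information A C send i k) (fun t => state A k t l 0)
    (fun t => kalman_estimate t l 0).
Proof.
apply: (is_cond_expP info_gen_measurable).
- exact: integrable_state.
- apply: eq_integrable (integrableB measurableT (integrable_state l)
    (integrable_deviation (delta_mx l 0))) => // t _.
  by rewrite /= deviation_delta -EFinB opprB addrCA subrr addr0.
- by move=> B mB; have := measurable_info_kalman l measurableT mB; rewrite setTI.
- move=> E HE; under eq_Rintegral do rewrite -deviation_delta.
  exact: deviation_mean.
Qed.

(** The error is defined with a chosen version of the conditional expectation, which agrees with the
    Kalman estimate only almost everywhere. *)
Lemma error_ae_deviation l :
  {ae P, forall t, error A C send i k t l 0 = deviation (delta_mx l 0) t}.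
Proof.
have c1 := kalman_is_cond_exp l.
have c2 := cond_exp_is c1.
have := is_cond_exp_ae_eq info_gen_measurable c2 c1; apply: filterS => t /= E.
by rewrite deviation_delta -E /error !mxE.
Qed.

Lemma measurable_error l : measurable_fun setT (fun t => error A C send i k t l 0 : R).
Proof.
have [_ iZ _] := cond_exp_is (kalman_is_cond_exp l).
have := integrableB measurableT (integrable_state l) iZ.
move=> /(measurable_int P)/measurable_EFinP; congr (measurable_fun _ _).
by apply/funext => t; rewrite /= /error !mxE.
Qed.

Lemma error_mul_ae a b (c : T -> R) : {ae P, forall t,
  ((error A C send i k t *m (error A C send i k t)^T) a b) * c t =
  deviation (delta_mx a 0) t * deviation (delta_mx b 0) t * c t}.
Proof.
have := error_ae_deviation b; have := error_ae_deviation a.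
apply: filterS2 => t Ea Eb; rewrite mxE big_ord1 [_^T _ _]mxE.
by rewrite [_ a _](_ : _ = error A C send i k t a 0) // Ea Eb.
Qed.

(** Integrability and the covariance identity are known for the Kalman deviations and pass to the
    error products through almost everywhere equality. *)
Lemma word_cov_is_cond_exp a b :
  is_cond_exp P (information A C send i k)
    (fun t => (error A C send i k t *m (error A C send i k t)^T) a b)
    (fun t => word_cov (word_of t) a b).
Proof.
pose X t : R := (error A C send i k t *m (error A C send i k t)^T) a b.
pose D t := deviation (delta_mx a 0) t * deviation (delta_mx b 0) t.
pose W t : R := word_cov (word_of t) a b.
have iW : P.-integrable setT (EFin \o W) := integrable_word_fun (fun w => word_cov w a b).
have iD : P.-integrable setT (EFin \o D) := integrable_deviation_mul _ _.
have mX : measurable_fun setT X.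
  rewrite (_ : X = fun t => error A C send i k t a 0 * error A C send i k t b 0).
    by apply: measurable_funM; exact: measurable_error.
  by apply/funext => t; rewrite /X [LHS]mxE big_ord1 [_^T _ _]mxE.
have mD : measurable_fun setT D.
  by apply/measurable_EFinP; exact: (measurable_int P) iD.
have iX : P.-integrable setT (EFin \o X).
  apply/integrableP; split; first exact/measurable_EFinP.
  have /integrableP[_] := iD; apply: le_lt_trans; rewrite le_eqVlt; apply/orP; left; apply/eqP.
  apply: ae_eq_integral => //.
  - by apply/measurable_EFinP; apply: measurableT_comp => //.
  - by apply/measurable_EFinP; apply: measurableT_comp => //.
  have := error_mul_ae a b (fun=> 1); apply: filterS => t /= E _.
  by move: E; rewrite !mulr1 -/(X t) -/(D t) => ->.
apply: (is_cond_expP info_gen_measurable iX iW) => [B mB|E HE].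
  have := measurable_info_word_fun (f := fun w _ => word_cov w a b)
    (fun w _ => measurable_cst _).
  by move=> /(_ measurableT _ mB); rewrite setTI.
have mE := sub_sigma_measurable info_gen_measurable HE.
have mI : measurable_fun setT (\1_E : T -> R) by exact: measurable_indic.
have mW : measurable_fun setT W.
  by apply/measurable_EFinP; exact: (measurable_int P) iW.
have D0 : \E (fun t => (D t - W t) * \1_E t) = 0.
  have := deviation_covariance (delta_mx a 0) (delta_mx b 0) HE.
  by move=> D0; rewrite -[RHS]D0; apply: eq_Rintegral => t _; rewrite bform_delta.
rewrite -[RHS]D0 /Rintegral; congr fine; apply: ae_eq_integral => //.
- by apply/measurable_EFinP; apply: measurable_funM => //; apply: measurable_funB.
- by apply/measurable_EFinP; apply: measurable_funM => //; apply: measurable_funB.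
have := error_mul_ae a b (fun=> 1); apply: filterS => t /= E1 _.
by move: E1; rewrite !mulr1 -/(X t) -/(D t) => ->.
Qed.

Lemma filtering_cov_mean a b :
  P.-integrable setT (EFin \o (fun t => filtering_cov A C send i k t a b)) /\
  \E (fun t => filtering_cov A C send i k t a b) =
  \sum_(w <- words k.+1) weight w * word_cov w a b.
Proof.
have c := word_cov_is_cond_exp a b; have c' := cond_exp_is c.
have [_ iZ _] := c'.
have E : (fun t => filtering_cov A C send i k t a b) =
    cond_exp P (information A C send i k)
    (fun t => (error A C send i k t *m (error A C send i k t)^T) a b).
  by apply/funext => t; rewrite [LHS]mxE.
rewrite E; split => //; rewrite -(Rintegral_word_fun (fun w => word_cov w a b)).
have GT : <<s info_gen>> setT by exact: (@measurableT _ IT).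
by rewrite (is_cond_exp_Rintegral c' GT) (is_cond_exp_Rintegral c GT).
Qed.

End horizon.

Lemma sum_weight k : \sum_(w <- words k) weight w = 1.
Proof.
case: k => [|k].
  rewrite /= big_seq1; have := prob_pattern [::]; rewrite [pattern _](_ : _ = setT).
    by rewrite probability_setT => -[].
  by apply/seteqP; split.
have := Rintegral_word_fun k (fun=> 1); under [RHS]eq_bigr do rewrite mulr1.
by move=> <-; rewrite Rintegral_cst // mul1r -[RHS]/(fine 1%E); congr fine; exact: probability_setT.
Qed.

Lemma mean_prediction_cov_words k : mean_prediction_cov A C Q S0 send i k =
  \sum_(w <- words k) weight w *: cov_along A C Q S0 V (nth false w) k.
Proof.
apply/matrixP => a b; rewrite mxE summxE.
case: k => [|k].
  rewrite /= expectation_cst /= big_seq1 mxE; have := sum_weight 0; rewrite /= big_seq1 => ->.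
  by rewrite mul1r.
pose f (x : 'I_n * 'I_n) t := A a x.2 * A b x.1 * filtering_cov A C send i k t x.2 x.1.
have conjE (F : 'M[R]_n) : (A *m F *m A^T) a b =
    \sum_(x : 'I_n * 'I_n) A a x.2 * A b x.1 * F x.2 x.1.
  rewrite mxE -(pair_bigA _ (fun x y => A a y * A b x * F y x)) /=.
  apply: eq_bigr => x _; rewrite !mxE mulr_suml; apply: eq_bigr => y _.
  by rewrite mulrAC.
have fi x : P.-integrable setT (EFin \o f x).
  have [H _] := filtering_cov_mean k x.2 x.1.
  exact: eq_integrable (integrableZl measurableT (A a x.2 * A b x.1) H).
have [iF EF] := @Rintegral_sum_seq _ _ _ P _ (index_enum _) f (fun x _ => fi x).
have iQ : P.-integrable setT (EFin \o (fun=> Q a b)).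
  exact: (probability_bounded_integrable P (M := `|Q a b|)).
rewrite unlock -/(Rintegral _ _ _).
transitivity (\E (fun t => \sum_x f x t + Q a b)).
  by apply: eq_Rintegral => t _; rewrite /= mxE conjE.
rewrite RintegralD // EF Rintegral_cst //.
rewrite [X in _ + _ * X](_ : _ = 1); last first.
  by rewrite -[RHS]/(fine 1%E); congr fine; exact: probability_setT.
transitivity (\sum_(w <- words k.+1) weight w * ((A *m word_cov k w *m A^T) a b + Q a b)).
  under [RHS]eq_bigr do rewrite mulrDr conjE mulr_sumr.
  rewrite big_split /=; congr (_ + _); last first.
    by rewrite mulr1 -[LHS]mul1r -(sum_weight k.+1) mulr_suml.
  rewrite exchange_big /=; apply: eq_bigr => x _.
  have [H1 H2] := filtering_cov_mean k x.2 x.1.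
  rewrite RintegralZl // H2 mulr_sumr; apply: eq_bigr => w _.
  by rewrite mulrCA.
by apply: eq_bigr => w _; rewrite [RHS]mxE /= [in RHS]mxE.
Qed.

Lemma expected_trace_words k : expected_trace A C Q S0 send i k =
  \sum_(w <- words k) weight w * \tr (cov_along A C Q S0 V (nth false w) k).
Proof.
rewrite /expected_trace mean_prediction_cov_words raddf_sum /=.
by apply: eq_bigr => w _; rewrite mxtraceZ.
Qed.

End filtering.

(** * Mean error covariance and the threshold *)

Section bernoulli_weight.
Variables (R : realType) (n m : nat).
Variables (A : 'M[R]_n) (C : 'M[R]_(m, n)) (Q : 'M[R]_n) (V : 'M[R]_m) (q : R).

Definition bernoulli_weight (w : seq bool) : R := \prod_(b <- w) (if b then q else 1 - q).

(** [cov_along] recurses on the last arrival and [mean_trace] on the first; the shift reconciles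
    them. *)
Lemma cov_along_shift X g k : cov_along A C Q X V g k.+1 =
  cov_along A C Q (riccati_step A C Q V (g 0) X) V (fun j => g j.+1) k.
Proof. by elim: k => [//|k IH] /=; rewrite -IH. Qed.

Lemma mean_trace_words k X : mean_trace A C Q V q k X =
  \sum_(w <- words k) bernoulli_weight w * \tr (cov_along A C Q X V (nth false w) k).
Proof.
elim: k X => [|k IH] X; first by rewrite /= big_seq1 /bernoulli_weight big_nil mul1r.
rewrite [words _]/= [LHS]/= !IH big_cat !big_map !mulr_sumr /=.
congr (_ + _); apply: eq_bigr => w _;
  by rewrite -/(cov_along _ _ _ _ _ _ k.+1) cov_along_shift /bernoulli_weight big_cons /= mulrA.
Qed.

End bernoulli_weight.

(** * Arrival patterns built from independent sources *)

Section independent_arrivals.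
Variables (R : realType) (d : measure_display) (T : measurableType d).
Variables (P : probability T R) (I : eqType) (F : I -> set (set T)).
Variables (arr : nat -> T -> bool) (S : nat -> seq I) (D : I -> set T) (q : R).
Hypothesis indep : mutually_independent P F.
Hypothesis F_measurable : forall x E, F x E -> measurable E.
Hypothesis S_uniq : forall j, uniq (S j).
Hypothesis S_disjoint : forall j k x, x \in S j -> x \in S k -> j = k.
Hypothesis FD : forall j x, x \in S j -> F x (D x).
Hypothesis arrE : forall j, [set t | arr j t] = \bigcap_(x in [set` S j]) D x.
Hypothesis arr_prob : forall j, (\prod_(x <- S j) P (D x))%E = q%:E.

Let pattern (w : seq bool) : set T := [set t | mkseq (arr ^~ t) (size w) = w].

Let measurable_seq (J : seq I) E : (forall x, x \in J -> F x (E x)) ->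
  measurable (\bigcap_(x in [set` J]) E x).
Proof.
move=> FE; apply: fin_bigcap_measurable => [|x /= xJ]; first exact: finite_seq.
exact: F_measurable (FE x xJ).
Qed.

Let measurable_arr j : measurable [set t | arr j t].
Proof. by rewrite arrE; apply: measurable_seq => x; exact: FD. Qed.

Let pattern_rcons w b : pattern (rcons w b) = pattern w `&` [set t | arr (size w) t = b].
Proof.
apply/seteqP; split=> t; rewrite /pattern /= size_rcons mkseqS.
  by move/rcons_inj => -[].
by move=> [-> ->].
Qed.

Let measurable_pat w : measurable (pattern w).
Proof.
elim/last_ind: w => [|w b IH].
  by rewrite [pattern _](_ : _ = setT) //; apply/seteqP; split.
rewrite pattern_rcons; apply: measurableI => //; case: b; first exact: measurable_arr.
rewrite (_ : [set t | _] = ~` [set t | arr (size w) t]); first exact: measurableC.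
by apply/seteqP; split=> t /=; [move=> ->|move/negP/negbTE].
Qed.

(** The word grows at its end. A final arrival is an intersection of source events, so its sources
    [S (size w)] join the list J; a final loss follows by subtracting the arrival case from the
    shorter word. This is why the extra events E are carried through the induction. *)
Lemma independent_pattern w (J : seq I) (E : I -> set T) :
  uniq J -> (forall j x, (j < size w)%N -> x \in S j -> x \notin J) ->
  (forall x, x \in J -> F x (E x)) ->
  P ([set t | mkseq (arr ^~ t) (size w) = w] `&` \bigcap_(x in [set` J]) E x) =
  ((bernoulli_weight q w)%:E * \prod_(x <- J) P (E x))%E.
Proof.
rewrite -/(pattern w); elim/last_ind: w J E => [|w b IH] J E uJ dJ FE.
  rewrite [pattern _](_ : _ = setT); last by apply/seteqP; split.
  by rewrite setTI /bernoulli_weight big_nil mul1e indep.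
have dJ' j x : (j < size w)%N -> x \in S j -> x \notin J.
  by move=> jw; apply: (dJ j); rewrite size_rcons ltnS ltnW.
have IHJ := IH J E uJ dJ' FE.
pose J' := S (size w) ++ J.
pose E' x := if x \in S (size w) then D x else E x.
have SJ x : x \in S (size w) -> x \notin J by apply: (dJ (size w)); rewrite size_rcons.
have E'J x : x \in J -> E' x = E x.
  by move=> xJ; rewrite /E'; case: ifP => // /SJ; rewrite xJ.
have uJ' : uniq J'.
  rewrite cat_uniq S_uniq uJ andbT /=; apply/hasPn => x xJ.
  by apply/negP => /SJ; rewrite xJ.
have dJ2 j x : (j < size w)%N -> x \in S j -> x \notin J'.
  move=> jw xj; rewrite mem_cat negb_or (dJ' j) // andbT; apply/negP => xw.
  by move: jw; rewrite (S_disjoint xj xw) ltnn.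
have FE' x : x \in J' -> F x (E' x).
  rewrite mem_cat /E' => /orP[xS|xJ]; first by rewrite xS; exact: FD xS.
  by case: ifP => [xS|_]; [exact: FD xS|exact: FE].
have capJ : \bigcap_(x in [set` J']) E' x =
    [set t | arr (size w) t] `&` \bigcap_(x in [set` J]) E x.
  rewrite arrE; apply/seteqP; split=> t /=.
    move=> H; split=> x /= xJ.
      by have := H x; rewrite /= mem_cat xJ /E' xJ; exact.
    by rewrite -E'J //; apply: H; rewrite /= mem_cat xJ orbT.
  move=> [HS HJ] x /=; rewrite mem_cat => /orP[xS|xJ].
    by rewrite /E' xS; exact: HS.
  by rewrite E'J //; exact: HJ.
have := IH J' E' uJ' dJ2 FE'.
rewrite capJ big_cat /= [X in (_ * (X * _))%E](_ : _ = q%:E); last first.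
  rewrite -(arr_prob (size w)) big_seq [RHS]big_seq; apply: eq_bigr => x xS.
  by rewrite /E' xS.
rewrite [X in (_ * (_ * X))%E](_ : _ = (\prod_(x <- J) P (E x))%E); last first.
  by rewrite big_seq [RHS]big_seq; apply: eq_bigr => x /E'J ->.
rewrite muleA -EFinM => IHT.
have -> : bernoulli_weight q (rcons w b) = bernoulli_weight q w * (if b then q else 1 - q).
  by rewrite /bernoulli_weight -cats1 big_cat big_seq1.
have cE : (\prod_(x <- J) P (E x))%E \is a fin_num.
  by rewrite -(indep uJ FE); apply: fin_num_measure; exact: measurable_seq.
move: IHJ IHT; rewrite -(fineK cE); set c := fine _ => IHJ IHT.
rewrite pattern_rcons; case: b dJ => dJ.
  by rewrite -setIA.
set B := [set t | arr (size w) t] in IHT *.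
have mA : measurable (pattern w `&` \bigcap_(x in [set` J]) E x).
  by apply: measurableI; [exact: measurable_pat|exact: measurable_seq].
have HDI : P (pattern w `&` \bigcap_(x in [set` J]) E x) =
   (P ((pattern w `&` \bigcap_(x in [set` J]) E x) `\` B) +
    P ((pattern w `&` \bigcap_(x in [set` J]) E x) `&` B))%E.
  exact: measureDI mA (measurable_arr (size w)).
have E1 : (pattern w `&` \bigcap_(x in [set` J]) E x) `&` B =
    pattern w `&` (B `&` \bigcap_(x in [set` J]) E x).
  by rewrite -setIA [B `&` _]setIC.
have E2 : (pattern w `&` \bigcap_(x in [set` J]) E x) `\` B =
    pattern w `&` [set t | arr (size w) t = false] `&` \bigcap_(x in [set` J]) E x.
  apply/seteqP; split=> t /= [[]].
    by move=> pw Et /negP/negbTE.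
  by move=> pw aw Et; split=> //; rewrite /B /= aw.
move: HDI; rewrite E1 E2 IHJ IHT.
set X := P _.
have [x ->] : exists x, X = x%:E.
  exists (fine X); rewrite fineK //; apply: fin_num_measure; apply: measurableI.
    by rewrite -pattern_rcons; exact: measurable_pat.
  exact: measurable_seq.
by rewrite -!EFinM -EFinD => -[H]; congr EFin; rewrite mulrBr mulr1 mulrBl H; ring.
Qed.

End independent_arrivals.

(** * Expected traces under the law of the model *)

Section law.
Variables (R : realType) (n m : nat).
Variables (A : 'M[R]_n) (C : 'M[R]_(m, n)) (Q S0 : 'M[R]_n) (V : 'M[R]_m).
Variables (p1 p2 : R) (M : realization R n m).
Hypothesis pQ : posdef Q.
Hypothesis pV : posdef V.
Hypothesis pS0 : posdef S0.
Hypothesis law : realization_law Q V p1 p2 S0 M.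

Local Notation P := (Pr M).

Definition reception_prob (i : receiver) : R := if i is user then p1 else p2.

Lemma bernoulli_reception i k : bernoulli_event P (reception M i k) (reception_prob i).
Proof. by case: law => _ _ _ H _; have [] := H k; case: i. Qed.

Lemma sigma_bool_measurable (b : Omega M -> bool) p E :
  bernoulli_event P b p -> sigma_bool b E -> measurable E.
Proof.
move=> [mb _] [B ->].
have mT : measurable_fun setT b by apply: (measurable_fun_bool true); rewrite setTI preimage_true.
by rewrite -[X in measurable X]setTI; apply: mT.
Qed.

Lemma sigma_vec_measurable k (X : Omega M -> 'cV[R]_k) (S : 'M[R]_k) E :
  centered_gaussian P X S -> sigma_vec X E -> measurable E.
Proof.
move=> [mX _]; apply: smallest_sub; first exact: sigma_algebra_measurable.
by move=> _ [l [B [mB ->]]]; rewrite -[X in measurable X]setTI; exact: mX.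
Qed.

Lemma source_sigma_measurable p x E : 0 <= p <= 1 -> source_sigma M p x E -> measurable E.
Proof.
case: law => g0 gw gv br /[apply] -[bd _].
case: x => [|k|k|k|i k]; [exact: sigma_vec_measurable g0|exact: sigma_vec_measurable (gw k)
  |exact: sigma_vec_measurable (gv k)|exact: sigma_bool_measurable (bd k)|].
exact: sigma_bool_measurable (bernoulli_reception i k).
Qed.

Definition arrival_sources (b : bool) (i : receiver) (j : nat) : seq source :=
  Reception i j :: (if b then [:: SensorDecision j] else [::]).

Definition arrival_event (p : R) (x : source) : set (Omega M) :=
  match x with
  | SensorDecision j => [set t | decision M p j t]
  | Reception i j => [set t | reception M i j t]
  | _ => setT
  end.

(* The mechanism sends always if [b] is false, and at random otherwise. *)
Lemma expected_trace_law (b : bool) p i k : 0 <= p <= 1 ->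
  expected_trace A C Q S0 (fun j t => b ==> decision M p j t) i k =
  mean_trace A C Q V ((if b then p else 1) * reception_prob i) k S0.
Proof.
move=> p01; have [g0 gw gv _ /(_ p p01)[bd ind]] := law.
have memS j x : x \in arrival_sources b i j -> x = Reception i j \/ b /\ x = SensorDecision j.
  rewrite inE => /predU1P[|]; first by left.
  by case: (b) => //; rewrite inE => /eqP; right.
have FD j x : x \in arrival_sources b i j -> source_sigma M p x (arrival_event p x).
  have tE (f : Omega M -> bool) : sigma_bool f [set t | f t].
    by exists [set true]; apply/seteqP; split.
  by move=> /memS[->|[_ ->]]; exact: tE.
have arrE j : [set t | arrival (fun j t => b ==> decision M p j t) i j t] =
    \bigcap_(x in [set` arrival_sources b i j]) arrival_event p x.
  apply/seteqP; split=> t; rewrite /= /arrival.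
    by move=> /andP[dt rt] x /= /memS[->//|[bT ->]]; move: dt; rewrite bT.
  move=> H; apply/andP; split; last by apply: (H (Reception i j)); rewrite /= mem_head.
  apply/implyP => bT; apply: (H (SensorDecision j)).
  by rewrite /arrival_sources /= bT !inE eqxx orbT.
have mx x E : source_sigma M p x E -> measurable E := source_sigma_measurable p01.
have marr j : measurable [set t | arrival (fun j t => b ==> decision M p j t) i j t].
  rewrite arrE; apply: fin_bigcap_measurable => [|x /= xJ]; first exact: finite_seq.
  exact: mx (FD _ _ xJ).
have US j : uniq (arrival_sources b i j).
  by rewrite /arrival_sources; case: (b) => //=; rewrite inE andbT; apply/eqP.
have DS j j' x : x \in arrival_sources b i j -> x \in arrival_sources b i j' -> j = j'.
  by move=> /memS[->|[_ ->]] /memS[|[_]] // [].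
have PS j : (\prod_(x <- arrival_sources b i j) P (arrival_event p x))%E =
    ((if b then p else 1) * reception_prob i)%:E.
  have [_ br] := bernoulli_reception i j; have [_ bdj] := bd j.
  rewrite /arrival_sources big_cons br; case: (b).
    by rewrite big_seq1 bdj -EFinM mulrC.
  by rewrite big_nil mule1 mul1r.
rewrite mean_trace_words.
apply: (expected_trace_words A C pQ pV pS0 g0 gw gv marr) => w J E uJ /allP JN HE.
apply: (independent_pattern ind mx US DS FD arrE PS uJ) => [j x _ /memS xS|x xJ].
  by apply/negP => /JN; case: xS => [->|[_ ->]].
by have := HE x xJ; have := JN x xJ; case: x {xJ}.
Qed.

End law.

(** * Limit superior and the equivalence with secrecy *)

Section limsup.
Variable R : realType.
Implicit Type u : nat -> R.

Lemma bounded_limsup_finite u B : (forall k, u k <= B) -> limsup_finite u.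
Proof.
move=> uB; rewrite /limsup_finite; apply: (@le_lt_trans _ _ B%:E); last exact: ltry.
rewrite limn_esup_lim; apply: lime_le; first exact: is_cvg_esups.
near=> k; apply: ge_ereal_sup => _ [j _ <-].
by rewrite lee_fin.
Unshelve. all: by end_near.
Qed.

Lemma cvgy_limsup_infinite u : u k @[k --> \oo] --> +oo -> ~ limsup_finite u.
Proof.
move=> cu; rewrite /limsup_finite.
have cu' : (u k)%:E @[k --> \oo] --> +oo%E by apply/cvgeryP.
have [_ ->] := cvg_limn_einf_sup cu'.
by rewrite ltxx.
Qed.

End limsup.

(** At q = 0 the quotient is infinite by convention and the right side reads 0 <= pc; the minimum
    with 1 is absorbed by p <= 1. *)
Lemma le_mine_div (R : realType) (p pc q : R) : p <= 1 -> 0 < pc -> 0 <= q ->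
  (p%:E <= mine (div_or_pinfty pc q) 1)%E <-> p * q <= pc.
Proof.
move=> p1 pc0 q0; rewrite /div_or_pinfty; case: eqVneq => [->|q0'].
  rewrite mulr0 (ltW pc0) min_r ?leey // lee_fin p1; by split.
have {}q0 : 0 < q by rewrite lt_def q0'.
by rewrite le_min !lee_fin p1 andbT ler_pdivlMr.
Qed.

Theorem theorem1 (R : realType) (n m : nat)
    (A : 'M[R]_n) (C : 'M[R]_(m, n)) (Q Qh : 'M[R]_n) (Rv : 'M[R]_m)
    (p1 p2 : R) (M : 'M[R]_n -> realization R n m)
    (posdef_Q : posdef Q) (posdef_Rv : posdef Rv)
    (unstable_A : 1 < spectral_radius A)
    (sqrt_Q : is_psd_sqrt Q Qh)
    (stabilizable_A_Qh : stabilizable A Qh)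
    (detectable_A_C : detectable A C)
    (p1_01 : 0 <= p1 <= 1) (p2_01 : 0 <= p2 <= 1)
    (law_M : forall S0 : 'M[R]_n, posdef S0 ->
       realization_law Q Rv p1 p2 S0 (M S0))
    (user_bounded : forall S0 : 'M[R]_n, posdef S0 ->
       limsup_finite (expected_trace A C Q S0 (always_send M S0) user)) :
  ((exists p : R, 0 <= p <= 1 /\
      perfect_expected_secrecy A C Q (random_send M p))
     <-> p2 < p1)
  /\
  (exists pc : R, 0 <= pc < 1 /\
     forall p : R, 0 <= p <= 1 ->
       (perfect_expected_secrecy A C Q (random_send M p) <->
        pc / p1 < p /\ (p%:E <= mine (div_or_pinfty pc p2) 1)%E)).
Proof.
have always S0 : posdef S0 -> expected_trace A C Q S0 (always_send M S0) user =
    fun k => mean_trace A C Q Rv p1 k S0.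
  move=> pS; apply/funext => k.
  (* With b false the decisions do not enter the arrivals; the parameter 0 is an arbitrary
     choice. *)
  have zero01 : 0 <= (0 : R) <= 1 by rewrite lexx ler01.
  by rewrite -(mul1r p1); exact: (expected_trace_law A C posdef_Q posdef_Rv pS (law_M S0 pS)
    false user k zero01).
have random (p : R) i S0 : 0 <= p <= 1 -> posdef S0 ->
    expected_trace A C Q S0 (random_send M p S0) i =
    fun k => mean_trace A C Q Rv (p * reception_prob p1 p2 i) k S0.
  move=> p01 pS; apply/funext => k.
  exact: (expected_trace_law A C posdef_Q posdef_Rv pS (law_M S0 pS)
    true i k p01).
have finiteP (q : R) S0 : 0 <= q <= 1 -> posdef S0 ->
    limsup_finite (fun k => mean_trace A C Q Rv q k S0) <-> bounded_mean A C Q Rv q.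
  move=> q01 /posdef_possemidef pS; split=> [fin|bd].
    apply: contrapT => nb; apply: cvgy_limsup_infinite fin.
    exact: unbounded_mean_cvg.
  have [B HB] := bounded_mean_any q01 posdef_Q posdef_Rv pS bd.
  exact: bounded_limsup_finite HB.
(* Taking Q as the initial covariance turns the assumption on the user into [bounded_mean] at p1. *)
have bp1 : bounded_mean A C Q Rv p1.
  by apply/(finiteP _ _ p1_01 posdef_Q); rewrite -always //; exact: user_bounded.
have [pc /andP[pc0 pcp1] Hpc] :=
  mean_trace_threshold posdef_Q posdef_Rv unstable_A p1_01 bp1.
have [p1_ge0 p1_le1] := andP p1_01; have [p2_ge0 p2_le1] := andP p2_01.
have mul01 (p q : R) : 0 <= p <= 1 -> 0 <= q <= 1 -> 0 <= p * q <= 1.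
  by move=> /andP[p0 p1'] /andP[q0 q1]; rewrite mulr_ge0 //= mulr_ile1.
have secrecyP (p : R) : 0 <= p <= 1 -> perfect_expected_secrecy A C Q (random_send M p) <->
    pc < p * p1 /\ p * p2 <= pc.
  move=> p01; have q1 := mul01 _ _ p01 p1_01; have q2 := mul01 _ _ p01 p2_01.
  split=> [sec|[lt1 le2] S0 pS].
    (* One initial covariance, here Q, yields both inequalities, since the regime is the same for
       all of them. *)
    have [] := sec Q posdef_Q; rewrite !random //= => toy fin; split.
      by apply/(Hpc _ q1); apply/(finiteP _ _ q1 posdef_Q).
    rewrite leNgt; apply/negP => /(Hpc _ q2)/(finiteP _ _ q2 posdef_Q).
    exact: cvgy_limsup_infinite.
  rewrite !random //=; split; last by apply/(finiteP _ _ q1 pS)/(Hpc _ q1).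
  apply: unbounded_mean_cvg => //; first exact: posdef_possemidef.
  by move/(Hpc _ q2); rewrite ltNge le2.
have p1_gt0 : 0 < p1 := lt_trans pc0 pcp1.
split; last first.
  exists pc; rewrite ltW // (lt_le_trans pcp1) //; split=> // p p01.
  have [p_ge0 p_le1] := andP p01.
  rewrite ltr_pdivrMr //; split=> [/(secrecyP _ p01)[? ?]|[? le2]].
    by split=> //; apply/(le_mine_div p_le1 pc0 p2_ge0).
  by apply/(secrecyP _ p01); split=> //; apply/(le_mine_div p_le1 pc0 p2_ge0).
split=> [[p [p01 /(secrecyP _ p01)[lt1 le2]]]|p21].
  have [p_ge0 _] := andP p01.
  rewrite ltNge; apply/negP => p12.
  by have := lt_le_trans lt1 (le_trans (ler_wpM2l p_ge0 p12) le2); rewrite ltxx.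
(* If p2 <= pc, sending always already defeats the eavesdropper. Otherwise p = pc / p2 is the
   largest rate that does so, and p1 > p2 leaves the user above pc. *)
have [p2pc|pcp2] := leP p2 pc.
  exists 1; rewrite ler01 lexx; split=> //; apply/secrecyP; rewrite ?ler01 ?lexx //.
  by rewrite !mul1r.
have p2_gt0 : 0 < p2 := lt_trans pc0 pcp2.
have p01 : 0 <= pc / p2 <= 1.
  by rewrite divr_ge0 ?(ltW pc0) //= ler_pdivrMr // mul1r ltW.
exists (pc / p2); split=> //; apply/(secrecyP _ p01).
rewrite divfK ?gt_eqF // lexx; split=> //.
by rewrite mulrAC ltr_pdivlMr // ltr_pM2l.
Qed.
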